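(* Let $n\geq 2$, $q=p^h$ with $p$ prime and $h\geq 1$, and $1\leq k\leq n-1$. Suppose that one of the following holds: (i) $h=1$, $q\geq 11$, and $\delta=\frac12\left((\sqrt{2}-1)q^k-3\theta_{k-1}-8\right)\geq 0$; (ii) $h\geq 2$, $k\geq 2$, $q\geq 25$, and $\delta=\frac12\left(q^{k-1}-\theta_{k-2}-3\right)$. Let $\mathcal{H}(n,n-k,q)$ be the hypergraph whose vertices are the points of $\mathrm{PG}(n,q)$ and whose hyperedges are the $(n-k)$-dimensional subspaces. Then: a) If $k<\frac{n}{2}$, then any rainbow-free strict $N$-coloring of $\mathcal{H}(n,n-k,q)$ with \[N\geq \theta_n-\tau_2(\mathcal{H}(n,n-k,q))+1-\delta=\theta_n-2\theta_k+1-\delta\] has a color class containing two disjoint $k$-dimensional subspaces (and hence the coloring has a monochromatic $2$-transversal). b) If $k\geq \frac{n}{2}$, then $\bar\chi(\mathcal{H}(n,n-k,q))<\theta_n-2\theta_k+1-\delta$.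
   Context: For a hypergraph $\mathcal{H}=(V;E)$, a strict $N$-coloring is a partition of $V$ into exactly $N$ nonempty color classes. A hyperedge is rainbow if no two of its vertices have the same color; a coloring is rainbow-free if no hyperedge is rainbow. The upper chromatic number $\bar\chi(\mathcal{H})$ is the largest $N$ such that $\mathcal{H}$ admits a rainbow-free strict $N$-coloring. A $2$-transversal is a vertex set meeting every hyperedge in at least $2$ vertices, and $\tau_2(\mathcal{H})$ is the minimum size of a $2$-transversal. Dimensions are projective, and $\theta_m=\frac{q^{m+1}-1}{q-1}$ is the number of points of an $m$-dimensional projective space of order $q$. *)

(* Defs.v *)
From HB Require Import structures.
From mathcomp Require Import all_boot all_order all_algebra.

Set Implicit Arguments.
Unset Strict Implicit.
Unset Printing Implicit Defensive.

Import Order.TTheory GRing.Theory Num.Theory.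

(* A hypergraph with vertex set the finite type V is given by its set of
   hyperedges H : {set {set V}}; a coloring is given by its set of color
   classes P : {set {set V}}. *)

Definition strict_coloring (V : finType) (N : nat) (P : {set {set V}}) : bool :=
  partition P [set: V] && (#|P| == N).

(* For a partition P of V, pblock P x is the color class of x. *)
Definition rainbow (V : finType) (P : {set {set V}}) (e : {set V}) : bool :=
  [forall x in e, forall y in e, (x != y) ==> (pblock P x != pblock P y)].

Definition rainbow_free (V : finType) (H P : {set {set V}}) : bool :=
  [forall e in H, ~~ rainbow P e].

(* Equal to 0 when H has no rainbow-free coloring at all, i.e., when some
   hyperedge has at most one vertex (or V is empty). *)
Definition upper_chromatic (V : finType) (H : {set {set V}}) : nat :=
  \max_(P : {set {set V}} | strict_coloring #|P| P && rainbow_free H P) #|P|.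

Definition two_transversal (V : finType) (H : {set {set V}}) (T : {set V}) :
    bool :=
  [forall e in H, (2 <= #|T :&: e|)%N].

(* Equal to #|V| when H has no 2-transversal, i.e., when some hyperedge has at
   most one vertex; otherwise [set: V] is a 2-transversal. *)
Definition tau2 (V : finType) (H : {set {set V}}) : nat :=
  #|[arg min_(T < [set: V] | two_transversal H T) #|T|]|.

(* The subspaces of PG(n, q), q = #|F|, of projective dimension d: row spaces
   of rank d + 1 in F^(n+1), each represented by its unique canonical
   generating matrix, so that equality of subspaces is Leibniz equality. *)
Definition pg_subspace (F : finFieldType) (n d : nat) : finType :=
  {U : 'M[F]_n.+1 | (<<U>>%MS == U) && (\rank U == d.+1)}.

Definition pg_point (F : finFieldType) (n : nat) : finType :=
  pg_subspace F n 0.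

Definition pg_points (F : finFieldType) (n d : nat) (U : pg_subspace F n d) :
    {set pg_point F n} :=
  [set x : pg_point F n | (val x <= val U)%MS].

Definition pg_hypergraph (F : finFieldType) (n d : nat) :
    {set {set pg_point F n}} :=
  [set pg_points U | U : pg_subspace F n d].

(* The division is exact for q >= 2. *)
Definition theta (q m : nat) : nat := ((q ^ m.+1 - 1) %/ (q - 1))%N.

(* Main.v *)
Require Import Defs.
From HB Require Import structures.
From mathcomp Require Import all_boot all_order all_algebra.
From mathcomp Require Import all_fingroup all_field.
From mathcomp Require Import zify ring lra.

Set Implicit Arguments.
Unset Strict Implicit.
Unset Printing Implicit Defensive.

Import Order.TTheory GRing.Theory Num.Theory.
Local Open Scope ring_scope.

(** Let [T] be the union of the color classes with at least two points.  Every
    (n-k)-space contains two points of [T] of the same color, so [T] is a double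
    blocking set with respect to (n-k)-spaces.  A random linear map onto
    F^(k+1) that kills no point of [T] and separates two chosen points of most
    classes from the rest of their class gives |T| <= 2 theta_k + 2 delta + 5.
    Such a double blocking set contains two disjoint k-spaces.  For k = 1 this
    is a second moment count over hyperplanes; for larger k most hyperplane
    sections satisfy the induction hypothesis, so [T] contains so many
    (k-1)-spaces that some k-space is covered by them too well not to lie in
    [T].  When q is prime, |T| is first brought down: with K = GF(q^k), the
    (n-k)-spaces are the zero sets of the K-linear functionals on K^(n+1), and
    a Redei type polynomial argument shows that a functional has two or at
    least p + 1 zeros in a minimal [T]; the second moment then forces |T| to be
    close to 2 theta_k.  Finally, a suitable linear map isolates a point x1 of
    one k-space and a point x2 of the other from the rest of [T], so that they
    have the same color. *)

Section DoubleCounting.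
Local Open Scope nat_scope.
Variables (I U : finType) (T : {set I}) (e : I -> pred U).

Lemma sum_card_incidence (S : {set U}) :
  (\sum_(u in S) #|[set i in T | e i u]| = \sum_(i in T) #|[set u in S | e i u]|).
Proof.
transitivity (\sum_(u in S) \sum_(i in T) e i u).
  apply: eq_bigr => u _; rewrite -sum1_card big_mkcond [RHS]big_mkcond /=.
  by apply: eq_bigr => i _; rewrite inE; case: (i \in T); case: (e i u).
rewrite exchange_big; apply: eq_bigr => i _; rewrite -sum1_card big_mkcond [RHS]big_mkcond /=.
by apply: eq_bigr => u _; rewrite inE; case: (u \in S); case: (e i u).
Qed.

Lemma sum_card_incidenceT :
  \sum_u #|[set i in T | e i u]| = \sum_(i in T) #|[set u | e i u]|.
Proof.
transitivity (\sum_(u in [set: U]) #|[set i in T | e i u]|).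
  by apply: eq_bigl => u; rewrite inE.
rewrite sum_card_incidence; apply: eq_bigr => i _; apply: eq_card => u.
by rewrite !inE.
Qed.

Lemma sum_sqr_card_incidence a z :
  (forall i, i \in T -> #|[set u | e i u]| = a) ->
  (forall i j, i \in T -> j \in T -> i != j -> #|[set u | e i u && e j u]| = z) ->
  (\sum_u #|[set i in T | e i u]| * #|[set i in T | e i u]| = #|T| * a + #|T| * (#|T| - 1) * z).
Proof.
move=> ea ez; transitivity (\sum_(u in [set: U]) \sum_(i in T) e i u * #|[set j in T | e j u]|).
  apply: eq_big => [u|u _]; first by rewrite inE.
  rewrite -big_distrl; congr (_ * _); rewrite -sum1_card big_mkcond [RHS]big_mkcond /=.
  by apply: eq_bigr => i _; rewrite inE; case: (i \in T); case: (e i u).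
rewrite exchange_big -mulnA -mulnDr -sum_nat_const /=; apply: eq_bigr => i iT.
transitivity (\sum_(u in [set u | e i u]) #|[set j in T | e j u]|).
  rewrite [RHS]big_mkcond; apply: eq_big => [u|u _]; rewrite ?inE //.
  by case: (e i u); rewrite ?mul1n ?mul0n.
rewrite sum_card_incidence (bigD1 i iT) /=; congr (_ + _).
  by rewrite -(ea i iT); apply: eq_card => u; rewrite !inE andbb.
rewrite -(_ : #|T :\ i| = #|T| - 1); last by rewrite (cardsD1 i T) iT addKn.
rewrite -sum_nat_const; apply: eq_big => [j|j /andP[jT ji]]; first by rewrite !inE andbC.
by rewrite -(ez i j) 1?eq_sym //; apply: eq_card => u; rewrite !inE.
Qed.

End DoubleCounting.

(** * Bivariate polynomials and their rational zeros *)

Lemma size_linear_le (R : nzRingType) (s t : R) : (size (s *: 'X + t%:P)%R <= 2)%N.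
Proof.
apply: leq_trans (size_polyD _ _) _; rewrite geq_max (leq_trans (size_polyC_leq1 _)) // andbT.
by apply: leq_trans (size_scale_leq _ _) _; rewrite size_polyX.
Qed.

Lemma linear_neq0 (R : nzRingType) (s t : R) :
  (s != 0) || (t != 0) -> s *: 'X + t%:P != 0.
Proof.
apply: contraTneq => E.
have := congr1 (fun p : {poly R} => p`_1) E; have := congr1 (fun p : {poly R} => p`_0) E.
rewrite !(coefD, coefZ, coefX, coefC, coef0) mulr0 mulr1 add0r addr0 => -> ->.
by rewrite eqxx.
Qed.

Section TotalDegree.
Variable R : idomainType.
Implicit Types F G : {poly {poly R}}.

(* Total degree at most d, in {poly {poly R}}. *)
Definition tdeg_le d F := forall i, (size (F`_i)%R <= d.+1 - i)%N.

Lemma tdeg_leW d e F : (d <= e)%N -> tdeg_le d F -> tdeg_le e F.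
Proof. by move=> de tF i; apply: leq_trans (tF i) _; lia. Qed.

Lemma tdeg_le0 d : tdeg_le d 0.
Proof. by move=> i; rewrite coef0 size_poly0. Qed.

Lemma tdeg_leD d F G : tdeg_le d F -> tdeg_le d G -> tdeg_le d (F + G).
Proof.
move=> tF tG i; rewrite coefD; apply: leq_trans (size_polyD _ _) _.
by rewrite geq_max tF tG.
Qed.

Lemma tdeg_leN d F : tdeg_le d F -> tdeg_le d (- F).
Proof. by move=> tF i; rewrite coefN size_polyN. Qed.

Lemma tdeg_leB d F G : tdeg_le d F -> tdeg_le d G -> tdeg_le d (F - G).
Proof. by move=> tF tG; apply: tdeg_leD => //; apply: tdeg_leN. Qed.

Lemma tdeg_leM d e F G : tdeg_le d F -> tdeg_le e G -> tdeg_le (d + e) (F * G).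
Proof.
move=> tF tG i; rewrite coefM.
apply: (big_ind (fun p : {poly R} => size p <= (d + e).+1 - i)%N).
- by rewrite size_poly0.
- by move=> p q hp hq; apply: leq_trans (size_polyD _ _) _; rewrite geq_max hp.
move=> j _; have [->|nF] := eqVneq F`_j 0; first by rewrite mul0r size_poly0.
have [->|nG] := eqVneq G`_(i - j) 0; first by rewrite mulr0 size_poly0.
rewrite size_mul //; have := tF j; have := tG (i - j)%N.
have := ltn_ord j; rewrite -size_poly_gt0 in nF; rewrite -size_poly_gt0 in nG.
lia.
Qed.

Lemma tdeg_le_size d F : tdeg_le d F -> (size F <= d.+1)%N.
Proof.
move=> tF; apply/leq_sizeP => i di; apply/eqP; rewrite -size_poly_leq0.
by apply: leq_trans (tF i) _; lia.
Qed.

Lemma tdeg_leC d (p : {poly R}) : (size p <= d.+1)%N -> tdeg_le d p%:P.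
Proof. by move=> sp [|i]; rewrite coefC //= size_poly0. Qed.

Lemma tdeg_leX : tdeg_le 1 'X.
Proof. by move=> i; rewrite coefX; case: i => [|[|i]] //=; rewrite ?size_poly0 ?size_poly1. Qed.

Lemma tdeg_leXn d : tdeg_le d 'X^d.
Proof.
move=> i; rewrite coefXn; case: eqP => [->|_] /=; rewrite ?size_poly0 ?size_poly1 //; lia.
Qed.

Lemma tdeg_le_deriv d F : tdeg_le d F -> tdeg_le d.-1 F^`().
Proof.
move=> tF i; rewrite coef_deriv -mulr_natl -polyC_natr mul_polyC.
apply: leq_trans (size_scale_leq _ _) _.
by apply: leq_trans (tF _) _; lia.
Qed.

Lemma tdeg_le_div d e F G : G \is monic -> size G = e.+1 -> tdeg_le e G ->
  (e <= d)%N -> tdeg_le d F ->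
  exists q r, [/\ F = q * G + r, (size r <= e)%N, tdeg_le (d - e) q & tdeg_le d r].
Proof.
move=> mG sG tG ed; have [m] := ubnP (size F); elim: m F => // m IH F sF tF.
have [sFe|sFe] := leqP (size F) e.
  by exists 0, F; split; rewrite ?mul0r ?add0r //; apply: tdeg_le0.
have [s sE] : {s | s = (size F).-1} by exists (size F).-1.
pose a := F`_s.
have sd : (s <= d)%N by have := tdeg_le_size tF; lia.
pose M : {poly {poly R}} := a%:P * 'X^(s - e).
have tM : tdeg_le (d - e) M.
  move=> i; rewrite /M coefCM coefXn; case: eqP => [->|_]; last by rewrite mulr0 size_poly0.
  by rewrite mulr1; apply: leq_trans (tF s) _; lia.
have tMG : tdeg_le d (M * G) by have := tdeg_leM tM tG; rewrite subnK.
have sMG : (size (M * G)%R <= s.+1)%N.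
  apply: leq_trans (size_polyMleq _ _) _; rewrite sG addnS /=.
  have : (size M <= (s - e).+1)%N.
    by rewrite /M mul_polyC; apply: leq_trans (size_scale_leq _ _) _; rewrite size_polyXn.
  by move=> hM; apply: leq_trans (leq_add hM (leqnn e)) _; lia.
have [||q [r [qE sr tq tr]]] := IH (F - M * G).
- suff h : (size (F - M * G)%R <= s)%N by apply: leq_ltn_trans h _; lia.
  apply/leq_sizeP => j; rewrite leq_eqVlt => /predU1P[<-|sj]; last first.
    rewrite coefB (leq_sizeP _ _ sMG) // nth_default ?subrr //.
    by apply: leq_trans sj; rewrite sE leqSpred.
  rewrite coefB /M -mulrA coefCM coefXnM ltnNge leq_subr /= subKn; last by lia.
  by have /monicP := mG; rewrite /lead_coef sG /= /a => ->; rewrite mulr1 subrr.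
- exact: tdeg_leB.
exists (q + M), r; split => //; last exact: tdeg_leD.
by rewrite mulrDl addrAC -qE subrK.
Qed.

End TotalDegree.

Section PlaneEvaluation.
Variable K : finFieldType.
Implicit Types (F G : {poly {poly K}}) (x y : K).

Lemma finField_card_eq0 : #|K|%:R = 0 :> K.
Proof.
have := erefl (\sum_(x : K) x); rewrite {1}(reindex_inj (addrI 1)) /=.
by rewrite big_split sumr_const /= => /(canRL (addrK _)); rewrite subrr.
Qed.

Lemma poly_eq0_on (S : {set K}) (p : {poly K}) :
  (size p <= #|S|)%N -> {in S, forall x, p.[x] = 0} -> p = 0.
Proof.
move=> sp p0; apply: (@roots_geq_poly_eq0 _ p (enum S)); rewrite ?enum_uniq -?cardE //.
by apply/allP => x; rewrite mem_enum => xS; apply/rootP/p0.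
Qed.

Definition evalY y F : {poly K} := map_poly (horner_eval y) F.

Lemma evalYM y F G : evalY y (F * G) = evalY y F * evalY y G.
Proof. exact: rmorphM. Qed.
Lemma evalYD y F G : evalY y (F + G) = evalY y F + evalY y G.
Proof. exact: rmorphD. Qed.
Lemma evalYC y (p : {poly K}) : evalY y p%:P = p.[y]%:P.
Proof. by rewrite /evalY map_polyC. Qed.
Lemma coef_evalY y F i : (evalY y F)`_i = (F`_i).[y].
Proof. by rewrite coef_map. Qed.

Lemma poly2_eq0 F : (forall i, size (F`_i)%R <= #|K|)%N -> (size F <= #|K|)%N ->
  (forall x y, (evalY y F).[x] = 0) -> F = 0.
Proof.
move=> sFi sF F0; apply/polyP => i; rewrite coef0.
apply: (@poly_eq0_on setT); rewrite ?cardsT // => y _.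
have -> : (F`_i).[y] = (evalY y F)`_i by rewrite coef_evalY.
rewrite (@poly_eq0_on setT (evalY y F)) ?coef0 // cardsT.
exact: leq_trans (size_poly _ _) sF.
Qed.

Definition subst2 (s t x y : K) F : {poly K} :=
  (map_poly (comp_poly (t *: 'X + y%:P)) F).[s *: 'X + x%:P].

Lemma subst2M s t x y F G : subst2 s t x y (F * G) = subst2 s t x y F * subst2 s t x y G.
Proof. by rewrite /subst2 rmorphM hornerM. Qed.
Lemma subst2D s t x y F G : subst2 s t x y (F + G) = subst2 s t x y F + subst2 s t x y G.
Proof. by rewrite /subst2 rmorphD hornerD. Qed.
Lemma subst2C s t x y (p : {poly K}) : subst2 s t x y p%:P = p \Po (t *: 'X + y%:P).
Proof. by rewrite /subst2 map_polyC hornerC. Qed.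

Lemma subst2_at0 s t x y F : (subst2 s t x y F).[0] = (evalY y F).[x].
Proof.
rewrite /subst2 /evalY -[LHS]/(horner_eval 0 _) -horner_map /= -map_poly_comp /=.
have -> : horner_eval 0 (s *: 'X + x%:P) = x by rewrite /horner_eval !hornerE ?mulr0 ?add0r.
congr (_.[x]); apply: eq_map_poly => p /=.
by rewrite /horner_eval horner_comp !hornerE ?mulr0 ?add0r.
Qed.

Definition ratPX : {poly {poly K}} := 'X^#|K| - 'X.
Definition ratPY : {poly {poly K}} := ('X^#|K| - 'X)%:P.

Lemma comp_genPoly (s x : K) : exists2 a : {poly K},
  (s *: 'X + x%:P) ^+ #|K| - (s *: 'X + x%:P) = 'X * a & a.[0] = - s.
Proof.
set q := s *: 'X + x%:P; pose p := ('X^#|K| - 'X) \Po q.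
have -> : q ^+ #|K| - q = p by rewrite /p rmorphB /= comp_Xn_poly comp_polyX.
have /factor_theorem[a pE] : root p 0.
  by rewrite /root horner_comp !hornerE ?mulr0 ?add0r expf_card subrr.
rewrite subr0 in pE; exists a; first by rewrite pE mulrC.
have : p^`().[0] = - s.
  rewrite deriv_comp hornerM horner_comp derivB derivXn derivX hornerD hornerMn.
  by rewrite -mulr_natr finField_card_eq0 /q !derivE !hornerE; ring.
by rewrite pE derivM derivX !hornerE ?mul0r ?addr0.
Qed.

Lemma subst2_ratPX s t x y : exists2 a : {poly K},
  subst2 s t x y ratPX = 'X * a & a.[0] = - s.
Proof.
have [a aE a0] := comp_genPoly s x; exists a => //; rewrite -aE.
by rewrite /subst2 /ratPX rmorphB /= map_polyXn map_polyX hornerD hornerN hornerXn hornerX.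
Qed.

Lemma subst2_ratPY s t x y : exists2 b : {poly K},
  subst2 s t x y ratPY = 'X * b & b.[0] = - t.
Proof. by have [b bE b0] := comp_genPoly t y; exists b; rewrite // subst2C rmorphB /= comp_Xn_poly comp_polyX. Qed.

Lemma evalY_ratPX y : evalY y ratPX = 'X^#|K| - 'X.
Proof. by rewrite /evalY /ratPX rmorphB /= map_polyXn map_polyX. Qed.

Lemma evalY_ratPY y : evalY y ratPY = 0.
Proof. by rewrite evalYC !hornerE expf_card subrr. Qed.

Lemma size_genPoly (R : nzRingType) : size ('X^#|K| - 'X : {poly R}) = #|K|.+1.
Proof. by rewrite size_polyDl size_polyXn // size_polyN size_polyX; apply: finNzRing_gt1. Qed.

Lemma monic_genPoly (R : nzRingType) : ('X^#|K| - 'X : {poly R}) \is monic.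
Proof.
rewrite monicE lead_coefDl ?lead_coefXn //.
by rewrite size_polyXn size_polyN size_polyX; apply: finNzRing_gt1.
Qed.

Lemma tdeg_le_ratPX : tdeg_le #|K| ratPX.
Proof.
apply: tdeg_leB; first exact: tdeg_leXn.
by apply: tdeg_leW (tdeg_leX K); apply: ltnW; apply: finNzRing_gt1.
Qed.

Lemma ratPY_div d F : (#|K| <= d)%N -> tdeg_le d F -> exists G r,
  [/\ F = ratPY * G + r, (size G <= size F)%N, (size r <= size F)%N,
      (forall i, size (r`_i)%R <= #|K|)%N & tdeg_le (d - #|K|) G].
Proof.
move=> Kd tF; pose g : {poly K} := 'X^#|K| - 'X.
have g0 : g != 0 by rewrite -size_poly_gt0 size_genPoly.
exists (\poly_(i < size F) (F`_i %/ g)), (\poly_(i < size F) (F`_i %% g)).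
split; rewrite ?size_poly //.
- apply/polyP => i; rewrite coefD coefCM !coef_poly; case: ifP => [_|/negbT].
    by rewrite mulrC -divp_eq.
  by rewrite -leqNgt => h; rewrite nth_default // mulr0 addr0.
- move=> i; rewrite coef_poly; case: ifP => _; rewrite ?size_poly0 //.
  by rewrite -ltnS -(size_genPoly K) ltn_modp.
- move=> i; rewrite coef_poly; case: ifP => _; rewrite ?size_poly0 //.
  rewrite size_divp // size_genPoly /=; move: (tF i) Kd; move: (size _) #|_| => u v; lia.
Qed.

End PlaneEvaluation.

Lemma dvdp_prod_X (R : idomainType) (I : finType) (U Z : {set I}) (g : I -> {poly R}) :
  Z \subset U -> {in Z, forall i, (g i).[0] = 0} -> 'X^#|Z| %| \prod_(i in U) g i.
Proof.
move=> ZU gZ; rewrite (bigID (mem Z)) /=; apply: dvdp_mulr.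
rewrite (eq_bigl (mem Z)) => [|i]; last by rewrite andbC; case iZ: (i \in Z); rewrite // (subsetP ZU).
have : \prod_(i in Z) 'X %| \prod_(i in Z) g i.
  apply: (big_ind2 (fun p q => p %| q)); rewrite ?dvdpp //; first by move=> *; apply: dvdp_mul.
  by move=> i iZ; rewrite -[X in X %| _]subr0 dvdp_XsubCl; apply/rootP/gZ.
by rewrite prodr_const.
Qed.

Lemma dvdp_X_horner0 (R : idomainType) (p : {poly R}) : ('X %| p) = (p.[0] == 0).
Proof. by rewrite -[X in X %| _]subr0 dvdp_XsubCl. Qed.

Section Certificate.
Variables (K : finFieldType) (I : finType) (b c : I -> K) (l1 l2 : {poly K}).
Implicit Types (U : {set I}) (x y : K) (i : I).
Local Notation Q := #|K|.
Local Notation A := (ratPX K).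
Local Notation B := (ratPY K).

Definition abscissa i : {poly K} := - (b i *: 'X + (c i)%:P).
Definition lineP i : {poly {poly K}} := 'X - (abscissa i)%:P.
Definition prodP U := \prod_(i in U) lineP i.
Definition incidence U x y := #|[set i in U | (abscissa i).[y] == x]|.

Lemma horner_abscissa i y : (abscissa i).[y] = - (b i * y + c i).
Proof. by rewrite /abscissa !hornerE. Qed.

Lemma prodP_seq U : prodP U = \prod_(i <- enum U) ('X - (abscissa i)%:P).
Proof. by rewrite big_enum. Qed.

Lemma monic_prodP U : prodP U \is monic.
Proof. by rewrite prodP_seq monic_prod_XsubC. Qed.

Lemma size_prodP U : size (prodP U) = #|U|.+1.
Proof. by rewrite prodP_seq size_prod_XsubC cardE. Qed.

Lemma tdeg_le_lineP i : tdeg_le 1 (lineP i).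
Proof.
apply: tdeg_leB; first exact: tdeg_leX.
by apply: tdeg_leC; rewrite /abscissa size_polyN size_linear_le.
Qed.

Lemma tdeg_le_prodP U : tdeg_le #|U| (prodP U).
Proof.
rewrite /prodP -sum1_card.
elim/big_ind2: _ => //; last by move=> i _; apply: tdeg_le_lineP.
  by apply: tdeg_leC; rewrite size_poly1.
by move=> m F m' F' tF tF'; apply: tdeg_leM.
Qed.

Lemma evalY_prodP U y : evalY y (prodP U) = \prod_(i in U) ('X - ((abscissa i).[y])%:P).
Proof.
rewrite /evalY rmorph_prod; apply: eq_bigr => i _.
by rewrite rmorphB /= map_polyX map_polyC.
Qed.

Lemma order_prodP s t x y U :
  'X^(incidence U x y + (l1.[y] == 0) + (l2.[y] == 0)) %|
    subst2 s t x y ((l1 * l2)%:P * prodP U).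
Proof.
rewrite addnAC -addnA [X in 'X^X]addnC exprD subst2M; apply: dvdp_mul.
  rewrite subst2C rmorphM /= addnC exprD; apply: dvdp_mul.
    case: eqP => [l0|_]; last exact: dvd1p.
    by rewrite dvdp_X_horner0 horner_comp !hornerE ?mulr0 ?add0r l0.
  case: eqP => [l0|_]; last exact: dvd1p.
  by rewrite dvdp_X_horner0 horner_comp !hornerE ?mulr0 ?add0r l0.
have -> : subst2 s t x y (prodP U) = \prod_(i in U) subst2 s t x y (lineP i).
  rewrite /subst2 /prodP rmorph_prod; exact: (rmorph_prod (horner_eval _)).
apply: dvdp_prod_X => [|i]; first by apply/subsetP => i; rewrite inE => /andP[].
rewrite inE => /andP[_ /eqP xE]; rewrite subst2_at0 /evalY /lineP rmorphB /= map_polyX map_polyC.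
by rewrite /= hornerXsubC /horner_eval xE subrr.
Qed.

(* If the lines [lineP i] together with the factors l1(y), l2(y) cover every
   rational point twice, their product lies in the square of the ideal (A, B)
   of the polynomials vanishing at all rational points. *)
Record certificate d U (f F1 F0 : {poly {poly K}}) : Prop := Certificate {
  cert_monic : f \is monic;
  cert_size : size f = d.+1;
  cert_tdeg : tdeg_le d f;
  cert_tdeg1 : tdeg_le d.+2 F1;
  cert_tdeg0 : tdeg_le d.+2 F0;
  cert_eq : (l1 * l2)%:P * prodP U =
    A ^+ 2 * ((l1 * l2)%:P * f) + A * B * F1 + B ^+ 2 * F0 }.

Hypothesis size_l1 : (size l1 <= 2)%N.
Hypothesis size_l2 : (size l2 <= 2)%N.

Lemma bireduced_eq0 (T T1 T0 : {poly {poly K}}) :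
  (size T <= Q)%N -> (forall j, size (T`_j)%R <= Q)%N ->
  (size T1 <= Q)%N -> (forall j, size (T1`_j)%R <= Q)%N ->
  (size T0 <= Q)%N -> (forall j, size (T0`_j)%R <= Q)%N ->
  (forall s t x y, 'X^2 %| subst2 s t x y (A * T + B * T1 + T0)) ->
  [/\ T = 0, T1 = 0 & T0 = 0].
Proof.
move=> sT siT sT1 siT1 sT0 siT0 dv.
have T00 : T0 = 0.
  apply: poly2_eq0 => // x y; have : 'X %| subst2 0 0 x y (A * T + B * T1 + T0).
    by apply: dvdp_trans (dv 0 0 x y); rewrite exprS dvdp_mulIl.
  rewrite dvdp_X_horner0 subst2_at0 !evalYD !evalYM evalY_ratPX evalY_ratPY.
  by rewrite !hornerE expf_card subrr !mul0r !add0r => /eqP.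
have dv1 s t x y : s * (evalY y T).[x] + t * (evalY y T1).[x] = 0.
  have := dv s t x y; rewrite T00 addr0 subst2D !subst2M.
  have [a -> a0] := subst2_ratPX s t x y; have [a' -> a0'] := subst2_ratPY s t x y.
  rewrite -!mulrA -mulrDr expr2 dvdp_mul2l ?polyX_eq0 // dvdp_X_horner0.
  rewrite hornerD !hornerM a0 a0' !subst2_at0 !mulNr -opprD oppr_eq0.
  by move/eqP.
split=> //; apply: poly2_eq0 => // x y.
  by have := dv1 1 0 x y; rewrite mul1r mul0r addr0.
by have := dv1 0 1 x y; rewrite mul1r mul0r add0r.
Qed.

Lemma certificate_exists d U : #|U| = (Q + Q + d)%N ->
  (forall x y, 2 <= incidence U x y + (l1.[y] == 0%R) + (l2.[y] == 0%R))%N ->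
  exists f F1 F0, certificate d U f F1 F0.
Proof.
move=> cU two; set l := l1 * l2.
have Q1 : (1 < Q)%N := finNzRing_gt1 K.
have sl : (size l <= 3)%N.
  by apply: leq_trans (size_polyMleq _ _) _; move: size_l1 size_l2; lia.
have tl : tdeg_le 2 l%:P by apply: tdeg_leC.
have mA : A \is monic by apply: monic_genPoly.
have sA : size A = Q.+1 by apply: size_genPoly.
have sA2 : size (A ^+ 2) = (Q + Q).+1.
  by rewrite expr2 size_monicM ?monic_neq0 // sA addnS.
have mA2 : A ^+ 2 \is monic by apply: monic_exp.
have tA := @tdeg_le_ratPX K.
have tA2 : tdeg_le (Q + Q) (A ^+ 2) by apply: tdeg_leM.
have tH := @tdeg_le_prodP U; rewrite cU in tH.
have [f [rho [HE srho tf trho]]] := tdeg_le_div mA2 sA2 tA2 (leq_addr _ _) tH.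
rewrite addKn in tf.
have [rho1 [rho0 [rhoE srho0 trho1 trho0]]] :=
  tdeg_le_div mA sA tA (leq_trans (leq_addr Q Q) (leq_addr d _)) trho.
have srho1 : (size rho1 <= Q)%N.
  have [->|n1] := eqVneq rho1 0; first by rewrite size_poly0.
  have : (size (rho1 * A)%R <= Q + Q)%N.
    rewrite -[rho1 * A](addrK rho0) -rhoE; apply: leq_trans (size_polyD _ _) _.
    by rewrite geq_max srho size_polyN (leq_trans srho0) ?leq_addr.
  by rewrite size_Mmonic // sA; move: (size rho1) Q => u v; lia.
have [sf mf] : size f = d.+1 /\ f \is monic.
  have sH := size_prodP U; have mH := monic_prodP U; rewrite HE cU in sH mH.
  have nf : f != 0.
    by apply: contraTneq srho => f0; rewrite f0 mul0r add0r in sH; rewrite sH -ltnNge; lia.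
  have sfA : size (f * A ^+ 2) = (size f + (Q + Q))%N by rewrite size_Mmonic // sA2 addnS.
  have lt : (size rho < size (f * A ^+ 2)%R)%N.
    by rewrite sfA; apply: leq_ltn_trans srho _; rewrite -addn1 addnC leq_add2r size_poly_gt0.
  rewrite size_polyDl // sfA in sH; split; first by move: sH; move: (size f) Q => u v; lia.
  by move: mH; rewrite !monicE lead_coefDl // lead_coef_Mmonic.
have trl1 : tdeg_le (2 + (Q + Q + d - Q)) (l%:P * rho1) by apply: tdeg_leM.
have trl0 : tdeg_le (2 + (Q + Q + d)) (l%:P * rho0) by apply: tdeg_leM.
have szl F : (size (l%:P * F)%R <= size F)%N by rewrite mul_polyC size_scale_leq.
have [F1 [T [E1 sF1 sT siT tF1]]] := ratPY_div (ltac:(lia) : (Q <= 2 + (Q + Q + d - Q))%N) trl1.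
have [G0 [T0 [E0 sG0 sT0 siT0 tG0]]] := ratPY_div (ltac:(lia) : (Q <= 2 + (Q + Q + d))%N) trl0.
have [F0 [T1 [E01 sF0 sT1 siT1 tF0]]] := ratPY_div (ltac:(lia) : (Q <= 2 + (Q + Q + d) - Q)%N) tG0.
have bnd (F G : {poly {poly K}}) : (size F <= size (l%:P * G)%R)%N -> (size G <= Q)%N -> (size F <= Q)%N.
  by move=> h1 h2; apply: leq_trans h1 (leq_trans (szl _) h2).
have sT' := bnd _ _ sT srho1; have sT0' := bnd _ _ sT0 srho0.
have sT1' : (size T1 <= Q)%N := leq_trans sT1 (bnd _ _ sG0 srho0).
have EE : l%:P * prodP U = A ^+ 2 * (l%:P * f) + A * B * F1 + B ^+ 2 * F0 + (A * T + B * T1 + T0).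
  rewrite HE rhoE mulrDr mulrDr mulrA (mulrA _ rho1) E1 E0 E01; ring.
have [T00 T10 T000] : [/\ T = 0, T1 = 0 & T0 = 0].
  apply: bireduced_eq0 => // s t x y.
  have := dvdp_trans (dvdp_exp2l 'X (two x y)) (order_prodP s t x y U).
  rewrite EE subst2D dvdp_addr // !subst2D !subst2M.
  have [a -> _] := subst2_ratPX s t x y; have [a' -> _] := subst2_ratPY s t x y.
  set u := subst2 _ _ _ _ _; set u' := subst2 _ _ _ _ f; set u1 := subst2 _ _ _ _ F1; set u0 := subst2 _ _ _ _ F0.
  have -> : 'X * a * ('X * a) * (u * u') + 'X * a * ('X * a') * u1 + 'X * a' * ('X * a') * u0 = 'X^2 * (a * a * (u * u') + a * a' * u1 + a' * a' * u0) by ring.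
  exact: dvdp_mulIl.
exists f, F1, F0; split=> //.
- by apply: tdeg_leW tF1; lia.
- by apply: tdeg_leW tF0; lia.
by rewrite EE T00 T10 T000 !mulr0 !addr0.
Qed.

End Certificate.

Lemma prod_XsubC_at (R : idomainType) (I : finType) (U : {set I}) (r : I -> R) x :
  exists2 g, \prod_(i in U) ('X - (r i)%:P) = ('X - x%:P) ^+ #|[set i in U | r i == x]| * g
    & g.[x] != 0.
Proof.
exists (\prod_(i in U | r i != x) ('X - (r i)%:P)).
  rewrite (bigID (fun i => r i == x)) /=; congr (_ * _).
  rewrite (eq_bigr (fun=> 'X - x%:P)) => [|i /andP[_ /eqP->]//].
  by rewrite -prodr_const; apply: eq_bigl => i; rewrite inE.
rewrite horner_prod; apply/prodf_neq0 => i /andP[_ rx].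
by rewrite hornerXsubC subr_eq0 eq_sym.
Qed.

Lemma dvdp_deriv_mul (R : fieldType) (s : seq R) (G : {poly R}) :
  {in s, forall z, G.[z] = 0} ->
  \prod_(z <- s) ('X - z%:P) %| (\prod_(z <- s) ('X - z%:P))^`() * G.
Proof.
elim: s => [|z s IH] Gs; first by rewrite !big_nil dvd1p.
rewrite !big_cons derivM derivXsubC mul1r [X in _ %| X]mulrDl dvdp_addr.
  by rewrite -mulrA dvdp_mul // IH // => u us; apply: Gs; rewrite inE us orbT.
by rewrite mulrC dvdp_mul // dvdp_XsubCl; apply/rootP/Gs; rewrite inE eqxx.
Qed.

Lemma deriv0_root_exp (R : fieldType) p (g : {poly R}) x :
  p \in [pchar R] -> g != 0 -> g^`() = 0 -> g.[x] = 0 -> ('X - x%:P) ^+ p %| g.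
Proof.
move=> cp g0 dg gx; have [[|m] [h hx gE]] := multiplicity_XsubC g x.
  by move: hx; rewrite g0 /= gE mulr1 in gx *; rewrite /root gx eqxx.
rewrite g0 /= in hx; rewrite gE in dg *.
have E : ('X - x%:P) ^+ m * (h^`() * ('X - x%:P) + h *+ m.+1) = 0.
  rewrite -dg derivM deriv_exp derivXsubC mul1r exprS /= mulrDr.
  by rewrite [in RHS]mulrnAr mulrnAr; congr (_ + _ *+ _); ring.
have E2 : h^`() * ('X - x%:P) + h *+ m.+1 = 0.
  by move: E => /eqP; rewrite mulf_eq0 (negPf (expf_neq0 m (monic_neq0 (monicXsubC x)))) => /eqP.
have : (p %| m.+1)%N.
  have := congr1 (horner^~ x) E2; rewrite !hornerE subrr mulr0 add0r => /eqP.
  rewrite (dvdn_pcharf cp) hornerMn -[h.[x] *+ _]mulr_natr mulf_eq0 => /orP[hx0|//]; by case/negP: hx.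
by move/(dvdn_leq (ltn0Sn m)) => pm; apply: dvdp_mull; apply: dvdp_exp2l.
Qed.

Lemma size_horner_le1 (R : idomainType) e (F : {poly {poly R}}) (a : {poly R}) :
  tdeg_le e F -> (size a <= 2)%N -> (size F.[a] <= e.+1)%N.
Proof.
move=> tF sa; rewrite horner_coef.
apply: (big_ind (fun p : {poly R} => size p <= e.+1)%N).
- by rewrite size_poly0.
- by move=> u v hu hv; apply: leq_trans (size_polyD _ _) _; rewrite geq_max hu.
move=> i _; have [->|nF] := eqVneq F`_i 0; first by rewrite mul0r size_poly0.
apply: leq_trans (size_polyMleq _ _) _.
have h1 := tF i; have h2 := size_poly_exp_leq a i; rewrite -size_poly_gt0 in nF.
have h3 : ((size a).-1 * i <= i)%N.
  by rewrite -[X in (_ <= X)%N]mul1n leq_mul2r; case: (size a) sa => [|[|[|]]] //=; rewrite orbT.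
move: h1 h2 h3 nF; move: (size F`_i) (size (a ^+ i)) ((size a).-1 * i)%N => u v w; lia.
Qed.

Lemma dvdp_strip (R : idomainType) (f G : {poly R}) (I : finType) (U : {set I}) (r : I -> R) :
  (forall i, i \in U -> f.[r i] != 0) ->
  (exists q, G * \prod_(i in U) ('X - (r i)%:P) = q * f) -> exists q, G = q * f.
Proof.
rewrite -big_enum /= => hU; have {hU} : {in enum U, forall i, f.[r i] != 0}.
  by move=> i; rewrite mem_enum; apply: hU.
elim: (enum U) => [|i s IH] hs [q]; first by rewrite big_nil mulr1 => ->; exists q.
rewrite big_cons mulrCA => E; apply: IH => [j js|]; first by apply: hs; rewrite inE js orbT.
have /factor_theorem[q' qE] : root q (r i).
  have := congr1 (horner^~ (r i)) E; rewrite !hornerM hornerXsubC subrr mul0r.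
  by move/esym/eqP; rewrite mulf_eq0 (negPf (hs i (mem_head _ _))) orbF.
exists q'; apply: (mulfI (monic_neq0 (monicXsubC (r i)))); rewrite E qE; ring.
Qed.

Section CertificateTheory.
Variables (K : finFieldType) (I : finType) (b c : I -> K) (l1 l2 : {poly K}).
Implicit Types (U : {set I}) (x y : K).
Local Notation Q := #|K|.
Local Notation A := (ratPX K).
Local Notation B := (ratPY K).
Local Notation abscissa := (abscissa b c).
Local Notation prodP := (prodP b c).
Local Notation incidence := (incidence b c).
Local Notation certificate := (certificate b c l1 l2).
Local Notation l := (l1 * l2).

Section OneCertificate.
Variables (d : nat) (U : {set I}) (f F1 F0 : {poly {poly K}}).
Hypothesis cert : certificate d U f F1 F0.

Lemma cert_evalY y : l.[y] != 0 ->
  \prod_(i in U) ('X - ((abscissa i).[y])%:P) = ('X^Q - 'X) ^+ 2 * evalY y f.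
Proof.
move=> ly; have := congr1 (evalY y) (cert_eq cert).
rewrite !expr2 !(evalY_ratPX, evalY_ratPY, evalYC, evalY_prodP, evalYD, evalYM).
rewrite !(mulr0, mul0r) !addr0 mulrCA => /mulfI; apply.
by rewrite polyC_eq0.
Qed.

Lemma genPoly_at x : exists2 a : {poly K}, 'X^Q - 'X = ('X - x%:P) * a & a.[x] != 0.
Proof.
have /factor_theorem[a aE] : root ('X^Q - 'X) x.
  by rewrite /root !hornerE expf_card subrr.
exists a; first by rewrite mulrC.
have := congr1 (fun p : {poly K} => p^`().[x]) aE.
rewrite derivB derivXn derivX derivM derivXsubC mulr1 hornerD hornerMn.
rewrite -[_ *+ _]mulr_natr finField_card_eq0 mulr0 add0r hornerN hornerC.
rewrite hornerD hornerM hornerXsubC subrr mulr0 add0r => <-.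
by rewrite oppr_eq0 oner_eq0.
Qed.

Lemma cert_incidence x y : l.[y] != 0 ->
  (2 <= incidence U x y)%N /\ ((evalY y f).[x] == 0) = (2 < incidence U x y)%N.
Proof.
move=> ly; have := cert_evalY ly.
have [g -> gx] := prod_XsubC_at U (fun i => (abscissa i).[y]) x.
have [a -> ax] := genPoly_at x; rewrite -/(incidence U x y).
have nX : 'X - x%:P != 0 := monic_neq0 (monicXsubC x).
case: (incidence U x y) => [|[|m]].
- rewrite expr0 mul1r exprMn expr2 -!mulrA => /(congr1 (horner^~ x))/eqP.
  by rewrite [X in _ == X]hornerM hornerXsubC subrr mul0r (negPf gx).
- rewrite expr1 exprMn expr2 -!mulrA => /(mulfI nX)/(congr1 (horner^~ x))/eqP.
  by rewrite [X in _ == X]hornerM hornerXsubC subrr mul0r (negPf gx).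
rewrite exprMn -[m.+2]add2n exprD -!mulrA => /(mulfI nX)/(mulfI nX) E; split=> //.
have := congr1 (horner^~ x) E; rewrite !hornerM horner_exp hornerXsubC subrr.
move/(congr1 (fun u => u == 0)); rewrite !mulf_eq0 expf_eq0 eqxx andbT.
by rewrite (negPf ax) (negPf gx) orbF /= => <-.
Qed.

Lemma cert_vanish x y : l.[y] != 0 -> (evalY y f).[x] = 0 ->
  (evalY y F1).[x] = 0 /\ (evalY y F0).[x] = 0.
Proof.
move=> ly fx; have [_] := cert_incidence x ly; rewrite fx eqxx => /esym inc3.
have dv s t : s ^+ 2 * (l.[y] * (evalY y f).[x]) + s * t * (evalY y F1).[x] + t ^+ 2 * (evalY y F0).[x] = 0.
  have /dvdp_trans/(_ (order_prodP b c l1 l2 s t x y U)) : ('X^3 : {poly K}) %| 'X^(incidence U x y + (l1.[y] == 0%R) + (l2.[y] == 0%R)).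
    by apply: dvdp_exp2l; apply: leq_trans inc3 _; rewrite -addnA leq_addr.
  rewrite (cert_eq cert) !subst2D !subst2M.
  have [a -> a0] := subst2_ratPX s t x y; have [a' -> a0'] := subst2_ratPY s t x y.
  set u := subst2 _ _ _ _ l%:P; set u' := subst2 _ _ _ _ f; set u1 := subst2 _ _ _ _ F1; set u0 := subst2 _ _ _ _ F0.
  have -> : 'X * a * ('X * a) * (u * u') + 'X * a * ('X * a') * u1 + 'X * a' * ('X * a') * u0 = 'X^2 * (a * a * (u * u') + a * a' * u1 + a' * a' * u0) by ring.
  rewrite exprSr dvdp_mul2l ?expf_neq0 ?polyX_eq0 // dvdp_X_horner0 => /eqP.
  rewrite !(hornerD, hornerM) a0 a0' !subst2_at0 evalYC hornerC hornerM => <-; ring.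
split; last by have := dv 0 1; rewrite fx !(mulr0, mul0r, expr0n, expr1n, mul1r, add0r).
by have := dv 1 1; have := dv 0 1; rewrite fx !(mulr0, mul0r, expr0n, expr1n, mul1r, add0r) => ->; rewrite addr0.
Qed.

End OneCertificate.
End CertificateTheory.

Section BoundedCertificates.
Variables (K : finFieldType) (I : finType) (b c : I -> K) (l1 l2 : {poly K}).
Implicit Types (U : {set I}) (x y : K).
Local Notation Q := #|K|.
Local Notation A := (ratPX K).
Local Notation B := (ratPY K).
Local Notation abscissa := (abscissa b c).
Local Notation prodP := (prodP b c).
Local Notation lineP := (lineP b c).
Local Notation incidence := (incidence b c).
Local Notation certificate := (certificate b c l1 l2).
Local Notation l := (l1 * l2).
Hypothesis size_l1 : (size l1 <= 2)%N.
Hypothesis size_l2 : (size l2 <= 2)%N.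
Hypothesis l_neq0 : l != 0.

Let size_l : (size l <= 3)%N.
Proof. by apply: leq_trans (size_polyMleq _ _) _; move: size_l1 size_l2; lia. Qed.

Lemma card_valid : (Q - 2 <= #|[set y | l.[y] != 0%R]|)%N.
Proof.
set V := [set y | _]; have : (#|~: V| < size l)%N.
  rewrite cardE; apply: max_poly_roots => //; rewrite ?enum_uniq //.
  by apply/allP => y; rewrite mem_enum !inE negbK.
by move=> /leq_trans/(_ size_l) h; rewrite leq_subLR -(cardsC V) addnC leq_add2r -ltnS.
Qed.

Lemma poly_eq0_valid (p : {poly K}) : (size p + 2 <= Q)%N ->
  (forall y, l.[y] != 0 -> p.[y] = 0) -> p = 0.
Proof.
move=> sp p0; apply: (@poly_eq0_on _ [set y | l.[y] != 0]); last by move=> y; rewrite inE; apply: p0.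
by apply: leq_trans card_valid; lia.
Qed.

Section OneCertificate.
Variables (d : nat) (U : {set I}) (f F1 F0 : {poly {poly K}}).
Hypothesis cert : certificate d U f F1 F0.
Hypothesis dQ : (2 * d + 5 <= Q)%N.

Lemma cert_split y : l.[y] != 0 ->
  exists s, evalY y f = \prod_(z <- s) ('X - z%:P).
Proof.
move=> ly; have E := cert_evalY cert ly.
have : evalY y f %| \prod_(i <- enum U) ('X - ((abscissa i).[y])%:P).
  by rewrite big_enum E dvdp_mull.
case/dvdp_prod_XsubC=> m; rewrite -(big_map _ xpredT (fun z => 'X - z%:P)) => Em.
eexists; apply/eqP; rewrite -eqp_monic; first exact: Em.
  by apply: monic_map; apply: cert_monic cert.
by rewrite monic_prod_XsubC.
Qed.

Lemma cert_dvd_deriv F : tdeg_le d.+2 F ->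
  (forall x y, l.[y] != 0 -> (evalY y f).[x] = 0 -> (evalY y F).[x] = 0) ->
  exists q, f^`() * F = q * f.
Proof.
move=> tF F0v; have mf := cert_monic cert; have sf := cert_size cert.
have tG : tdeg_le (d.-1 + d.+2) (f^`() * F).
  by apply: tdeg_leM => //; apply: tdeg_le_deriv (cert_tdeg cert).
have [q [r [E sr _ tr]]] := tdeg_le_div mf sf (cert_tdeg cert) (leq_trans (leqnSn d) (leq_trans (leqnSn _) (leq_addl _ _))) tG.
exists q; rewrite E; suff -> : r = 0 by rewrite addr0.
apply/polyP => i; rewrite coef0; apply: poly_eq0_valid => [|y ly].
  have := tr i; move: (size _) => u hu.
  have : (u <= (d.-1 + d.+2).+1)%N by apply: leq_trans hu (leq_subr _ _).
  by move: dQ; case: (d) => [|?]; lia.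
have [s fs] := cert_split ly.
have dv : evalY y f %| evalY y r.
  have := congr1 (evalY y) E; rewrite evalYD !evalYM => /(canLR (addKr _)) <-.
  rewrite addrC; apply: dvdp_sub; last by rewrite dvdp_mull.
  have -> : evalY y f^`() = (evalY y f)^`() by rewrite /evalY deriv_map.
  rewrite fs; apply: dvdp_deriv_mul => z zs; apply: F0v => //.
  by rewrite fs; apply/rootP; rewrite root_prod_XsubC.
rewrite -coef_evalY; suff -> : evalY y r = 0 by rewrite coef0.
apply: contraTeq dv => nr; apply: contraL (isT) => /(dvdp_leq nr).
have -> : size (evalY y f) = d.+1 by rewrite /evalY size_map_poly_id0 ?sf // (monicP mf) /= /horner_eval hornerC oner_eq0.
by move/(leq_trans)/(_ (size_poly _ _))/leq_trans/(_ sr); rewrite ltnn.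
Qed.

(* Over a valid y, f splits and its roots are roots of F1 and F0, so f divides
   f' F1 and f' F0, hence f' l prod.  No linear factor of the product divides f,
   so f divides f' l, which is zero by its degree. *)
Lemma cert_deriv_eq0 : (forall i, i \in U -> f.[abscissa i] != 0) -> f^`() = 0.
Proof.
move=> hU; have mf := cert_monic cert.
have [q1 E1] : exists q, f^`() * F1 = q * f.
  apply: cert_dvd_deriv (cert_tdeg1 cert) _ => x y ly fx.
  by have [] := cert_vanish cert ly fx.
have [q0 E0] : exists q, f^`() * F0 = q * f.
  apply: cert_dvd_deriv (cert_tdeg0 cert) _ => x y ly fx.
  by have [] := cert_vanish cert ly fx.
have [q E] : exists q, (f^`() * l%:P) * prodP U = q * f.
  exists (A ^+ 2 * l%:P * f^`() + A * B * q1 + B ^+ 2 * q0).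
  rewrite -mulrA (cert_eq cert) !mulrDr.
  have -> : f^`() * (A * B * F1) = A * B * (f^`() * F1) by ring.
  have -> : f^`() * (B ^+ 2 * F0) = B ^+ 2 * (f^`() * F0) by ring.
  by rewrite E1 E0; ring.
have {q E} [q E] := dvdp_strip hU (ex_intro _ q E).
have sq : (size (f^`() * l%:P)%R < size f)%N.
  rewrite mulrC mul_polyC; apply: leq_ltn_trans (size_scale_leq _ _) _.
  by rewrite lt_size_deriv // monic_neq0.
have q0' : q = 0.
  apply: contraTeq sq => nq; rewrite E size_Mmonic // -leqNgt.
  by rewrite -size_poly_gt0 in nq; rewrite -(prednK nq) addSn /= leq_addl.
have /eqP : f^`() * l%:P = 0 by rewrite E q0' mul0r.
by rewrite mulf_eq0 polyC_eq0 (negPf l_neq0) orbF => /eqP.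
Qed.

Lemma cert_remove i : i \in U -> f.[abscissa i] = 0 ->
  exists f' F1' F0', certificate d.-1 (U :\ i) f' F1' F0' /\ f = lineP i * f'.
Proof.
move=> iU fi; have /factor_theorem[f' fE] : root f (abscissa i) by apply/rootP.
have size_a : (size (abscissa i) <= 2)%N.
  by rewrite /(abscissa) size_polyN size_linear_le.
have hor (F : {poly {poly K}}) y : F.[abscissa i].[y] = (evalY y F).[(abscissa i).[y]].
  by rewrite /evalY -[LHS]/(horner_eval y _) -horner_map.
have van F : tdeg_le d.+2 F -> (forall x y, l.[y] != 0 -> (evalY y f).[x] = 0 -> (evalY y F).[x] = 0) ->
    root F (abscissa i).
  move=> tF vF; apply/rootP/poly_eq0_valid => [|y ly].
    by apply: leq_trans (leq_add (size_horner_le1 tF size_a) (leqnn 2)) _; move: dQ; lia.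
  by rewrite hor; apply: vF => //; rewrite -hor fi horner0.
have /factor_theorem[F1' F1E] : root F1 (abscissa i).
  by apply: van (cert_tdeg1 cert) _ => x y ly fx; have [] := cert_vanish cert ly fx.
have /factor_theorem[F0' F0E] : root F0 (abscissa i).
  by apply: van (cert_tdeg0 cert) _ => x y ly fx; have [] := cert_vanish cert ly fx.
have mL : lineP i \is monic by apply: monicXsubC.
have tq e (F F' : {poly {poly K}}) : tdeg_le e.+1 F -> F = F' * lineP i -> tdeg_le e F'.
  move=> tF FE; have [q [r [E sr tq _]]] := tdeg_le_div mL (size_XsubC _) (tdeg_le_lineP b c i) (ltn0Sn e) tF.
  rewrite subSS subn0 in tq; suff -> : F' = q by [].
  apply/eqP; rewrite -subr_eq0; apply: contraTT sr => n; rewrite -ltnNge.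
  have -> : r = (F' - q) * lineP i by rewrite mulrBl -FE E; ring.
  by rewrite size_Mmonic // size_XsubC addn2 /= ltnS size_poly_gt0.
have d1 : d = d.-1.+1.
  have := cert_size cert; rewrite fE size_Mmonic ?monicXsubC //; last first.
    by apply: contra_eq_neq (cert_size cert) => f0; rewrite fE f0 mul0r size_poly0.
  rewrite size_XsubC addn2 /=; move=> [sf']; rewrite -sf' prednK // size_poly_gt0.
  by apply: contra_eq_neq (cert_size cert) => f0; rewrite fE f0 mul0r size_poly0.
have mf' : f' \is monic by have := cert_monic cert; rewrite fE monicMr.
exists f', F1', F0'; split; last by rewrite fE mulrC.
split=> //.
- have := cert_size cert; rewrite fE size_Mmonic ?monic_neq0 // size_XsubC addn2 /= d1 /=.
  by case.
- by apply: (tq _ f) => //; rewrite -d1; apply: cert_tdeg cert.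
- by apply: (tq _ F1) => //; rewrite -d1; apply: cert_tdeg1 cert.
- by apply: (tq _ F0) => //; rewrite -d1; apply: cert_tdeg0 cert.
apply: (mulfI (monic_neq0 mL)); rewrite mulrCA.
have -> : lineP i * prodP (U :\ i) = prodP U by rewrite /(prodP) (big_setD1 _ iU).
by rewrite (cert_eq cert) fE F1E F0E /(lineP); ring.
Qed.

End OneCertificate.

Lemma cert_core d U f F1 F0 : certificate d U f F1 F0 -> (2 * d + 5 <= Q)%N ->
  exists d' U' f' F1' F0', [/\ certificate d' U' f' F1' F0', U' \subset U,
    f'^`() = 0 & forall i, i \in U :\: U' -> f.[abscissa i] = 0].
Proof.
have [m] := ubnP #|U|; elim: m d U f F1 F0 => // m IH d U f F1 F0 Um cert dQ.
have [/existsP[i /andP[iU /eqP fi]]|/existsPn noroot] :=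
    boolP [exists i, (i \in U) && (f.[abscissa i] == 0)].
  have [f' [F1' [F0' [cert' fE]]]] := cert_remove cert dQ iU fi.
  have [||d' [U' [g [G1 [G0 [cg U'U dg rt]]]]]] := IH _ _ _ _ _ _ cert'; try lia.
    by move: Um; rewrite (cardsD1 i) iU; lia.
  exists d', U', g, G1, G0; split=> //.
    by apply: subset_trans U'U (subsetDl _ _).
  move=> j; rewrite inE => /andP[jU' jU].
  have [->//|ji] := eqVneq j i.
  by rewrite fE hornerM rt ?mulr0 // !inE jU' ji jU.
exists d, U, f, F1, F0; split=> //; last by move=> i; rewrite setDv inE.
apply: (cert_deriv_eq0 cert dQ) => i iU.
by have := noroot i; rewrite iU.
Qed.

Lemma cert_incidence_large p d U f F1 F0 x y (i1 i2 i3 : I) :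
  p \in [pchar K] -> certificate d U f F1 F0 -> (2 * d + 5 <= Q)%N -> l.[y] != 0 ->
  [/\ i1 \in U, i2 \in U & i3 \in U] -> uniq [:: i1; i2; i3] ->
  (forall i, i \in [:: i1; i2; i3] -> (abscissa i).[y] = x /\ f.[abscissa i] != 0) ->
  (p + 2 <= incidence U x y)%N.
Proof.
move=> cp cert dQ ly [iU1 iU2 iU3] un hi.
have [d' [U' [g [G1 [G0 [cg U'U dg rt]]]]]] := cert_core cert dQ.
have inU' i : i \in [:: i1; i2; i3] -> i \in U -> i \in U'.
  move=> ii iU; apply: contraT => niU'; have [_] := hi _ ii.
  by rewrite rt ?eqxx // inE niU' iU.
apply: (@leq_trans (incidence U' x y)); last first.
  by apply: subset_leq_card; apply/subsetP => i; rewrite !inE => /andP[/(subsetP U'U)->].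
have inc3 : (3 <= incidence U' x y)%N.
  rewrite -[3%N]/(size [:: i1; i2; i3]) -(card_uniqP un); apply: subset_leq_card.
  apply/subsetP => i ii; have [ix _] := hi _ ii; rewrite inE ix eqxx andbT.
  by apply: inU' => //; move: ii; rewrite !inE => /or3P[] /eqP->.
have [_] := cert_incidence cg x ly; rewrite inc3 => /eqP gx.
have ng : evalY y g != 0 by apply/monic_neq0/monic_map; apply: cert_monic cg.
have dgy : (evalY y g)^`() = 0 by rewrite /evalY deriv_map dg rmorph0.
have /dvdpP[h hE] := deriv0_root_exp cp ng dgy gx.
have := cert_evalY cg ly.
have [u -> ux] := prod_XsubC_at U' (fun i => (abscissa i).[y]) x.
have [a -> ax] := genPoly_at x; rewrite hE -/(incidence U' x y) => E.
rewrite leqNgt; apply: contra ux => lt.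
have nX : 'X - x%:P != 0 := monic_neq0 (monicXsubC x).
have E2 : ('X - x%:P) ^+ incidence U' x y * u =
   ('X - x%:P) ^+ incidence U' x y * (('X - x%:P) ^+ (p + 2 - incidence U' x y) * (a ^+ 2 * h)).
  by rewrite E mulrA -exprD subnKC 1?ltnW // exprD exprMn; ring.
have /(congr1 (horner^~ x)) := mulfI (expf_neq0 _ nX) E2.
rewrite hornerM horner_exp hornerXsubC subrr expr0n subn_eq0 leqNgt lt mul0r => ->.
exact: eqxx.
Qed.

End BoundedCertificates.

(** * Functionals with few zeros on a double blocking set *)

Section Functionals.
Variables (K : finFieldType) (N : nat) (I : finType) (r : I -> 'rV[K]_N) (T : {set I}).
Implicit Types (u v : 'cV[K]_N) (i j : I) (x y : K).
Local Notation Q := #|K|.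

Definition pairing i u : K := (r i *m u) 0 0.
Local Notation e := pairing.
Definition zeros u := [set i in T | e i u == 0].
Local Notation W u := #|zeros u|.

Lemma pairingD i u v : e i (u + v) = e i u + e i v.
Proof. by rewrite /pairing mulmxDr mxE. Qed.
Lemma pairingZ i x u : e i (x *: u) = x * e i u.
Proof. by rewrite /pairing -scalemxAr mxE. Qed.
Lemma pairingB i u v : e i (u - v) = e i u - e i v.
Proof. by rewrite -scaleN1r pairingD pairingZ mulN1r. Qed.

Lemma zerosZ x u : x != 0 -> zeros (x *: u) = zeros u.
Proof. by move=> x0; apply/setP => i; rewrite !inE pairingZ mulf_eq0 (negPf x0). Qed.

Lemma sum_zeros_line u v : zeros v :&: zeros u = set0 ->
  (\sum_(x : K) W (u + x *: v) = #|T :\: zeros v|)%N.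
Proof.
move=> dis; transitivity (\sum_(x : K) #|[set i in T :\: zeros v | (e i u + x * e i v == 0)%R]|)%N.
  apply: eq_bigr => x _; apply: eq_card => i; rewrite !inE pairingD pairingZ.
  have [iT|] //= := boolP (i \in T); have [v0|//] := eqVneq (e i v) 0.
  rewrite v0 mulr0 addr0; apply/negP => u0.
  by have := in_set0 i; rewrite -dis !inE iT v0 u0 eqxx.
rewrite (sum_card_incidenceT _ (fun i x => e i u + x * e i v == 0)) -sum1_card.
apply: eq_bigr => i; rewrite !inE => /andP[+ iT]; rewrite iT /= => iv.
apply/eqP/cards1P; exists (- e i u / e i v); apply/setP => x; rewrite !inE.
by rewrite addrC addr_eq0 eq_sym -(can2_eq (mulfVK iv) (mulfK iv)) eq_sym.
Qed.

Variable d : nat.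
Hypothesis two_zeros : forall u, (2 <= W u)%N.
Hypothesis cardT : #|T| = (Q + Q + d + 2)%N.
Hypothesis dQ : (2 * d + 7 <= Q)%N.

Section ExactPair.
Variables (al : 'cV[K]_N) (P P' : I).
Hypothesis PP' : P != P'.
Hypothesis al_zeros : zeros al = [set P; P'].

Let U := T :\: zeros al.

Let PT : P \in T. Proof. by have := set21 P P'; rewrite -al_zeros inE => /andP[]. Qed.
Let P'T : P' \in T. Proof. by have := set22 P P'; rewrite -al_zeros inE => /andP[]. Qed.
Let eP : e P al = 0. Proof. by have := set21 P P'; rewrite -al_zeros inE => /andP[_ /eqP]. Qed.
Let eP' : e P' al = 0. Proof. by have := set22 P P'; rewrite -al_zeros inE => /andP[_ /eqP]. Qed.
Let cardU : #|U| = (Q + Q + d)%N.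
Proof.
have := cardsDS (_ : zeros al \subset T); rewrite -/U => -> //.
  by rewrite cardT al_zeros cards2 PP' addnK.
by apply/subsetP => i; rewrite inE => /andP[].
Qed.
Let UP i : (i \in U) = (i \in T) && (e i al != 0).
Proof. by rewrite !inE; case: (i \in T); rewrite ?andbT ?andbF. Qed.

Section Plane.
Variables be ga : 'cV[K]_N.
Let b i := e i be / e i al.
Let c i := e i ga / e i al.
Let l1 : {poly K} := e P be *: 'X + (e P ga)%:P.
Let l2 : {poly K} := e P' be *: 'X + (e P' ga)%:P.

Lemma card_zeros_plane x y : W (x *: al + (y *: be + ga)) =
  (incidence b c U x y + (l1.[y] == 0%R) + (l2.[y] == 0%R))%N.
Proof.
set u := _ + _; have eu i : e i u = x * e i al + (y * e i be + e i ga).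
  by rewrite !(pairingD, pairingZ).
have l1E : l1.[y] = e P u by rewrite /l1 !hornerE eu eP mulr0 add0r mulrC.
have l2E : l2.[y] = e P' u by rewrite /l2 !hornerE eu eP' mulr0 add0r mulrC.
rewrite -(cardsID (zeros al)) addnC -addnA; congr (_ + _)%N.
  rewrite /incidence; apply: eq_card => i; rewrite [X in _ = X]inE UP horner_abscissa !inE eu.
  case: (i \in T) => //=; have [//|/= ea] := eqVneq (e i al) 0.
  rewrite /b /c; apply/eqP/eqP => [h|<-]; last by field.
  have -> : x = - (y * e i be + e i ga) / e i al.
    by apply: (mulIf ea); rewrite divfK //; apply/eqP; rewrite -addr_eq0 h.
  by field.
rewrite l1E l2E al_zeros.
have -> : zeros u :&: [set P; P'] = [set i in [set P; P'] | e i u == 0].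
  by apply/setP => i; rewrite !inE; have [->|_] := eqVneq i P; rewrite ?PT ?andbT //=; have [->|_] := eqVneq i P'; rewrite ?P'T ?andbT ?andbF.
rewrite -sum1_card (eq_bigl (fun i => (i \in [set P; P']) && (e i u == 0))) => [|i]; last by rewrite !inE.
by rewrite big_mkcondr /= big_setU1 ?inE // big_set1 /=; do 2!case: eqP.
Qed.

Hypothesis nP : (e P be != 0) || (e P ga != 0).
Hypothesis nP' : (e P' be != 0) || (e P' ga != 0).

Lemma plane_l_neq0 : l1 * l2 != 0.
Proof. by rewrite mulf_neq0 ?linear_neq0. Qed.

Lemma plane_certificate : exists f F1 F0, certificate b c l1 l2 d U f F1 F0.
Proof.
apply: certificate_exists; rewrite ?size_linear_le // => x y.
by rewrite -card_zeros_plane.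
Qed.

Lemma plane_incidence x y : (l1 * l2).[y] != 0 -> incidence b c U x y = W (x *: al + (y *: be + ga)).
Proof.
rewrite hornerM mulf_eq0 negb_or card_zeros_plane => /andP[/negPf-> /negPf->].
by rewrite !addn0.
Qed.

End Plane.

Lemma card_nonexact_pencil i u v : i \in T -> e i u = 0 -> e i v = 0 -> W u = 2 ->
  e P u != 0 -> e P' u != 0 -> (#|[set y | W (u + y *: v) != 2] | <= d + 2)%N.
Proof.
move=> iT iu iv Wu Pu P'u.
pose b j := e j v / e j al; pose c j := e j u / e j al.
pose l1 : {poly K} := e P v *: 'X + (e P u)%:P; pose l2 : {poly K} := e P' v *: 'X + (e P' u)%:P.
have [f [F1 [F0 cert]]] : exists f F1 F0, certificate b c l1 l2 d U f F1 F0.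
  by apply: plane_certificate; rewrite ?Pu ?P'u orbT.
have nl : l1 * l2 != 0 by apply: plane_l_neq0; rewrite ?Pu ?P'u orbT.
have a0 : abscissa b c i = 0 by rewrite /abscissa /b /c iu iv !mul0r scale0r addr0 oppr0.
pose p := f.[0]; have pE y : p.[y] = (evalY y f).[0].
  by rewrite /p /evalY -{1}(polyC0 K) -[LHS]/(horner_eval y _) -horner_map /= /horner_eval hornerC.
have zE y : 0 *: al + (y *: v + u) = u + y *: v by rewrite scale0r add0r addrC.
have py y : (l1 * l2).[y] != 0 -> (p.[y] == 0) = (W (u + y *: v) != 2).
  move=> ly; rewrite pE; have [h2 ->] := cert_incidence cert 0 ly.
  by rewrite -zE -plane_incidence // ltn_neqAle h2 andbT eq_sym.
have l0 : (l1 * l2).[0] != 0 by rewrite hornerM /l1 /l2 !hornerE ?mulr0 ?add0r mulf_neq0.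
have np : p != 0.
  by apply/eqP => p0; have := py 0 l0; rewrite p0 horner0 eqxx scale0r addr0 Wu.
have sp : (size p <= d.+1)%N.
  by apply: (size_horner_le1 (cert_tdeg cert)); rewrite size_poly0.
have : (#|[set y | W (u + y *: v)%R != 2%N]| < size (p * (l1 * l2))%R)%N.
  rewrite cardE; apply: (max_poly_roots (mulf_neq0 np nl)); last exact: enum_uniq.
  apply/allP => y; rewrite mem_enum inE => Wy; rewrite rootM.
  have [ly|ly] := boolP (root (l1 * l2) y); first by rewrite orbT.
  by rewrite orbF /root py.
move=> h; rewrite -ltnS; apply: leq_trans h _.
apply: leq_trans (size_polyMleq _ _) _.
have : (size (l1 * l2)%R <= 3)%N.
  apply: leq_trans (size_polyMleq _ _) _.
  have s1 : (size l1 <= 2)%N := size_linear_le _ _; have s2 : (size l2 <= 2)%N := size_linear_le _ _.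
  by move: s1 s2; case: (size l1) (size l2) => [|[|[|]]] // [|[|[|]]].
by move: sp; move: (size p) (size _) => ? ?; lia.
Qed.

Lemma card_nonexact_line u : e P u != 0 -> e P' u != 0 ->
  (#|[set x | W (u + x *: al) != 2]| <= d)%N.
Proof.
move=> Pu P'u.
have sumW : (\sum_(x : K) W (u + x *: al) = Q + Q + d)%N.
  rewrite -cardU sum_zeros_line //; apply/setP => i; rewrite in_setI al_zeros !inE.
  by apply/negP => /andP[/orP[] /eqP -> /andP[_]]; rewrite ?(negPf Pu) ?(negPf P'u).
have -> : d = (\sum_(x : K) (W (u + x *: al) - 2))%N.
  have : (\sum_(x : K) (W (u + x *: al) - 2) + \sum_(x : K) 2 = Q + Q + d)%N.
    by rewrite -big_split -sumW; apply: eq_bigr => x _ /=; rewrite subnK.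
  by move/eqP; rewrite sum_nat_const muln2 -addnn addnC eqn_add2l => /eqP.
rewrite -sum1_card big_mkcond /=; apply: leq_sum => x _; rewrite inE.
by have := two_zeros (u + x *: al); case: (W _) => [|[|[|m]]].
Qed.

Lemma zeros_large p u ga (i1 i2 i3 : I) : p \in [pchar K] ->
  [/\ i1 \in T, i2 \in T & i3 \in T] -> uniq [:: i1; i2; i3] ->
  e P u != 0 -> e P' u != 0 -> e P ga != 0 -> e P' ga != 0 ->
  (forall i, i \in [:: i1; i2; i3] -> e i ga = 0 /\ W (u - (e i u / e i al) *: al) = 2) ->
  (p + 2 <= W ga)%N.
Proof.
move=> cp [i1T i2T i3T] un Pu P'u Pg P'g hi.
pose be := u - ga; pose b j := e j be / e j al; pose c j := e j ga / e j al.
pose l1 : {poly K} := e P be *: 'X + (e P ga)%:P; pose l2 : {poly K} := e P' be *: 'X + (e P' ga)%:P.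
have [f [F1 [F0 cert]]] : exists f F1 F0, certificate b c l1 l2 d U f F1 F0.
  by apply: plane_certificate; rewrite ?Pg ?P'g orbT.
have nl : l1 * l2 != 0 by apply: plane_l_neq0; rewrite ?Pg ?P'g orbT.
have l0 : (l1 * l2).[0] != 0 by rewrite hornerM /l1 /l2 !hornerE ?mulr0 ?add0r mulf_neq0.
have l1' : (l1 * l2).[1] != 0.
  by rewrite hornerM /l1 /l2 !hornerE /be !pairingB !subrK mulf_neq0.
have -> : W ga = incidence b c U 0 0 by rewrite plane_incidence // !scale0r !add0r.
have iU i : i \in [:: i1; i2; i3] -> i \in U.
  move=> ii; rewrite UP; have [g0 _] := hi _ ii.
  have -> /= : i \in T by move: ii; rewrite !inE => /or3P[] /eqP->.
  have : i \notin zeros al.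
    by rewrite al_zeros !inE; apply/negP => /orP[] /eqP E; rewrite -E g0 eqxx in Pg P'g.
  by rewrite inE; move: ii; rewrite !inE => /or3P[] /eqP->; rewrite ?i1T ?i2T ?i3T.
apply: (@cert_incidence_large _ _ b c l1 l2 (size_linear_le _ _) (size_linear_le _ _) nl p d U f F1 F0 0 0 i1 i2 i3) => //.
- by apply: leq_trans dQ; rewrite leq_add2l.
- by split; apply: iU; rewrite !inE eqxx ?orbT.
move=> i ii; have [g0 Wi] := hi _ ii; have := iU _ ii; rewrite UP => /andP[iT ia].
rewrite horner_abscissa /c g0 mul0r mulr0 addr0 oppr0; split=> //.
apply: contra_eq_neq Wi => fi.
have hor : (evalY 1 f).[(abscissa b c i).[1]] = 0.
  by rewrite /evalY horner_map /= fi /horner_eval horner0.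
have [_] := cert_incidence cert (abscissa b c i).[1] l1'; rewrite hor eqxx => /esym.
rewrite plane_incidence // horner_abscissa /b /c /be.
have -> : - ((e i (u - ga)) / e i al * 1 + e i ga / e i al) *: al + (1 *: (u - ga) + ga) = u - (e i u / e i al) *: al.
  by rewrite scale1r subrK pairingB g0 subr0 mul0r addr0 mulr1 scaleNr addrC.
by rewrite ltn_neqAle eq_sym => /andP[].
Qed.

End ExactPair.
End Functionals.

Section ModP.
Variables (K : finFieldType) (N : nat) (I : finType) (r : I -> 'rV[K]_N) (T : {set I}).
Implicit Types (u v : 'cV[K]_N) (i j : I) (x y : K).
Local Notation Q := #|K|.
Local Notation e := (pairing r).
Local Notation zeros := (zeros r T).
Local Notation W u := #|zeros u|.

Variables (d p : nat).
Hypothesis two_zeros : forall u, (2 <= W u)%N.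
Hypothesis cardT : #|T| = (Q + Q + d + 2)%N.
Hypothesis dQ : (2 * d + 7 <= Q)%N.
Hypothesis charp : p \in [pchar K].
Hypothesis essential : forall i, i \in T -> exists2 u, e i u = 0 & W u = 2.
Hypothesis separated : forall i j, i != j -> exists2 v, e i v = 0 & e j v != 0.

Lemma exact_pair u : W u = 2 -> exists P P', P != P' /\ zeros u = [set P; P'].
Proof. by move/eqP/cards2P => [P [P' [PP' ->]]]; exists P, P'. Qed.

Lemma nonzero_pair i j : i != j -> exists2 v, e i v != 0 & e j v != 0.
Proof.
move=> ij; have [v vi vj] := separated ij; rewrite eq_sym in ij.
have [w wj wi] := separated ij; exists (v + w); rewrite pairingD.
  by rewrite vi add0r.
by rewrite wj addr0.
Qed.

Lemma card_affine_zero (s t : K) : (s != 0) || (t != 0) ->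
  (#|[set y | (s + y * t == 0)%R]| <= 1)%N.
Proof.
move=> st; have [t0|nt] := eqVneq t 0.
  rewrite t0 eqxx orbF in st; rewrite (_ : [set y | _] = set0) ?cards0 //.
  by apply/setP => y; rewrite !inE t0 mulr0 addr0 (negPf st).
apply: (@leq_trans #|[set - s / t]|); last by rewrite cards1.
apply: subset_leq_card; apply/subsetP => y; rewrite !inE addr_eq0 => /eqP ->.
by rewrite opprK mulfK.
Qed.

Lemma exists_outside (A : {set K}) : (#|A| < Q)%N -> exists y, y \notin A.
Proof.
move=> lt; have /set0Pn[y] : ~: A != set0 by rewrite -card_gt0 -(ltn_add2l #|A|) addn0 cardsC.
by rewrite inE; exists y.
Qed.

Lemma cardsU_le (A B : {set K}) a b : (#|A| <= a)%N -> (#|B| <= b)%N -> (#|A :|: B| <= a + b)%N.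
Proof. by move=> ha hb; apply: leq_trans (leq_card_setU _ _) (leq_add ha hb). Qed.

Lemma zeros_mem u i : i \in T -> (i \in zeros u) = (e i u == 0).
Proof. by move=> iT; rewrite inE iT. Qed.

Lemma exact_avoid i s1 s2 : i \in T -> s1 \in T -> s2 \in T -> i != s1 -> i != s2 ->
  exists u, [/\ e i u = 0, W u = 2, e s1 u != 0 & e s2 u != 0].
Proof.
move=> iT s1T s2T is1 is2; have [u0 iu0 Wu0] := essential iT.
have [P0 [P0' [n0 z0]]] := exact_pair Wu0.
have [i' ii' {P0 P0' n0 z0} z0] : exists2 i', i != i' & zeros u0 = [set i; i'].
  have : i \in zeros u0 by rewrite zeros_mem // iu0.
  rewrite z0 !inE => /orP[] /eqP E; [exists P0' | exists P0]; rewrite E ?z0 // 1?eq_sym //.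
  by rewrite setUC.
have i'T : i' \in T by have := set22 i i'; rewrite -z0 inE => /andP[].
have u0i' : e i' u0 = 0 by have := set22 i i'; rewrite -z0 inE => /andP[_ /eqP].
have nz s : s \in T -> i != s -> s != i' -> e s u0 != 0.
  by move=> sT ns ns'; rewrite -zeros_mem // z0 !inE negb_or eq_sym ns.
have [nu nui nui'] := nonzero_pair ii'.
have [x] : exists x, x \notin [set x | W (nu + x *: u0)%R != 2%N].
  apply: exists_outside; apply: leq_ltn_trans (card_nonexact_line two_zeros cardT ii' z0 nui nui') _.
  by move: dQ; clear; move: #|K| => q; lia.
rewrite inE negbK => /eqP Wx; set al := nu + x *: u0 in Wx.
have ali : e i al != 0 by rewrite /al pairingD pairingZ iu0 mulr0 addr0.
have ali' : e i' al != 0 by rewrite /al pairingD pairingZ u0i' mulr0 addr0.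
have [P [P' [PP' zal]]] := exact_pair Wx.
have PT : P \in T /\ e P al = 0 by have := set21 P P'; rewrite -zal inE => /andP[-> /eqP].
have P'T : P' \in T /\ e P' al = 0 by have := set22 P P'; rewrite -zal inE => /andP[-> /eqP].
have nz' s : s \in T /\ e s al = 0 -> e s u0 != 0.
  move=> [sT sal]; apply: nz => //; first by apply: contraNneq ali => ->; rewrite sal.
  by apply: contraNneq ali' => <-; rewrite sal.
have [v iv i'v] := separated ii'.
have := card_nonexact_pencil two_zeros cardT dQ PP' zal iT iu0 iv Wu0 (nz' _ PT) (nz' _ P'T).
move=> hb.
have one s : s \in T -> i != s -> (#|[set y | (e s u0 + y * e s v == 0)%R]| <= 1)%N.
  move=> sT ns; apply: card_affine_zero; have [->|ns'] := eqVneq s i'; first by rewrite i'v orbT.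
  by rewrite nz.
have [y] : exists y, y \notin [set y | W (u0 + y *: v)%R != 2%N] :|:
    ([set y | (e s1 u0 + y * e s1 v == 0)%R] :|: [set y | (e s2 u0 + y * e s2 v == 0)%R]).
  apply: exists_outside; apply: leq_ltn_trans (cardsU_le hb (cardsU_le (one _ s1T is1) (one _ s2T is2))) _.
  by move: dQ; clear; move: #|K| => q; lia.
rewrite !inE !negb_or negbK => /and3P[/eqP Wy y1 y2].
exists (u0 + y *: v); rewrite !pairingD !pairingZ iu0 iv mulr0 addr0; split=> //.
Qed.

Lemma no_medium_zeros ga : (3 <= W ga)%N -> (p + 2 <= W ga)%N || (Q <= d + W ga)%N.
Proof.
move=> W3; have [//|lt] := leqP Q (d + W ga); first by rewrite orbT.
rewrite orbF.
have [i1 [i2 [i3 [un /and3P[i1g i2g i3g]]]]] : exists i1 i2 i3, uniq [:: i1; i2; i3] /\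
    [&& i1 \in zeros ga, i2 \in zeros ga & i3 \in zeros ga].
  have := W3; rewrite cardE; have := enum_uniq (zeros ga).
  have : {subset enum (zeros ga) <= zeros ga} by move=> i; rewrite mem_enum.
  case: (enum _) => [|i1 [|i2 [|i3 s]]] // sub un _; exists i1, i2, i3.
  rewrite !sub ?inE ?eqxx ?orbT //; split=> //.
  by move: un; rewrite -[_ :: _]/([:: i1; i2; i3] ++ s) cat_uniq => /andP[].
move: (i1g) (i2g) (i3g); rewrite !inE => /andP[i1T /eqP g1] /andP[i2T /eqP g2] /andP[i3T /eqP g3].
move: (un); rewrite /= !inE negb_or andbT => /andP[/andP[n12 n13] n23].
have [u1 [e11 W1 e21 e31]] := exact_avoid i1T i2T i3T n12 n13.
have [P0 [P0' [n0 z0]]] := exact_pair W1.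
have [i1' n1' {P0 P0' n0 z0} z1] : exists2 i', i1 != i' & zeros u1 = [set i1; i'].
  have : i1 \in zeros u1 by rewrite zeros_mem // e11.
  rewrite z0 !inE => /orP[] /eqP E; [exists P0' | exists P0]; rewrite E ?z0 // 1?eq_sym //.
  by rewrite setUC.
have i1'T : i1' \in T by have := set22 i1 i1'; rewrite -z1 inE => /andP[].
have e1'1 : e i1' u1 = 0 by have := set22 i1 i1'; rewrite -z1 inE => /andP[_ /eqP].
have n21' : i2 != i1' by apply: contraNneq e21 => ->; rewrite e1'1.
have n31' : i3 != i1' by apply: contraNneq e31 => ->; rewrite e1'1.
have [u2 [e22 W2 e12 e1'2]] := exact_avoid i2T i1T i1'T (contra_neq esym n12) n21'.
have [u3 [e33 W3' e13 e1'3]] := exact_avoid i3T i1T i1'T (contra_neq esym n13) n31'.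
have [w wE] : {w | w = u3 - u2} by exists (u3 - u2).
pose v2 := w - (e i2 w / e i2 u1) *: u1.
pose v3 := w - (e i3 w / e i3 u1) *: u1.
have ev2 : e i2 v2 = 0 by rewrite /v2 pairingB pairingZ divfK // subrr.
have ev3 : e i3 v3 = 0 by rewrite /v3 pairingB pairingZ divfK // subrr.
have h2 := card_nonexact_pencil two_zeros cardT dQ n1' z1 i2T e22 ev2 W2 e12 e1'2.
have h3 := card_nonexact_pencil two_zeros cardT dQ n1' z1 i3T e33 ev3 W3' e13 e1'3.
have h1 : (#|[set y | (e i1 u2 + y * e i1 w == 0)%R]| <= 1)%N by apply: card_affine_zero; rewrite e12.
have h1' : (#|[set y | (e i1' u2 + y * e i1' w == 0)%R]| <= 1)%N by apply: card_affine_zero; rewrite e1'2.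
have [y] : exists y, y \notin ([set y | W (u2 + y *: v2)%R != 2%N] :|:
    (fun y => y + 1) @: [set y | W (u3 + y *: v3)%R != 2%N]) :|:
    ([set y | (e i1 u2 + y * e i1 w == 0)%R] :|: [set y | (e i1' u2 + y * e i1' w == 0)%R]).
  apply: exists_outside.
  apply: leq_ltn_trans (cardsU_le (cardsU_le h2 (leq_trans (leq_imset_card _ _) h3)) (cardsU_le h1 h1')) _.
  by move: dQ; clear; move: #|K| => q; lia.
rewrite !in_setU !negb_or => /andP[/andP[y2 y3] /andP[y1 y1']].
pose nu := u2 + y *: w.
have Wn2 : W (nu - (e i2 nu / e i2 u1) *: u1) = 2.
  have -> : nu - (e i2 nu / e i2 u1) *: u1 = u2 + y *: v2.
    by rewrite /nu /v2 pairingD pairingZ e22 add0r scalerBr -addrA scalerA mulrA.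
  by move: y2; rewrite inE negbK => /eqP.
have Wn3 : W (nu - (e i3 nu / e i3 u1) *: u1) = 2.
  have nuE : nu = u3 + (y - 1) *: w.
    by rewrite /nu scalerBl scale1r [in - w]wE opprB [RHS]addrCA [u3 + _]addrC subrK addrC.
  have -> : nu - (e i3 nu / e i3 u1) *: u1 = u3 + (y - 1) *: v3.
    by rewrite nuE /v3 pairingD pairingZ e33 add0r scalerBr -addrA scalerA mulrA.
  have : y - 1 \notin [set y | W (u3 + y *: v3)%R != 2%N].
    by apply: contra y3 => h; apply/imsetP; exists (y - 1); rewrite // subrK.
  by rewrite inE negbK => /eqP.
have n1 : e i1 nu != 0 by move: y1; rewrite inE /nu pairingD pairingZ.
have n1'' : e i1' nu != 0 by move: y1'; rewrite inE /nu pairingD pairingZ.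
have hx := card_nonexact_line two_zeros cardT n1' z1 n1 n1''.
have [x] : exists x, x \notin [set x | W (nu + x *: u1)%R != 2%N] :|:
    (fun i => - e i nu / e i u1) @: zeros ga.
  apply: exists_outside; apply: leq_ltn_trans (cardsU_le hx (leq_imset_card _ _)) lt.
rewrite in_setU negb_or inE negbK => /andP[/eqP Wal xg].
set al := nu + x *: u1 in Wal.
have al_g i : i \in zeros ga -> e i al != 0.
  move=> ig; have iT : i \in T by move: ig; rewrite inE => /andP[].
  rewrite /al pairingD pairingZ; have [iu|iu] := eqVneq (e i u1) 0.
    rewrite iu mulr0 addr0; have : i \in zeros u1 by rewrite zeros_mem // iu.
    by rewrite z1 !inE => /orP[] /eqP ->.
  apply: contra xg; rewrite addr_eq0 => /eqP h; apply/imsetP; exists i => //.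
  by rewrite h opprK mulfK.
have [P [P' [PP' zal]]] := exact_pair Wal.
have PT : P \in T /\ e P al = 0 by have := set21 P P'; rewrite -zal inE => /andP[-> /eqP].
have P'T : P' \in T /\ e P' al = 0 by have := set22 P P'; rewrite -zal inE => /andP[-> /eqP].
have nu1 s : s \in T /\ e s al = 0 -> e s u1 != 0.
  move=> [sT sal]; rewrite -zeros_mem // z1 !inE negb_or.
  apply/andP; split; apply/eqP => E; move: sal; rewrite /al pairingD pairingZ E.
    by rewrite e11 mulr0 addr0; apply/eqP.
  by rewrite e1'1 mulr0 addr0; apply/eqP.
have ng s : s \in T /\ e s al = 0 -> e s ga != 0.
  by move=> [sT sal]; rewrite -zeros_mem //; apply/negP => /al_g; rewrite sal eqxx.
apply: (zeros_large two_zeros cardT dQ PP' zal charp (And3 i1T i2T i3T) un (nu1 _ PT) (nu1 _ P'T) (ng _ PT) (ng _ P'T)).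
have comp i : e i ga = 0 -> i \in T -> e i u1 != 0 -> W (nu - (e i nu / e i u1) *: u1) = 2 ->
    W (u1 - (e i u1 / e i al) *: al) = 2.
  move=> gi iT iu Wi; have ial : e i al != 0 by apply: al_g; rewrite inE iT gi eqxx.
  have E : u1 - (e i u1 / e i al) *: al =
      (- e i u1 / e i al) *: (nu - (e i nu / e i u1) *: u1).
    have -> : e i nu = e i al - x * e i u1 by rewrite /al pairingD pairingZ addrK.
    move: (e i al) ial (e i u1) iu => A A0 a a0; rewrite /al.
    by apply/matrixP => s t; rewrite !mxE; field; rewrite A0 a0.
  by rewrite E zerosZ // mulf_neq0 ?oppr_eq0 ?invr_eq0.
move=> i; rewrite !inE => /or3P[] /eqP ->; split=> //.
- by rewrite e11 mul0r scale0r subr0.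
- exact: comp.
- exact: comp.
Qed.


Lemma card_slice (S : {set 'cV[K]_N}) i v : e i v = 1 ->
  (forall u x, u \in S -> u + x *: v \in S) ->
  #|S| = (Q * #|[set u in S | (e i u == 0)%R]|)%N.
Proof.
move=> v1 hS; set S0 := [set u in S | _].
have -> : S = (fun w : K * 'cV[K]_N => w.2 + w.1 *: v) @: setX [set: K] S0.
  apply/setP => u; apply/idP/imsetP => [uS|[[x w]]]; last first.
    by rewrite !inE /= => /andP[wS _] ->; apply: hS.
  exists (e i u, u - e i u *: v); rewrite /= ?subrK // !inE /= -scaleNr hS //=.
  by rewrite pairingD pairingZ v1 mulr1 subrr.
rewrite card_in_imset ?cardsX ?cardsT // => -[x u] [y w]; rewrite !inE /=.
move=> /andP[_ /eqP u0] /andP[_ /eqP w0] E.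
have xy : x = y.
  by have := congr1 (e i) E; rewrite !pairingD !pairingZ u0 w0 v1 !mulr1 !add0r.
by move: E; rewrite xy => /addIr ->.
Qed.

Lemma unit_pairing i j : i != j -> exists2 v, e i v = 0 & e j v = 1.
Proof.
move=> ij; have [v vi vj] := separated ij; exists ((e j v)^-1 *: v); rewrite pairingZ.
  by rewrite vi mulr0.
by rewrite mulVf.
Qed.

Let other i : exists j, j != i.
Proof.
have /card_gt0P[j] : (0 < #|T :\ i|)%N by have := cardsD1 i T; rewrite cardT; lia.
by rewrite !inE => /andP[ji _]; exists j.
Qed.

Lemma card_kernel i : #|{: 'cV[K]_N}| = (Q * #|[set u | (e i u == 0)%R]|)%N.
Proof.
have [j ji] := other i; have [v _ v1] := unit_pairing ji.
rewrite -cardsT (card_slice v1) => [|u x]; last by rewrite !inE.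
by congr (_ * _)%N; apply: eq_card => u; rewrite !inE.
Qed.

Lemma card_kernel2 i j : i != j ->
  #|[set u | (e i u == 0)%R]| = (Q * #|[set u | (e i u == 0)%R && (e j u == 0)%R]|)%N.
Proof.
move=> ij; have [v v0 v1] := unit_pairing ij.
rewrite (card_slice v1) => [|u x]; last first.
  by rewrite !inE pairingD pairingZ v0 mulr0 addr0.
by congr (_ * _)%N; apply: eq_card => u; rewrite !inE.
Qed.

Lemma zeros_gap ga : (d + 3 <= W ga)%N -> (Q < W ga)%N.
Proof.
move=> hW; have [/forallP meet|/forallPn[v]] := boolP [forall v, zeros ga :&: zeros v != set0].
  have [i0 i0g] : exists i, i \in zeros ga by apply/card_gt0P; apply: leq_trans hW; rewrite addnS.
  have kE i : #|[set u | (e i u == 0)%R]| = #|[set u | (e i0 u == 0)%R]|.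
    apply/eqP; rewrite -(eqn_pmul2l (_ : 0 < Q)%N) ?(ltnW (finNzRing_gt1 K)) //.
    by rewrite -!card_kernel.
  have k0 : (0 < #|[set u | (e i0 u == 0)%R]|)%N.
    by apply/card_gt0P; exists 0; rewrite inE /pairing mulmx0 mxE.
  rewrite -(ltn_pmul2r k0) -card_kernel.
  have -> : (W ga * #|[set u | (e i0 u == 0)%R]| = \sum_u #|zeros ga :&: zeros u|)%N.
    transitivity (\sum_u #|[set i in zeros ga | (e i u == 0)%R]|)%N; last first.
      by apply: eq_bigr => u _; apply: eq_card => i; rewrite !inE; case: (i \in T).
    rewrite (sum_card_incidenceT _ (fun i u => e i u == 0)) -sum_nat_const.
    by apply: eq_bigr => i _; rewrite kE.
  rewrite -sum1_card (bigD1 0) //= [X in (_ < X)%N](bigD1 0) //= -addSn leq_add //.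
    rewrite (_ : zeros ga :&: zeros 0 = zeros ga) ?(leq_trans _ hW) ?addnS //.
    by apply/setIidPl/subsetP => i; rewrite !inE => /andP[-> _]; rewrite /pairing mulmx0 mxE eqxx.
  by apply: leq_sum => u _; rewrite card_gt0.
rewrite negbK => /eqP empty; move: hW; rewrite leqNgt; case/negP.
have := sum_zeros_line empty.
move=> E; have : (Q * 2 <= #|T :\: zeros ga|)%N.
  by rewrite -E -sum_nat_const; apply: leq_sum.
have := cardsID (zeros ga) T; rewrite (setIidPr _) ?cardT; last by apply/subsetP => i; rewrite inE => /andP[].
by clear; move: #|K| (W ga) #|_| => q w t; lia.
Qed.

Lemma char_le_card : (p <= Q)%N.
Proof.
apply: dvdn_leq; first exact: ltnW (finNzRing_gt1 K).
by rewrite (dvdn_pcharf charp) finField_card_eq0.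
Qed.

Lemma zeros_dichotomy u : W u = 2 \/ (p < W u)%N.
Proof.
have [W3|] := leqP 3 (W u); last by have := two_zeros u; case: (W u) => [|[|[|]]] // _ _; left.
right; case/orP: (no_medium_zeros W3) => [|h]; first by rewrite addnS addn1 => /ltnW.
apply: leq_ltn_trans char_le_card (zeros_gap _).
by move: h dQ; clear; move: #|K| (W u) => q w; lia.
Qed.

Lemma zeros_second_moment_leq : ((p + 2) * (#|T| * Q) <= #|T| * (#|T| - 1) + 2 * (p + 1) * (Q * Q))%N.
Proof.
have [i0 i0T] : exists i, i \in T by apply/card_gt0P; rewrite cardT addnS.
have [j0 ji0] := other i0; have ij0 : i0 != j0 by rewrite eq_sym.
pose z := #|[set u | (e i0 u == 0)%R && (e j0 u == 0)%R]|.
have Q0 : (0 < Q)%N := ltnW (finNzRing_gt1 K).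
have zi i : #|[set u | (e i u == 0)%R]| = (Q * z)%N.
  apply/eqP; rewrite -(eqn_pmul2l Q0) -card_kernel (card_kernel i0) eqn_pmul2l //.
  by rewrite (card_kernel2 ij0).
have zij i j : i != j -> #|[set u | (e i u == 0)%R && (e j u == 0)%R]| = z.
  by move=> ij; apply/eqP; rewrite -(eqn_pmul2l Q0) -card_kernel2 // zi.
have z0 : (0 < z)%N by apply/card_gt0P; exists 0; rewrite inE /pairing !mulmx0 mxE eqxx.
have M : #|{: 'cV[K]_N}| = (Q * (Q * z))%N by rewrite (card_kernel i0) zi.
have S1 : (\sum_u W u = #|T| * (Q * z))%N.
  rewrite (sum_card_incidenceT T (fun i u => e i u == 0)) -sum_nat_const.
  by apply: eq_bigr => i _; rewrite zi.
have S2 : (\sum_u W u * W u = #|T| * (Q * z) + #|T| * (#|T| - 1) * z)%N.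
  by apply: (sum_sqr_card_incidence (e := fun i u => e i u == 0)) => [i _|i j _ _]; [apply: zi|apply: zij].
have : (\sum_u (p + 3) * W u <= \sum_(u : 'cV[K]_N) (W u * W u + 2 * (p + 1)))%N.
  apply: leq_sum => u _; have := zeros_dichotomy u; move: (W u) => w [->|]; first by lia.
  by move=> /subnKC <-; move: (w - p.+1)%N (p); clear => -[|m] a; nia.
have cE : (\sum_(u : 'cV[K]_N) 2 * (p + 1) = Q * (Q * z) * (2 * (p + 1)))%N.
  by rewrite -M sum_nat_const.
rewrite -big_distrr big_split /= S1 S2 cE.
move=> H; rewrite -(leq_pmul2r z0); move: H.
move: (#|T|) (#|T| - 1)%N (#|K|) (z) (p); clear => t s q w a.
nia.
Qed.

End ModP.

(** * Points, subspaces and projections *)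

Definition gnum (q r : nat) : nat := (\sum_(i < r) q ^ i)%N.

Lemma gnum0 q : gnum q 0 = 0%N. Proof. by rewrite /gnum big_ord0. Qed.
Lemma gnumSr q r : gnum q r.+1 = (gnum q r + q ^ r)%N.
Proof. by rewrite /gnum big_ord_recr. Qed.
Lemma gnumS q r : gnum q r.+1 = (q * gnum q r + 1)%N.
Proof.
rewrite /gnum big_ord_recl expn0 addnC big_distrr /=; congr (_ + _)%N.
by apply: eq_bigr => i _; rewrite expnS.
Qed.
Lemma gnum_geom q r : (0 < q)%N -> (q.-1 * gnum q r + 1 = q ^ r)%N.
Proof.
move=> q0; elim: r => [|r IH]; first by rewrite gnum0 muln0.
by rewrite gnumSr mulnDr addnAC IH expnS -mulSn prednK.
Qed.
Lemma thetaE q m : (1 < q)%N -> theta q m = gnum q m.+1.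
Proof.
move=> q1; have q0 := ltnW q1; rewrite /theta -(gnum_geom _ q0) addnK -subn1 mulKn //.
by rewrite subn_gt0.
Qed.
Lemma leq_gnum q r s : (r <= s)%N -> (gnum q r <= gnum q s)%N.
Proof.
by move/subnKC <-; elim: (s - r)%N => [|i IH]; rewrite ?addn0 // addnS gnumSr (leq_trans IH) ?leq_addr.
Qed.

Lemma card_bigcup_le (I X : finType) (P : pred I) (Y : I -> {set X}) :
  (#|\bigcup_(i | P i) Y i| <= \sum_(i | P i) #|Y i|)%N.
Proof.
elim/big_rec2: _ => [|i s B _ h]; first by rewrite cards0.
by apply: leq_trans (leq_card_setU _ _) _; rewrite leq_add2l.
Qed.

Section MatrixCounting.
Variable F : finFieldType.
Local Notation q := #|F|.

Lemma card_rowspace m N (U : 'M[F]_(m, N)) :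
  #|[set v : 'rV[F]_N | (v <= U)%MS]| = (q ^ \rank U)%N.
Proof.
have -> : [set v : 'rV[F]_N | (v <= U)%MS] =
    (fun w : 'rV_(\rank U) => w *m row_base U) @: [set: 'rV_(\rank U)].
  apply/setP => v; rewrite inE -(eq_row_base U); apply/idP/imsetP => [/submxP[w ->]|[w _ ->]].
    by exists w.
  exact: submxMl.
rewrite card_imset ?cardsT ?card_mx ?mul1n //.
exact: (can_inj (mulmxK_row_free _)) || exact: row_free_inj (row_base_free U).
Qed.

Lemma card_annihilator a N m (A : 'M[F]_(a, N)) :
  #|[set G : 'M[F]_(N, m) | A *m G == 0]| = (q ^ (m * (N - \rank A)))%N.
Proof.
pose B := kermx A^T.
have -> : [set G : 'M[F]_(N, m) | A *m G == 0] =
    (fun w : 'M_(m, \rank B) => (w *m row_base B)^T) @: [set: 'M_(m, \rank B)].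
  apply/setP => G; rewrite inE -trmx_eq0 trmx_mul -sub_kermx -/B.
  apply/idP/imsetP => [GB|[w _ ->]]; last by rewrite trmxK (submx_trans (submxMl _ _)) ?eq_row_base.
  have /submxP[w E] : (G^T <= row_base B)%MS by rewrite eq_row_base.
  by exists w; rewrite // -E trmxK.
rewrite card_imset => [|w w' /trmx_inj]; last exact: row_free_inj (row_base_free B) _ _.
by rewrite cardsT card_mx mxrank_ker mxrank_tr.
Qed.

Lemma exists_annihilator_avoiding a N m (I : finType) (S : {set I}) (A : 'M[F]_(a, N))
    (v : I -> 'rV[F]_N) :
  (forall i, i \in S -> ~~ (v i <= A)%MS) -> (#|S| < q ^ m)%N ->
  exists2 G : 'M[F]_(N, m), A *m G = 0 & forall i, i \in S -> v i *m G != 0.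
Proof.
move=> vA lt.
pose X := [set G : 'M[F]_(N, m) | A *m G == 0].
pose Y i := [set G : 'M[F]_(N, m) | col_mx A (v i) *m G == 0].
have rk i : i \in S -> \rank (col_mx A (v i)) = (\rank A).+1.
  move=> iS; have vi0 : v i != 0 by apply: contraNneq (vA i iS) => ->; rewrite sub0mx.
  apply/eqP; rewrite eqn_leq; apply/andP; split.
    rewrite -addsmxE; apply: leq_trans (mxrank_adds_leqif _ _) _.
    by rewrite rank_rV vi0 addn1.
  rewrite ltn_neqAle mxrankS ?andbT; last by rewrite -addsmxE addsmxSl.
  apply: contra (vA i iS) => /eqP E.
  have sA : (A <= col_mx A (v i))%MS by rewrite -addsmxE addsmxSl.
  have [_] := mxrank_leqif_sup sA; rewrite E eqxx => /esym; apply: submx_trans.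
  by rewrite -addsmxE addsmxSr.
have : ~~ (X \subset \bigcup_(i in S) Y i).
  apply: contraTN lt => sub; rewrite -leqNgt.
  have cX : #|X| = (q ^ (m * (N - \rank A)))%N by apply: card_annihilator.
  have q0 : (0 < q)%N := ltnW (finNzRing_gt1 F).
  have [S0|/set0Pn[i0 i0S]] := eqVneq S set0.
    move: (subset_leq_card sub); rewrite S0 big_set0 cards0 cX leqn0 expn_eq0.
    by rewrite -leqn0 leqNgt q0.
  have NA : (\rank A < N)%N by rewrite -(rk _ i0S) rank_leq_col.
  rewrite -(leq_pmul2r (_ : 0 < q ^ (m * (N - (\rank A).+1)))%N) ?expn_gt0 ?q0 //.
  rewrite -expnD -mulnS subnSK // -cX -sum_nat_const.
  apply: leq_trans (subset_leq_card sub) _; apply: leq_trans (card_bigcup_le _ _) _.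
  by apply: leq_sum => i iS; rewrite card_annihilator rk.
case/subsetPn=> G; rewrite inE => /eqP AG nY; exists G => // i iS.
apply: contra nY => viG; apply/bigcupP; exists i => //.
by rewrite inE mul_col_mx AG (eqP viG) col_mx0.
Qed.

End MatrixCounting.

Section Points.
Variables (F : finFieldType) (n : nat).
Local Notation q := #|F|.
Local Notation pt := (pg_point F n).
Implicit Types (x y z : pt) (S T : {set pt}).

Lemma rank_pt x : \rank (val x) = 1%N.
Proof. by have /andP[_ /eqP] := valP x. Qed.

Lemma genmx_pt x : <<val x>>%MS = val x.
Proof. by have /andP[/eqP] := valP x. Qed.

Definition vec x : 'rV[F]_n.+1 := nz_row (val x).

Lemma vec_neq0 x : vec x != 0.
Proof. by rewrite nz_row_eq0 -mxrank_eq0 rank_pt. Qed.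

Lemma vecP x : (vec x :=: val x)%MS.
Proof.
apply/eqmxP; rewrite nz_row_sub /=.
have [_] := mxrank_leqif_sup (nz_row_sub (val x)).
by rewrite rank_pt rank_rV vec_neq0 eqxx => /esym.
Qed.

Lemma pt_ext x y : (val x <= val y)%MS -> x = y.
Proof.
move=> xy; apply/val_inj; rewrite -(genmx_pt x) -(genmx_pt y); apply/genmxP.
rewrite xy /=; have [_] := mxrank_leqif_sup xy.
by rewrite !rank_pt eqxx => /esym.
Qed.

Lemma pt_of_rank1 m (M : 'M[F]_(m, n.+1)) : \rank M = 1%N -> exists x, (val x :=: M)%MS.
Proof.
move=> rM; have h : (<<<<M>>%MS>>%MS == <<M>>%MS) && (\rank <<M>>%MS == 1%N).
  by rewrite genmx_id eqxx mxrank_gen rM eqxx.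
by exists (Sub <<M>>%MS h); rewrite SubK; apply: genmxE.
Qed.

Lemma pt_of_vec (v : 'rV[F]_n.+1) : v != 0 -> exists x, (val x :=: v)%MS.
Proof. by move=> v0; apply: pt_of_rank1; rewrite rank_rV v0. Qed.

Definition pts m (U : 'M[F]_(m, n.+1)) : {set pt} := [set x | (val x <= U)%MS].

Lemma mem_pts m (U : 'M[F]_(m, n.+1)) x : (x \in pts U) = (val x <= U)%MS.
Proof. by rewrite inE. Qed.

Lemma pts_vec m (U : 'M[F]_(m, n.+1)) x : (x \in pts U) = (vec x <= U)%MS.
Proof. by rewrite mem_pts vecP. Qed.

Lemma card_pts m (U : 'M[F]_(m, n.+1)) : #|pts U| = gnum q (\rank U).
Proof.
have q1 : (1 < q)%N := finNzRing_gt1 F.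
have fib x : #|[set v : 'rV[F]_n.+1 | (v != 0) && (v <= val x)%MS]| = q.-1.
  have := card_rowspace (val x); rewrite rank_pt expn1 (cardsD1 0) inE sub0mx add1n => <-.
  by apply: eq_card => v; rewrite !inE.
apply/eqP; rewrite -(eqn_pmul2l (_ : 0 < q.-1)%N); last by rewrite -ltnS prednK // ltnW.
rewrite -(eqn_add2r 1) gnum_geom ?(ltnW q1) // -card_rowspace.
rewrite [X in _ == X](cardsD1 0) inE sub0mx add1n addn1 eqSS mulnC -sum_nat_const.
apply/eqP; under eq_bigr => x _ do rewrite -(fib x) -sum1_card big_mkcond.
rewrite /= exchange_big -sum1_card [RHS]big_mkcond /=.
apply: eq_bigr => v _; rewrite !inE; have [->|v0] := eqVneq v 0.
  by rewrite big1 // => x _; rewrite inE eqxx.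
have [x xv] := pt_of_vec v0; case: ifP => /= vU.
  rewrite (bigD1 x) /=; last by rewrite mem_pts xv.
  rewrite inE v0 xv submx_refl big1 // => y /andP[_ yx]; rewrite inE v0 /=.
  case: ifP => // vy; case/eqP: yx; apply/esym/pt_ext; by rewrite xv.
rewrite big1 // => y; rewrite mem_pts inE v0 /= => yU; case: ifP => // vy.
by rewrite (submx_trans vy yU) in vU.
Qed.

Lemma pts_sub m1 m2 (U : 'M[F]_(m1, n.+1)) (W : 'M[F]_(m2, n.+1)) :
  (pts U \subset pts W) = (U <= W)%MS.
Proof.
apply/subsetP/idP => [h|UW x]; last by rewrite !mem_pts => /submx_trans; apply.
apply/row_subP => i; have [->|r0] := eqVneq (row i U) 0; first exact: sub0mx.
have [x xr] := pt_of_vec r0; have := h x; rewrite !mem_pts !xr; apply.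
exact: row_sub.
Qed.

Lemma ptsI m1 m2 (U : 'M[F]_(m1, n.+1)) (W : 'M[F]_(m2, n.+1)) :
  pts (U :&: W)%MS = pts U :&: pts W.
Proof. by apply/setP => x; rewrite !inE sub_capmx. Qed.

Lemma disjoint_pts m1 m2 (U : 'M[F]_(m1, n.+1)) (W : 'M[F]_(m2, n.+1)) :
  [disjoint pts U & pts W] = (\rank (U :&: W) == 0)%N.
Proof.
rewrite -setI_eq0 -ptsI -cards_eq0 card_pts; case: (\rank _) => [|r]; first by rewrite gnum0.
by rewrite gnumS addn1.
Qed.

Definition kerpts T m (G : 'M[F]_(n.+1, m)) : {set pt} := [set x in T | vec x *m G == 0].

Lemma vec_ker x m (G : 'M[F]_(n.+1, m)) : (vec x *m G == 0) = (val x *m G == 0).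
Proof. by rewrite -!sub_kermx vecP. Qed.

(* [T] meets every subspace of vector space codimension at most k, given as the
   kernel of a matrix acting on row vectors, in at least t points. *)
Definition hits t k T := forall m (G : 'M[F]_(n.+1, m)), (\rank G <= k)%N -> (t <= #|kerpts T G|)%N.

Lemma vec_scale x y (c : F) : vec x = c *: vec y -> x = y.
Proof. by move=> E; apply: pt_ext; rewrite -!vecP E scalemx_sub. Qed.

Lemma vec_comb_neq0 x y (c : F) : x != y -> vec x - c *: vec y != 0.
Proof. by apply: contraNneq => /eqP; rewrite subr_eq0 => /eqP/vec_scale ->. Qed.

Lemma vec_not_sub x y : x != y -> ~~ (vec x <= vec y)%MS.
Proof. by apply: contra => h; apply/eqP/pt_ext; rewrite -!vecP. Qed.

End Points.

Section Pencils.
Variables (F : finFieldType) (n : nat).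
Local Notation q := #|F|.
Local Notation pt := (pg_point F n).
Implicit Types (x y z : pt) (S T : {set pt}).

Lemma nsubmx0 a (v : 'rV[F]_n.+1) : ~~ (v <= (0%R : 'M[F]_(a, n.+1)))%MS = (v != 0).
Proof. by congr (~~ _); apply/idP/eqP => [/submxP[D ->]|->]; rewrite ?mulmx0 ?sub0mx. Qed.

Lemma avoid_points a m (A : 'M[F]_(a, n.+1)) S :
  (forall x, x \in S -> x \notin pts A) -> (#|S| < q ^ m)%N ->
  exists2 G : 'M[F]_(n.+1, m), A *m G = 0 & forall x, x \in S -> vec x *m G != 0.
Proof.
move=> SA lt; apply: (exists_annihilator_avoiding (v := @vec F n) _ lt) => x xS.
by rewrite -pts_vec SA.
Qed.

Lemma avoid_points_and_combinations a m (A : 'M[F]_(a, n.+1)) S S' y :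
  (forall x, x \in S -> x \notin pts A) ->
  (forall z c, z \in S' -> ~~ (vec z - c *: vec y <= A)%MS) ->
  (#|S| + #|S'| * q < q ^ m)%N ->
  exists G : 'M[F]_(n.+1, m), [/\ A *m G = 0, forall x, x \in S -> vec x *m G != 0 &
    forall z c, z \in S' -> vec z *m G != c *: (vec y *m G)].
Proof.
move=> SA S'A lt.
pose v (i : pt + pt * F) := match i with inl x => vec x | inr zc => vec zc.1 - zc.2 *: vec y end.
pose C := (inl @: S) :|: (inr @: setX S' [set: F]) : {set pt + pt * F}.
have ltC : (#|C| < q ^ m)%N.
  apply: leq_ltn_trans (leq_card_setU _ _) _.
  by rewrite !card_imset ?cardsX ?cardsT // => ? ? [].
have [|G AG vG] := exists_annihilator_avoiding (S := C) (A := A) (v := v) _ ltC.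
  move=> i; rewrite inE => /orP[] /imsetP[w]; first by move=> wS ->; rewrite /v -pts_vec SA.
  by rewrite !inE andbT => wS -> /=; apply: S'A.
exists G; split=> //.
  by move=> x xS; apply: (vG (inl x)); rewrite inE imset_f.
move=> z c zS; have := vG (inr (z, c)); rewrite inE imset_f ?orbT ?inE ?zS // => /(_ isT).
by apply: contraNneq => E; rewrite /= mulmxBl -scalemxAl E subrr.
Qed.

Section Fiber.
Variable k : nat.
Implicit Type g : 'M[F]_(n.+1, k.+1).

Definition fiber T g (u : pg_point F k) := [set x in T | (vec x *m g <= val u)%MS].

Lemma fiber_hits t T g u : hits t k T -> (t <= #|fiber T g u|)%N.
Proof.
move=> hT; have := hT _ (g *m cokermx (val u)).
have -> : kerpts T (g *m cokermx (val u)) = fiber T g u.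
  by apply/setP => x; rewrite !inE mulmxA -submxE.
apply; apply: leq_trans (mxrankM_maxr _ _) _.
by rewrite mxrank_coker rank_pt subSS subn0.
Qed.

Lemma sum_pt_containing (v : 'rV[F]_k.+1) : v != 0 ->
  (\sum_(u : pg_point F k) (v <= val u)%MS = 1)%N.
Proof.
move=> v0; have [u uv] := pt_of_vec v0; rewrite (bigD1 u) //= uv submx_refl big1 // => w wu.
apply/eqP; rewrite eqb0; apply: contra wu => vw; apply/eqP/esym/pt_ext.
by rewrite uv.
Qed.

Lemma sum_fiber S g : (forall x, x \in S -> vec x *m g != 0) ->
  (\sum_(u : pg_point F k) #|fiber S g u| = #|S|)%N.
Proof.
move=> Sg; rewrite (sum_card_incidenceT S (fun x (u : pg_point F k) => (vec x *m g <= val u)%MS)).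
rewrite -sum1_card; apply: eq_bigr => x xS; apply: etrans (sum_pt_containing (Sg x xS)).
by rewrite -sum1_card big_mkcond; apply: eq_bigr => u _; rewrite inE; case: (_ <= _)%MS.
Qed.

Lemma card_pg_point : #|{: pg_point F k}| = gnum q k.+1.
Proof.
rewrite -[in RHS](mxrank1 F k.+1) -card_pts -cardsT; apply: eq_card => x.
by rewrite !inE submx1.
Qed.

Lemma leq_card_hits t T : hits t k T -> (#|T| < q ^ k.+1)%N -> (t * gnum q k.+1 <= #|T|)%N.
Proof.
move=> hT lt; have [|G _ TG] := @avoid_points 0 k.+1 0 T _ lt.
  by move=> x _; rewrite pts_vec nsubmx0 vec_neq0.
rewrite -(sum_fiber TG) mulnC -card_pg_point -sum_nat_const.
by apply: leq_sum => u _; apply: fiber_hits.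
Qed.

Lemma subspace_gap T m (X : 'M[F]_(m, n.+1)) : hits 2 k T -> (#|T| < q ^ k.+1)%N ->
  (\rank X <= k.+1)%N -> (#|T| < #|pts X :&: T| + 2 * q ^ k)%N -> pts X \subset T.
Proof.
move=> hT lt rX big; apply/subsetP => Z ZX; apply: contraLR big => ZT; rewrite -leqNgt.
have [|g Zg Tg] := @avoid_points _ k.+1 (vec Z) T _ lt.
  by move=> x xT; rewrite pts_vec; apply: vec_not_sub; apply: contraNneq ZT => <-.
have rXg : (\rank (X *m g) <= k)%N.
  have := mxrank_mul_ker X g.
  have : (0 < \rank (X :&: kermx g))%N.
    rewrite lt0n mxrank_eq0; apply: contraNneq (vec_neq0 Z) => E.
    have : (vec Z <= X :&: kermx g)%MS by rewrite sub_capmx -pts_vec ZX sub_kermx Zg eqxx.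
    by rewrite E => /submxP[D ->]; rewrite mulmx0.
  by move=> h1 h2; rewrite -ltnS; apply: leq_trans rX; rewrite -h2 -addn1 leq_add2l.
rewrite -(cardsID (pts X) T) setIC leq_add2l.
have Tg' x : x \in T :\: pts X -> vec x *m g != 0 by rewrite inE => /andP[_ /Tg].
rewrite -(sum_fiber Tg').
apply: (@leq_trans (\sum_(u : pg_point F k | u \notin pts (X *m g)) 2)).
  rewrite sum_nat_const mulnC leq_mul2r /=.
  have -> : #|[pred u | u \notin pts (X *m g)]| = #|~: pts (X *m g)|.
    by apply: eq_card => u; rewrite !inE.
  rewrite -(leq_add2l #|pts (X *m g)|) cardsC card_pg_point gnumSr leq_add2r.
  by rewrite card_pts leq_gnum.
rewrite big_mkcond /=; apply: leq_sum => u _; case: ifP => // uX.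
apply: leq_trans (fiber_hits g u hT) _; apply: subset_leq_card; apply/subsetP => x.
rewrite !inE => /andP[xT xu]; rewrite xT xu !andbT; apply: contra uX; rewrite inE => xX.
have [w wx] := pt_of_vec (Tg x xT); have wu : w = u by apply: pt_ext; rewrite wx.
by rewrite -wu wx; apply: submxMr; rewrite vecP.
Qed.

Lemma inj_on_subspace T g m (X : 'M[F]_(m, n.+1)) x y c :
  (forall z, z \in T -> vec z *m g != 0) -> pts X \subset T ->
  x \in pts X -> y \in pts X -> vec x *m g = c *: (vec y *m g) -> x = y.
Proof.
move=> Tg XT; rewrite !pts_vec => xX yX E; apply/eqP; apply: contraT => /(vec_comb_neq0 c) nz.
have [z zE] := pt_of_vec nz.
have /Tg : z \in T.
  apply: (subsetP XT); rewrite mem_pts zE addmx_sub // eqmx_opp scalemx_sub //.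
rewrite vec_ker -sub_kermx zE sub_kermx mulmxBl -scalemxAl E subrr.
by rewrite eqxx.
Qed.

Lemma full_subspaces_disjoint T m1 m2 (X1 : 'M[F]_(m1, n.+1)) (X2 : 'M[F]_(m2, n.+1)) :
  hits 2 k T -> pts X1 \subset T -> pts X2 \subset T ->
  (#|T| + #|T :\: (pts X1 :|: pts X2)| * q < q ^ k.+1)%N -> [disjoint pts X1 & pts X2].
Proof.
move=> hT X1T X2T lt; rewrite -setI_eq0; apply: contraT => /set0Pn[Z]; rewrite inE => /andP[Z1 Z2].
have [||g [_ Tg Rg]] := @avoid_points_and_combinations 0 k.+1 0 T _ Z _ _ lt.
- by move=> x _; rewrite pts_vec nsubmx0 vec_neq0.
- move=> z c; rewrite !inE negb_or nsubmx0 => /andP[/andP[zX1 _] _]; apply: vec_comb_neq0.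
  by apply: contraNneq zX1 => ->; rewrite -mem_pts.
have ZT := subsetP X1T _ Z1.
have [u uE] := pt_of_vec (Tg Z ZT).
have := fiber_hits g u hT; suff -> : fiber T g u = [set Z] by rewrite cards1.
apply/setP => x; rewrite !inE; apply/andP/eqP => [[xT]|->]; last by rewrite ZT uE.
rewrite uE => /sub_rVP[c E].
have [x1|x1] := boolP (x \in pts X1); first exact: (inj_on_subspace Tg X1T x1 Z1 E).
have [x2|x2] := boolP (x \in pts X2); first exact: (inj_on_subspace Tg X2T x2 Z2 E).
by have := Rg x c; rewrite in_setD in_setU (negPf x1) (negPf x2) xT E eqxx => /(_ isT).
Qed.

Lemma isolate_pair T m1 m2 (X1 : 'M[F]_(m1, n.+1)) (X2 : 'M[F]_(m2, n.+1)) x1 x2 :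
  pts X1 \subset T -> pts X2 \subset T -> [disjoint pts X1 & pts X2] ->
  (#|T| + #|T :\: (pts X1 :|: pts X2)| * q < q ^ k.+1)%N ->
  x1 \in pts X1 -> x2 \in pts X2 ->
  (forall x, x \in T -> (vec x <= vec x1 + vec x2)%MS -> x = x1 \/ x = x2) ->
  exists2 G : 'M[F]_(n.+1, k.+1), (\rank G <= k)%N & kerpts T G = [set x1; x2].
Proof.
move=> X1T X2T dis lt x1X x2X line.
have n12 : x1 != x2.
  by apply: contraTneq dis => E; rewrite -setI_eq0; apply/set0Pn; exists x1; rewrite inE x1X E.
pose A := vec x2 - vec x1.
have A_line : (A <= vec x1 + vec x2)%MS.
  by rewrite addmx_sub ?addsmxSr // eqmx_opp addsmxSl.
have nA12 : ~~ (vec x1 <= A)%MS /\ ~~ (vec x2 <= A)%MS.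
  split; apply/negP => /sub_rVP[c E].
    have c0 : c != 0 by apply: contraTneq (vec_neq0 x1) => c0; rewrite E c0 scale0r eqxx.
    have AE : A = c^-1 *: vec x1 by rewrite E scalerA mulVf // scale1r.
    move/eqP: n12; apply; apply/esym/(@vec_scale _ _ _ _ (c^-1 + 1)).
    by rewrite scalerDl scale1r -AE /A subrK.
  have c0 : c != 0 by apply: contraTneq (vec_neq0 x2) => c0; rewrite E c0 scale0r eqxx.
  have AE : A = c^-1 *: vec x2 by rewrite E scalerA mulVf // scale1r.
  move/eqP: n12; apply; apply: (@vec_scale _ _ _ _ (1 - c^-1)).
  by rewrite scalerBl scale1r -AE /A opprB addrC subrK.
have [||g [Ag Tg Rg]] := @avoid_points_and_combinations _ k.+1 A T _ x1 _ _ lt.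
- move=> x xT; rewrite pts_vec; apply/negP => xA.
  by case: (line x xT (submx_trans xA A_line)) => E; rewrite E in xA; case: nA12; rewrite xA.
- move=> z c; rewrite !inE negb_or => /andP[/andP[z1 z2] zT]; apply/negP => zA.
  have zl : (vec z <= vec x1 + vec x2)%MS.
    rewrite -(subrK (c *: vec x1) (vec z)) addmx_sub ?(submx_trans zA) //.
    by rewrite scalemx_sub // addsmxSl.
  case: (line z zT zl) => E; first by rewrite E -mem_pts x1X in z1.
  by rewrite E -mem_pts x2X in z2.
have E12 : vec x2 *m g = vec x1 *m g by apply/eqP; rewrite -subr_eq0 -mulmxBl Ag.
have x1T := subsetP X1T _ x1X; have x2T := subsetP X2T _ x2X.
have [u uE] := pt_of_vec (Tg _ x1T).
exists (g *m cokermx (val u)).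
  by apply: leq_trans (mxrankM_maxr _ _) _; rewrite mxrank_coker rank_pt subSS subn0.
apply/setP => x; rewrite !inE mulmxA -submxE uE.
apply/andP/orP => [[xT /sub_rVP[c E]]|[] /eqP ->]; last 2 first.
- by rewrite x1T submx_refl.
- by rewrite x2T E12 submx_refl.
have [h1|h1] := boolP (x \in pts X1).
  by left; apply/eqP/(inj_on_subspace Tg X1T h1 x1X E).
have [h2|h2] := boolP (x \in pts X2).
  by right; apply/eqP; rewrite -E12 in E; apply: (inj_on_subspace Tg X2T h2 x2X E).
by have := Rg x c; rewrite in_setD in_setU (negPf h1) (negPf h2) xT E eqxx => /(_ isT).
Qed.

End Fiber.
End Pencils.

(** * Double blocking sets *)

Section Hyperplanes.
Variables (F : finFieldType) (n : nat).
Local Notation q := #|F|.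
Local Notation pt := (pg_point F n).
Implicit Types (x y z : pt) (S T B : {set pt}).

Lemma kerptsS S T m (G : 'M[F]_(n.+1, m)) : S \subset T -> kerpts S G \subset kerpts T G.
Proof. by move=> ST; apply/subsetP => x; rewrite !inE => /andP[/(subsetP ST)->]. Qed.

Lemma kerpts_sub T m (G : 'M[F]_(n.+1, m)) : kerpts T G \subset T.
Proof. by apply/subsetP => x; rewrite inE => /andP[]. Qed.

Lemma kerpts_row_mx T m1 m2 (G1 : 'M[F]_(n.+1, m1)) (G2 : 'M[F]_(n.+1, m2)) :
  kerpts T (row_mx G1 G2) = kerpts (kerpts T G1) G2.
Proof. by apply/setP => x; rewrite !inE mul_mx_row row_mx_eq0 andbA. Qed.

Lemma rank_row_mx m1 m2 (G1 : 'M[F]_(n.+1, m1)) (G2 : 'M[F]_(n.+1, m2)) :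
  (\rank (row_mx G1 G2) <= \rank G1 + \rank G2)%N.
Proof.
rewrite -mxrank_tr tr_row_mx -addsmxE -(mxrank_tr G1) -(mxrank_tr G2).
exact: mxrank_adds_leqif.
Qed.

Lemma hits_hyperplane t k T (mu : 'cV[F]_n.+1) : hits t k.+1 T -> hits t k (kerpts T mu).
Proof.
move=> hT m G rG; rewrite -kerpts_row_mx; apply: hT.
exact: leq_trans (rank_row_mx _ _) (leq_add (rank_leq_col mu) rG).
Qed.

Lemma hits_setD t k T S : hits t k T -> hits (t - #|S|) k (T :\: S).
Proof.
move=> hT m G rG; rewrite leq_subLR; apply: leq_trans (hT _ G rG) _.
apply: leq_trans (leq_card_setU _ _); apply: subset_leq_card; apply/subsetP => x.
by rewrite !inE; case: (x \in S).
Qed.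

Lemma same_kernel m k (G : 'M[F]_(n.+1, m)) : (\rank G <= k)%N ->
  exists G' : 'M[F]_(n.+1, k), forall v : 'rV[F]_n.+1, (v *m G' == 0) = (v *m G == 0).
Proof.
move=> rG; exists (col_base G *m pid_mx (\rank G)) => v.
have E : (v *m G == 0) = (v *m col_base G == 0).
  rewrite -{1}(mulmx_base G) mulmxA; apply/eqP/eqP => [h|->]; last by rewrite mul0mx.
  by apply: (row_free_inj (row_base_free G)); rewrite h mul0mx.
rewrite E mulmxA; apply/eqP/eqP => [h|->]; last by rewrite mul0mx.
have pf : row_free (pid_mx (\rank G) : 'M[F]_(\rank G, k)).
  by rewrite /row_free rank_pid_mx.
by apply: (row_free_inj pf); rewrite h mul0mx.
Qed.

Lemma hyperplane_gap0 t k T (mu : 'cV[F]_n.+1) (G : 'M[F]_(n.+1, k)) : hits t k T ->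
  kerpts (kerpts T mu) G = set0 -> (#|kerpts T mu| + t * q ^ k <= #|T|)%N.
Proof.
move=> hT empty; pose g : 'M[F]_(n.+1, 1 + k) := row_mx mu G.
pose W : 'M[F]_(1 + k) := kermx (col_mx 1%:M 0 : 'cV_(1 + k)).
have Tg x : x \in T -> vec x *m g != 0.
  move=> xT; apply: contraFneq (in_set0 x) => E; rewrite -empty -kerpts_row_mx inE xT.
  by rewrite -/g E eqxx.
have rW : (\rank W <= k)%N.
  by rewrite mxrank_ker rank_col_mx0 mxrank1 leq_subLR.
rewrite -(cardsID (kerpts T mu) T) (setIidPr (kerpts_sub _ _)) leq_add2l.
have Tg' x : x \in T :\: kerpts T mu -> vec x *m g != 0 by rewrite inE => /andP[_ /Tg].
rewrite -(sum_fiber Tg').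
apply: (@leq_trans (\sum_(u : pg_point F k | u \notin pts W) t)).
  rewrite sum_nat_const mulnC leq_mul2r; apply/orP; right.
  have -> : #|[pred u : pg_point F k | u \notin pts W]| = #|~: pts W|.
    by apply: eq_card => u; rewrite !inE.
  rewrite -(leq_add2l #|pts W|) cardsC card_pg_point gnumSr leq_add2r.
  by rewrite card_pts leq_gnum.
rewrite big_mkcond /=; apply: leq_sum => u _; case: ifP => // uW.
apply: leq_trans (fiber_hits g u hT) _; apply: subset_leq_card; apply/subsetP => x.
rewrite !inE => /andP[xT xu]; rewrite xT xu !andbT; apply: contra uW => xmu.
have [w wx] := pt_of_vec (Tg x xT); have wu : w = u by apply: pt_ext; rewrite wx.
rewrite -wu mem_pts wx sub_kermx /g mul_mx_row (eqP xmu).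
by rewrite mul_row_col mul0mx mulmx0 addr0.
Qed.

Lemma hyperplane_gap t k T (mu : 'cV[F]_n.+1) m (G : 'M[F]_(n.+1, m)) : hits t k T ->
  (\rank G <= k)%N ->
  (#|kerpts T mu| + (t - #|kerpts (kerpts T mu) G|) * q ^ k <= #|T|)%N.
Proof.
move=> hT rG; have [G' GE] := same_kernel rG.
set E := kerpts (kerpts T mu) G.
have ET : E \subset kerpts T mu by apply: kerpts_sub.
have ET' : E \subset T := subset_trans ET (kerpts_sub _ _).
have := @hyperplane_gap0 (t - #|E|) k (T :\: E) mu G' (hits_setD E hT).
have -> : kerpts (T :\: E) mu = kerpts T mu :\: E.
  by apply/setP => x; rewrite [LHS]inE !in_setD [x \in kerpts T mu]inE andbA.
have -> : kerpts (kerpts T mu :\: E) G' = set0.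
  apply/setP => x; rewrite in_set0 inE GE inE.
  have [xE|] := boolP (x \in E); rewrite //= andbC; case x0: (_ == _) => //=.
  by apply: contraNF => xT; rewrite inE xT x0.
move=> /(_ erefl); rewrite !cardsDS //.
have := subset_leq_card ET; have := subset_leq_card ET'.
by move: (#|E|) #|T| (#|kerpts T mu|) (_ * _)%N => a b c e; clear; lia.
Qed.

Lemma separating_functional m a (V : 'M[F]_(m, n.+1)) (A : 'M[F]_(a, n.+1)) :
  ~~ (V <= A)%MS -> exists2 mu : 'cV[F]_n.+1, A *m mu = 0 & V *m mu != 0.
Proof.
rewrite submxE => nz; have [j hj] : exists j, col j (V *m cokermx A) != 0.
  apply/existsP; apply: contraNT nz => /existsPn h; apply/eqP/matrixP => i j.
  by have := h j; rewrite negbK => /eqP/colP/(_ i); rewrite !mxE.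
exists (col j (cokermx A)); last by rewrite colE mulmxA -colE.
by rewrite colE mulmxA mulmx_coker mul0mx.
Qed.

Section Moments.
Variable T : {set pt}.
Hypothesis n_gt0 : (0 < n)%N.
Local Notation Z mu := #|kerpts T mu|.

Lemma card_functionals : #|{: 'cV[F]_n.+1}| = (q * (q * q ^ n.-1))%N.
Proof. by rewrite card_mx muln1 -expnS prednK // -expnS. Qed.

Lemma card_pt_functionals x : #|[set mu : 'cV[F]_n.+1 | vec x *m mu == 0]| = (q * q ^ n.-1)%N.
Proof. by rewrite card_annihilator rank_rV vec_neq0 mul1n subn1 -expnS prednK. Qed.

Lemma card_pair_functionals x y : x != y ->
  #|[set mu : 'cV[F]_n.+1 | (vec x *m mu == 0) && (vec y *m mu == 0)]| = (q ^ n.-1)%N.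
Proof.
move=> xy; have -> : [set mu : 'cV[F]_n.+1 | (vec x *m mu == 0) && (vec y *m mu == 0)]
    = [set mu | col_mx (vec x) (vec y) *m mu == 0].
  by apply/setP => mu; rewrite !inE mul_col_mx col_mx_eq0.
rewrite card_annihilator mul1n; congr (_ ^ _)%N.
suff -> : \rank (col_mx (vec x) (vec y)) = 2 by rewrite subSS subn1.
rewrite -addsmxE; have := mxrank_sum_cap (vec x) (vec y).
rewrite !rank_rV !vec_neq0 (_ : \rank (vec x :&: vec y) = 0) ?addn0 //.
apply/eqP; rewrite -disjoint_pts -setI_eq0 -subset0; apply/subsetP => z.
rewrite !inE !vecP => /andP[zx zy]; move: xy.
by rewrite -(pt_ext zx) -(pt_ext zy) eqxx.
Qed.

Lemma first_moment : (\sum_(mu : 'cV[F]_n.+1) Z mu = #|T| * (q * q ^ n.-1))%N.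
Proof.
rewrite (sum_card_incidenceT T (fun x (mu : 'cV[F]_n.+1) => vec x *m mu == 0)) -sum_nat_const.
by apply: eq_bigr => x _; rewrite card_pt_functionals.
Qed.

Lemma hyperplane_second_moment : (\sum_(mu : 'cV[F]_n.+1) Z mu * Z mu =
  #|T| * (q * q ^ n.-1) + #|T| * (#|T| - 1) * q ^ n.-1)%N.
Proof.
apply: (sum_sqr_card_incidence (e := fun x (mu : 'cV[F]_n.+1) => vec x *m mu == 0)) => [x _|x y _ _ xy].
  exact: card_pt_functionals.
exact: card_pair_functionals.
Qed.

End Moments.
End Hyperplanes.

Lemma ltn_of_sqr q t : (1 < q)%N -> (t * t <= q)%N -> (t < q)%N.
Proof. by move=> q1 tq; rewrite ltnNge; apply/negP => qt; have := leq_mul qt qt; nia. Qed.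

Section Lines.
Variables (F : finFieldType) (n : nat).
Local Notation q := #|F|.
Local Notation pt := (pg_point F n).
Implicit Types (x y z : pt) (S T B : {set pt}).
Hypothesis n_gt0 : (0 < n)%N.

Let q1 : (1 < q)%N := finNzRing_gt1 F.

Definition span_pts T : 'M[F]_n.+1 := (\sum_(x in T) <<vec x>>)%MS.

Lemma sub_span_pts T : T \subset pts (span_pts T).
Proof. by apply/subsetP => x xT; rewrite pts_vec (sumsmx_sup x) // genmxE. Qed.

Lemma span_pts_mul_eq0 T (mu : 'cV[F]_n.+1) : (span_pts T *m mu == 0) = (kerpts T mu == T).
Proof.
apply/idP/eqP => [V0|E].
  apply/setP => x; rewrite inE; case xT: (x \in T) => //=.
  rewrite -sub_kermx; apply: submx_trans (_ : span_pts T <= _)%MS; last by rewrite sub_kermx.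
  by rewrite -pts_vec (subsetP (sub_span_pts T)).
rewrite -sub_kermx; apply/sumsmx_subP => x; rewrite -E inE => /andP[_].
by rewrite genmxE sub_kermx.
Qed.

Lemma card_span_annihilator T : (3 <= \rank (span_pts T))%N ->
  (#|[set mu : 'cV[F]_n.+1 | (span_pts T *m mu == 0)%R]| * q <= q ^ n.-1)%N.
Proof.
move=> r3; rewrite card_annihilator mul1n -expnSr leq_pexp2l ?(ltnW q1) //.
by have := rank_leq_row (span_pts T); move: r3; lia.
Qed.

Lemma kerpts_proper T (mu : 'cV[F]_n.+1) : span_pts T *m mu != 0 ->
  (#|kerpts T mu| < #|T|)%N.
Proof. by rewrite span_pts_mul_eq0 => nE; rewrite proper_card // properEneq nE kerpts_sub. Qed.

Lemma sum_span_indicator T (c : nat) :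
  (\sum_(mu : 'cV[F]_n.+1) ((span_pts T *m mu == 0)%R : nat) * c =
   #|[set mu : 'cV[F]_n.+1 | (span_pts T *m mu == 0)%R]| * c)%N.
Proof.
rewrite -big_distrl /=; congr (_ * _)%N; rewrite -sum1_card [RHS]big_mkcond /=.
by apply: eq_bigr => mu _; rewrite inE; case: eqP.
Qed.

(* A hyperplane with more than |B| - q points of B meets B in a blocking set; if
   every such hyperplane contains B, the second moment is too small. *)
Lemma blocking_contains_line B t : hits 1 1 B -> (#|B| <= q + t)%N -> (t * t <= q)%N ->
  exists2 X : 'M[F]_n.+1, \rank X = 2%N & pts X \subset B.
Proof.
have [m] := ubnP #|B|; elim: m B => // m IH B Bm hB Bt tq.
have tq' : (t < q)%N := ltn_of_sqr q1 tq.
have ltB : (#|B| < q ^ 2)%N.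
  by apply: leq_ltn_trans Bt _; rewrite -mulnn; move: tq' q1; clear; move: #|F| => w; nia.
have := leq_card_hits hB ltB; rewrite mul1n !gnumS gnum0 muln0 add0n muln1 => geB.
have [t0 t0E] : {t0 | #|B| = (q + t0)%N} by exists (#|B| - q)%N; rewrite subnKC // (leq_trans _ geB) ?leq_addr.
have t01 : (0 < t0)%N by move: geB; rewrite t0E leq_add2l.
have t0t : (t0 <= t)%N by move: Bt; rewrite t0E leq_add2l.
set V := span_pts B.
have [/existsP[mu /andP[nV zmu]]|/existsPn small] :=
    boolP [exists mu : 'cV[F]_n.+1, (V *m mu != 0)%R && (t0 < #|kerpts B mu|)%N].
  have [||||X rX XB] := IH (kerpts B mu).
  - by apply: leq_trans (kerpts_proper nV) _; rewrite -ltnS.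
  - move=> k G rG; rewrite lt0n; apply: contraTN zmu => /eqP z0.
    have := hyperplane_gap mu hB rG; rewrite z0 t0E expn1 subn0 mul1n -leqNgt addnC.
    by rewrite leq_add2l.
  - by apply: leq_trans (ltnW (kerpts_proper nV)) Bt.
  - by [].
  by exists X => //; apply: subset_trans XB (kerpts_sub _ _).
have {}small (mu : 'cV[F]_n.+1) : V *m mu != 0 -> (#|kerpts B mu| <= t0)%N.
  by move=> nV; have := small mu; rewrite nV /= -leqNgt.
have [r3|r2] := leqP 3 (\rank V); last first.
  have rV : \rank V = 2%N.
    apply/eqP; rewrite eqn_leq -ltnS r2 /= leqNgt; rewrite ltnS; apply/negP => r1.
    have := subset_leq_card (sub_span_pts B); rewrite card_pts => h.
    by have := leq_trans h (leq_gnum q r1); rewrite gnumS gnum0 muln0 add0n leqNgt (leq_trans _ geB) // addn1 ltnS ltnW.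
  exists V => //; apply/subsetP => y yV.
  have nVy : ~~ (V <= vec y)%MS.
    by apply/negP => /mxrankS; rewrite rV rank_rV; case: (_ != _).
  have [mu ymu Vmu] := separating_functional nVy.
  have /card_gt0P[x] : (0 < #|kerpts B mu|)%N := hB _ mu (rank_leq_col _).
  rewrite inE => /andP[xB /eqP xmu]; suff -> : y = x by [].
  apply/pt_ext; rewrite -!vecP.
  have := mxrank_mul_ker V mu; rewrite rV => rk.
  have rc : (\rank (V :&: kermx mu) <= 1)%N.
    have : (0 < \rank (V *m mu))%N by rewrite lt0n mxrank_eq0.
    by move: rk; move: (\rank (V *m mu)) (\rank _) => u v; clear; lia.
  have xc : (vec x <= V :&: kermx mu)%MS.
    by rewrite sub_capmx -pts_vec (subsetP (sub_span_pts B)) //= sub_kermx xmu.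
  have yc : (vec y <= V :&: kermx mu)%MS by rewrite sub_capmx -pts_vec yV sub_kermx ymu eqxx.
  have [_] := mxrank_leqif_sup xc.
  rewrite eqn_leq mxrankS //= rank_rV vec_neq0 rc => /esym cx.
  exact: submx_trans yc cx.
exfalso.
have M0 : (0 < q ^ n.-1)%N by rewrite expn_gt0 (ltnW q1).
have key (mu : 'cV[F]_n.+1) : (#|kerpts B mu| * #|kerpts B mu| + t0 <=
    (t0 + 1) * #|kerpts B mu| + ((V *m mu == 0)%R : nat) * ((#|B| - 1) * q))%N.
  have [V0|nV] := eqVneq (V *m mu) 0.
    move/eqP: V0; rewrite span_pts_mul_eq0 => /eqP ->; rewrite mul1n t0E.
    by move: q1 t01; clear; nia.
  rewrite addn0; have := small mu nV; have := hB _ mu (rank_leq_col _).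
  by move: (#|_|) => z; clear; nia.
have : (\sum_(mu : 'cV[F]_n.+1) (#|kerpts B mu| * #|kerpts B mu| + t0) <= \sum_(mu : 'cV[F]_n.+1)
    ((t0 + 1) * #|kerpts B mu| + ((V *m mu == 0)%R : nat) * ((#|B| - 1) * q)))%N.
  by apply: leq_sum => mu _; apply: key.
rewrite !big_split /= -big_distrr /= hyperplane_second_moment // first_moment //.
rewrite sum_span_indicator sum_nat_const card_functionals // => H.
have := card_span_annihilator r3; rewrite -/V => h3.
have : (#|B| * q + #|B| * (#|B| - 1) + q * q * t0 <= (t0 + 1) * (#|B| * q) + (#|B| - 1))%N.
  rewrite -(leq_pmul2r M0); move: H h3; move: (#|[set _ | _]|) (q ^ n.-1)%N (#|B|) => u M b; clear.
  move: (b - 1)%N => s H h3; have h4 : (u * (s * q) <= s * M)%N by rewrite mulnCA leq_mul2l h3 orbT.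
  rewrite (_ : (b * q + b * s + q * q * t0) * M = b * (q * M) + b * s * M + q * (q * M) * t0)%N; last by ring.
  apply: leq_trans H _; rewrite [X in (_ <= X)%N](_ : _ = (t0 + 1) * (b * (q * M)) + s * M)%N; last by ring.
  by rewrite leq_add2l.
rewrite t0E; have : (t0 * t0 <= q)%N by apply: leq_trans (leq_mul t0t t0t) tq.
by move: q1 t01; clear; nia.
Qed.

Lemma double_blocking_contains_lines T t : hits 2 1 T -> (#|T| <= 2 * q + t)%N -> (t * t <= q)%N ->
  (7 <= q)%N -> exists X1 X2 : 'M[F]_n.+1,
    [/\ \rank X1 = 2%N, \rank X2 = 2%N, [disjoint pts X1 & pts X2], pts X1 \subset T & pts X2 \subset T].
Proof.
have [m] := ubnP #|T|; elim: m T => // m IH T Tm hT Tt tq q7.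
have tq' : (t < q)%N := ltn_of_sqr q1 tq.
have ltT : (#|T| < q ^ 2)%N.
  by apply: leq_ltn_trans Tt _; rewrite -mulnn; move: tq' q7; clear; move: #|F| => w; nia.
have := leq_card_hits hT ltT; rewrite !gnumS gnum0 muln0 add0n muln1 => geT.
have [t0 t0E] : {t0 | #|T| = (2 * q + t0)%N}.
  by exists (#|T| - 2 * q)%N; rewrite subnKC // (leq_trans _ geT) // mulnDr leq_addr.
have t02 : (2 <= t0)%N by move: geT; rewrite t0E mulnDr leq_add2l.
have t0t : (t0 <= t)%N by move: Tt; rewrite t0E leq_add2l.
set V := span_pts T.
have [/existsP[mu /andP[nV zmu]]|/existsPn small] :=
    boolP [exists mu : 'cV[F]_n.+1, (V *m mu != 0)%R && (t0 < #|kerpts T mu|)%N].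
  have h1 : hits 1 1 (kerpts T mu).
    move=> a G rG; rewrite lt0n; apply: contraTN zmu => /eqP z0.
    have := hyperplane_gap mu hT rG; rewrite z0 t0E expn1 subn0 -leqNgt addnC.
    by rewrite leq_add2l.
  have Tmu := kerpts_sub T mu.
  have [/existsP[G le1]|/existsPn ge2] := boolP [exists G : 'cV[F]_n.+1, (#|kerpts (kerpts T mu) G| <= 1)%N]; last first.
    have [|||X1 [X2 [r1 r2 dis s1 s2]]] := IH (kerpts T mu) _ _ _ tq q7.
    - by apply: leq_trans (kerpts_proper nV) _; rewrite -ltnS.
    - move=> a G /same_kernel[G' GE]; rewrite ltnNge; apply: contra (ge2 G').
      by congr (#|pred_of_set _| <= 1)%N; apply/setP => x; rewrite !inE GE.
    - by apply: leq_trans (ltnW (kerpts_proper nV)) Tt.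
    by exists X1, X2; split => //; apply: subset_trans Tmu.
  have small_mu : (#|kerpts T mu| <= q + t)%N.
    have := hyperplane_gap mu hT (rank_leq_col G); rewrite t0E expn1.
    by move: le1 t0t; move: (#|kerpts (kerpts T mu) G|) (#|kerpts T mu|) #|F|; clear; nia.
  have [X rX XT] := blocking_contains_line h1 small_mu tq; have {}XT := subset_trans XT Tmu.
  have cX : #|pts X| = (q + 1)%N by rewrite card_pts rX !gnumS gnum0 muln0 add0n muln1.
  have cTX : (#|T :\: pts X| + (q + 1) = 2 * q + t0)%N.
    by rewrite -cX -t0E addnC -(cardsID (pts X) T) (setIidPr XT).
  have line P : P \in pts X -> exists2 Y : 'M[F]_n.+1, \rank Y = 2%N & pts Y \subset P |: (T :\: pts X).
    move=> PX; have [||Y rY YB] := @blocking_contains_line (P |: (T :\: pts X)) t _ _ tq; last by exists Y.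
      move=> a H rH; have [XG|XG] := boolP (X <= kermx H)%MS.
        apply/card_gt0P; exists P; rewrite !inE eqxx -sub_kermx; apply: submx_trans XG.
        by rewrite -pts_vec.
      have c1 : (#|kerpts (pts X) H| <= 1)%N.
        have rk : (\rank (X :&: kermx H) <= 1)%N.
          rewrite -ltnS -rX ltn_neqAle mxrankS ?capmxSl // andbT.
          apply: contra XG => /eqP E; have [_] := mxrank_leqif_sup (capmxSl X (kermx H)).
          by rewrite E eqxx sub_capmx submx_refl => /esym.
        have -> : kerpts (pts X) H = pts (X :&: kermx H)%MS.
          by apply/setP => x; rewrite inE !pts_vec sub_capmx sub_kermx.
        by rewrite card_pts (leq_trans (leq_gnum q rk)) // gnumS gnum0 muln0.
      have := hT _ H rH; rewrite -(cardsID (pts X) (kerpts T H)) => h2.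
      have h3 : (0 < #|kerpts T H :\: pts X|)%N.
        have : (#|kerpts T H :&: pts X| <= 1)%N.
          apply: leq_trans c1; apply: subset_leq_card; apply/subsetP => x.
          by rewrite !inE => /andP[/andP[_ ->] ->].
        by move: h2; case: (#|_ :\: _|) => //; rewrite addn0 => h2 h3; have := leq_trans h2 h3; rewrite ltnn.
      apply: leq_trans h3 _; apply: subset_leq_card; apply/subsetP => x.
      by rewrite !inE => /and3P[-> -> ->]; rewrite orbT.
    rewrite -(leq_add2r (q + 1)) (leq_trans (leq_add (leq_card_setU _ _) (leqnn _))) // cards1.
    by move: cTX t0t; clear; lia.
  have [y0 [y1 [y0X y1X y01]]] : exists y0 y1, [/\ y0 \in pts X, y1 \in pts X & y0 != y1].
    have /card_gt1P[y0 [y1 [h0 h1' h2]]] : (1 < #|pts X|)%N by rewrite cX addn1 ltnS ltnW.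
    by exists y0, y1.
  have [Y0 rY0 Y0B] := line _ y0X; have [Y1 rY1 Y1B] := line _ y1X.
  have avoids P (Y : 'M_n.+1) : pts Y \subset P |: (T :\: pts X) -> P \in pts X -> P \notin pts Y ->
      [disjoint pts X & pts Y] /\ pts Y \subset T.
    move=> /subsetP YB PX PY; have h z : z \in pts Y -> z \in T :\: pts X.
      by move=> zY; have /setU1P[E|//] := YB z zY; rewrite -E zY in PY.
    split; last by apply/subsetP => z /h/setDP[].
    by rewrite -setI_eq0; apply/eqP/setP => z; rewrite in_setI in_set0; apply/andP => -[zX /h]; rewrite in_setD zX.
  have [P0|P0] := boolP (y0 \in pts Y0); last first.
    by have [d1 d2] := avoids _ _ Y0B y0X P0; exists X, Y0.
  have [P1|P1] := boolP (y1 \in pts Y1); last first.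
    by have [d1 d2] := avoids _ _ Y1B y1X P1; exists X, Y1.
  exfalso; have cI : (#|pts Y0 :&: pts Y1| <= 1)%N.
    rewrite -ptsI card_pts (leq_trans (leq_gnum q (_ : _ <= 1)%N)) ?gnumS ?gnum0 ?muln0 //.
    rewrite -ltnS -rY0 ltn_neqAle mxrankS ?capmxSl // andbT.
    apply/negP => /eqP E; have [_] := mxrank_leqif_sup (capmxSl Y0 Y1).
    rewrite E eqxx sub_capmx submx_refl -pts_sub => /esym/subsetP/(_ _ P0)/(subsetP Y1B).
    by rewrite in_setU1 in_setD y0X (negPf y01).
  have : (#|pts Y0 :|: pts Y1| <= #|y0 |: (y1 |: (T :\: pts X))|)%N.
    apply: subset_leq_card; apply/subsetP => z /setUP[/(subsetP Y0B)|/(subsetP Y1B)];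
      by rewrite !inE => /orP[->|->]; rewrite ?orbT.
  have : (#|y0 |: (y1 |: (T :\: pts X))| <= 1 + (1 + #|T :\: pts X|))%N.
    apply: leq_trans (leq_card_setU _ _) _; rewrite cards1 leq_add2l.
    by apply: leq_trans (leq_card_setU _ _) _; rewrite cards1.
  have := cardsUI (pts Y0) (pts Y1); rewrite (card_pts Y0) (card_pts Y1) rY0 rY1 !gnumS gnum0 muln0 add0n muln1.
  move: cI cTX tq' t0t; move: (#|_ :&: _|) (#|_ |: _|) (#|_ :|: _|) (#|_ :\: _|) #|F|; clear; lia.
have {}small (mu : 'cV[F]_n.+1) : V *m mu != 0 -> (#|kerpts T mu| <= t0)%N.
  by move=> nV; have := small mu; rewrite nV /= -leqNgt.
have r3 : (3 <= \rank V)%N.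
  rewrite leqNgt; apply/negP => r2; have := subset_leq_card (sub_span_pts T); rewrite card_pts => h.
  have := leq_trans h (leq_gnum q (r2 : (_ <= 2)%N)); rewrite !gnumS gnum0 muln0 add0n muln1 t0E.
  by move: t02; clear; lia.
exfalso.
have M0 : (0 < q ^ n.-1)%N by rewrite expn_gt0 (ltnW q1).
have [t1 t1E] : {t1 | t1 = (2 * t0)%N} by exists (2 * t0)%N.
have key (mu : 'cV[F]_n.+1) : (#|kerpts T mu| * #|kerpts T mu| + t1 <=
    (t0 + 2) * #|kerpts T mu| + ((V *m mu == 0)%R : nat) * ((#|T| - 2) * (2 * q)))%N.
  have [V0|nV] := eqVneq (V *m mu) 0.
    move/eqP: V0; rewrite span_pts_mul_eq0 => /eqP ->; rewrite mul1n t0E.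
    by move: t1E q1 t02; clear; nia.
  rewrite addn0; have := small mu nV; have := hT _ mu (rank_leq_col _).
  by move: t1E; move: (#|_|) => z; clear; nia.
have : (\sum_(mu : 'cV[F]_n.+1) (#|kerpts T mu| * #|kerpts T mu| + t1) <= \sum_(mu : 'cV[F]_n.+1)
    ((t0 + 2) * #|kerpts T mu| + ((V *m mu == 0)%R : nat) * ((#|T| - 2) * (2 * q))))%N.
  by apply: leq_sum => mu _; apply: key.
rewrite !big_split /= -big_distrr /= hyperplane_second_moment // first_moment //.
rewrite sum_span_indicator sum_nat_const card_functionals // => H.
have := card_span_annihilator r3; rewrite -/V => h3.
have : (#|T| * q + #|T| * (#|T| - 1) + q * q * t1 <= (t0 + 2) * (#|T| * q) + 2 * (#|T| - 2))%N.
  rewrite -(leq_pmul2r M0); move: H h3; move: (#|[set _ | _]|) (q ^ n.-1)%N (#|T|) => u M b; clear.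
  move: (b - 1)%N (b - 2)%N => s s' H h3; have h4 : (u * (s' * (2 * q)) <= 2 * s' * M)%N.
    by rewrite (_ : u * (s' * (2 * q)) = (2 * s') * (u * q))%N; [rewrite leq_mul2l h3 orbT|ring].
  rewrite (_ : (b * q + b * s + q * q * t1) * M = b * (q * M) + b * s * M + q * (q * M) * t1)%N; last by ring.
  apply: leq_trans H _; rewrite [X in (_ <= X)%N](_ : _ = (t0 + 2) * (b * (q * M)) + 2 * s' * M)%N; last by ring.
  by rewrite leq_add2l.
rewrite t0E; have : (t0 * t0 <= q)%N by apply: leq_trans (leq_mul t0t t0t) tq.
by rewrite t1E; move: q7 t02; clear; nia.
Qed.

End Lines.

Lemma bonferroni (X : finType) (I : eqType) (Y : I -> {set X}) (Z : {set X}) (s : seq I) (a b : nat) :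
  uniq s -> (forall i, i \in s -> (a <= #|Y i|)%N) ->
  (forall i j, i \in s -> j \in s -> i != j -> (#|Y i :&: Y j| <= b)%N) ->
  (forall i, i \in s -> Y i \subset Z) -> (size s * a <= #|Z| + 'C(size s, 2) * b)%N.
Proof.
elim: s Z => [|i s IH] Z //= /andP[is_ us] Ya Yb YZ.
have mem j : j \in s -> j \in i :: s by move=> js; rewrite inE js orbT.
have {}IH : (size s * a <= #|\bigcup_(j <- s) Y j| + 'C(size s, 2) * b)%N.
  apply: IH => // [j js|j l js ls|j js]; [exact: Ya (mem j js) | exact: Yb (mem j js) (mem l ls) |].
  by rewrite (big_rem j js) subsetUl.
have cap : (#|Y i :&: \bigcup_(j <- s) Y j| <= size s * b)%N.
  have : {subset s <= [pred j | (#|Y i :&: Y j| <= b)%N]}.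
    move=> j js; rewrite inE; apply: Yb (mem_head _ _) (mem j js) _.
    by apply: contraNneq is_ => ->.
  elim: (s) => [|j l IHl] h; first by rewrite big_nil setI0 cards0.
  rewrite big_cons setIUr (leq_trans (leq_card_setU _ _)) // mulSn leq_add ?IHl //.
    by apply: h; rewrite mem_head.
  by move=> z zl; apply: h; rewrite inE zl orbT.
have : (#|Y i :|: \bigcup_(j <- s) Y j| <= #|Z|)%N.
  rewrite subset_leq_card // subUset YZ ?mem_head //=.
  have : {subset s <= [pred j | Y j \subset Z]} by move=> j /mem/YZ; rewrite inE.
  elim: (s) => [|j l IHl] h; first by rewrite big_nil sub0set.
  rewrite big_cons subUset; apply/andP; split; first exact: h (mem_head _ _).
  by apply: IHl => z zl; apply: h; rewrite inE zl orbT.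
have := cardsUI (Y i) (\bigcup_(j <- s) Y j); have := Ya i (mem_head _ _).
rewrite binS bin1 mulnDl mulSn; move: cap IH.
by move: (#|_ :&: _|) (size s * b)%N (size s * a)%N ('C(_, _) * _)%N; clear; lia.
Qed.

Section SubspaceFamilies.
Variables (F : finFieldType) (n : nat).
Local Notation q := #|F|.
Local Notation pt := (pg_point F n).
Implicit Types (x y z : pt) (S T : {set pt}) (A B K U W X : 'M[F]_n.+1).

Let q1 : (1 < q)%N := finNzRing_gt1 F.
Let q0 : (0 < q)%N := ltnW q1.

Definition subspaces_in r T : {set 'M[F]_n.+1} :=
  [set U | [&& <<U>>%MS == U, \rank U == r & pts U \subset T]].

Lemma subspaces_inP r T U : U \in subspaces_in r T -> \rank U = r /\ pts U \subset T.
Proof. by rewrite inE => /and3P[_ /eqP]. Qed.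

Lemma genmx_subspaces_in r T m (U : 'M[F]_(m, n.+1)) :
  \rank U = r -> pts U \subset T -> <<U>>%MS \in subspaces_in r T.
Proof.
move=> rU UT; rewrite inE genmx_id eqxx mxrank_gen rU eqxx /=.
by rewrite (subset_trans _ UT) // pts_sub genmxE.
Qed.

Lemma subspaces_in_inj r S T U W : U \in subspaces_in r S -> W \in subspaces_in r T ->
  (U <= W)%MS -> U = W.
Proof.
rewrite !inE => /and3P[/eqP gU /eqP rU _] /and3P[/eqP gW /eqP rW _] UW.
rewrite -gU -gW; apply/genmxP; rewrite UW /=.
by have [_] := mxrank_leqif_sup UW; rewrite rU rW eqxx => /esym.
Qed.

Lemma rank_cap_ltn r m1 m2 (U : 'M[F]_(m1, n.+1)) (W : 'M[F]_(m2, n.+1)) :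
  \rank U = r.+1 -> ~~ (U <= W)%MS -> (\rank (U :&: W) <= r)%N.
Proof.
move=> rU UW; rewrite -ltnS -rU ltn_neqAle mxrankS ?capmxSl // andbT.
apply: contra UW => /eqP E; have [_] := mxrank_leqif_sup (capmxSl U W).
by rewrite E eqxx sub_capmx submx_refl => /esym.
Qed.

Lemma card_ptsI_leq r m1 m2 (U : 'M[F]_(m1, n.+1)) (W : 'M[F]_(m2, n.+1)) :
  \rank U = r.+1 -> ~~ (U <= W)%MS -> (#|pts U :&: pts W| <= gnum q r)%N.
Proof. by move=> rU UW; rewrite -ptsI card_pts leq_gnum // rank_cap_ltn. Qed.

Lemma exists_subspace_of_rank r m (U : 'M[F]_(m, n.+1)) : (r <= \rank U)%N ->
  exists2 K : 'M[F]_n.+1, \rank K = r & (K <= U)%MS.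
Proof.
move=> rU; pose L : 'M[F]_(\rank U, n.+1) := pid_mx r *m row_base U.
exists <<L>>%MS; last by rewrite genmxE (submx_trans (submxMl _ _)) // eq_row_base.
by rewrite mxrank_gen mxrankMfree ?row_base_free // rank_pid_mx //; apply: leq_trans rU (rank_leq_col _).
Qed.

Lemma rank_cap_ker1 r m (U : 'M[F]_(m, n.+1)) (mu : 'cV[F]_n.+1) :
  \rank U = r.+1 -> (r <= \rank (U :&: kermx mu))%N.
Proof.
move=> rU; have := mxrank_mul_ker U mu; rewrite rU; have := rank_leq_col (U *m mu).
by move: (\rank _) (\rank _) => a b; clear; lia.
Qed.

Lemma pts_capker m (U : 'M[F]_(m, n.+1)) T a (mu : 'M[F]_(n.+1, a)) : pts U \subset T ->
  pts (U :&: kermx mu)%MS \subset kerpts T mu.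
Proof.
move=> UT; apply/subsetP => x; rewrite !inE -vecP sub_capmx sub_kermx => /andP[xU ->].
by rewrite (subsetP UT) // pts_vec.
Qed.

Lemma kerpts_mul0 m (U : 'M[F]_(m, n.+1)) T a (mu : 'M[F]_(n.+1, a)) :
  pts U \subset kerpts T mu -> U *m mu = 0.
Proof.
move=> UT; apply/eqP; rewrite -sub_kermx -pts_sub.
by apply: subset_trans UT _; apply/subsetP => x; rewrite !inE -vecP sub_kermx => /andP[].
Qed.

Lemma leq_card_incidences r t (AA : {set 'M[F]_n.+1}) (G : {set 'cV[F]_n.+1}) :
  (forall A, A \in AA -> \rank A = r) ->
  (forall mu, mu \in G -> (t <= #|[set A in AA | (A *m mu == 0)%R]|)%N) ->
  (t * #|G| <= #|AA| * q ^ (n.+1 - r))%N.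
Proof.
move=> rA tG; rewrite mulnC -sum_nat_const.
apply: (@leq_trans (\sum_(mu in G) #|[set A in AA | (A *m mu == 0)%R]|)); first exact: leq_sum.
rewrite (sum_card_incidence AA (fun A (mu : 'cV[F]_n.+1) => A *m mu == 0)) -sum_nat_const.
apply: leq_sum => A AAA; rewrite -(rA A AAA) -[X in (_ <= q ^ X)%N]mul1n -card_annihilator.
by apply: subset_leq_card; apply/subsetP => mu; rewrite !inE => /andP[].
Qed.

(* Over K, a hyperplane of each of its members, the family is a partial partition of S \ K. *)
Lemma card_through_leq r s S (AA : {set 'M[F]_n.+1}) K : (AA \subset subspaces_in r.+1 S) ->
  \rank K = r -> (#|S| <= s * q ^ r)%N ->
  (#|[set A in AA | (K <= A)%MS]| <= s)%N.
Proof.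
move=> /subsetP AAS rK lt; set BB := [set A in AA | _].
have c A : A \in BB -> #|pts A :\: pts K| = (q ^ r)%N.
  rewrite inE => /andP[/AAS/subspaces_inP[rA _] KA].
  apply/eqP; rewrite -(eqn_add2l #|pts A :&: pts K|) cardsID card_pts rA.
  by rewrite (setIidPr _) ?pts_sub // card_pts rK gnumSr.
have q_gt0 : (0 < q ^ r)%N by rewrite expn_gt0 q0.
rewrite -(leq_pmul2r q_gt0); apply: leq_trans lt.
have disj A B : A \in BB -> B \in BB -> A != B -> #|(pts A :\: pts K) :&: (pts B :\: pts K)| = 0%N.
  move=> AB BB' AneB; apply/eqP; rewrite cards_eq0; apply/eqP/setP => x; rewrite in_setI !in_setD in_set0.
  apply/negP => /andP[/andP[xK xA] /andP[_ xB]].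
  move: AB BB'; rewrite !inE => /andP[AA1 KA] /andP[BB1 KB].
  have nAB : ~~ (A <= B)%MS by apply: contra AneB => /(subspaces_in_inj (AAS _ AA1) (AAS _ BB1)) ->.
  have [rA _] := subspaces_inP (AAS _ AA1).
  have rc := rank_cap_ltn rA nAB.
  have KAB : (K <= A :&: B)%MS by rewrite sub_capmx KA.
  have [_] := mxrank_leqif_sup KAB; rewrite eqn_leq mxrankS // rK rc => /esym cK.
  by move/negP: xK; apply; rewrite mem_pts (submx_trans _ cK) // sub_capmx -!mem_pts xA.
have := @bonferroni _ _ (fun A => pts A :\: pts K) S (enum BB) (q ^ r) 0 (enum_uniq _).
rewrite muln0 addn0 -cardE; apply=> [A|A B|A]; rewrite ?mem_enum; first by move=> /c ->.
  by move=> AB BB' /(disj A B AB BB') ->.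
rewrite inE => /andP[/AAS/subspaces_inP[_ AS] _].
exact: subset_trans (subsetDl _ _) AS.
Qed.
Lemma neighbours_leq j J s S T (AA : {set 'M[F]_n.+1}) A0 :
  hits 2 j.+2 T -> (#|T| < q ^ j.+3)%N -> S \subset T -> (#|S| <= s * q ^ j.+1)%N ->
  (#|T| + 'C(J.+2, 2) * gnum q j.+1 < J.+2 * gnum q j.+2 + 2 * q ^ j.+2)%N ->
  AA \subset subspaces_in j.+2 S -> A0 \in subspaces_in j.+2 T ->
  (exists X, [/\ \rank X = j.+3, (A0 <= X)%MS & pts X \subset T]) \/
  (#|[set A in AA | (A != A0) && (j < \rank (A :&: A0))]| <= J * s)%N.
Proof.
move=> hT ltT ST leS big /subsetP AAS A0T; set N := [set A in AA | _].
have [rA0 A0s] := subspaces_inP A0T.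
have [/existsP[z /andP[/setDP[zS zA0] many]]|/existsPn few] :=
    boolP [exists z, (z \in S :\: pts A0) && (J < #|[set A in N | z \in pts A]|)%N].
  left; have [X XE] : {X : 'M[F]_n.+1 | X = (A0 + val z)%MS} by exists (A0 + val z)%MS.
  have rX : \rank X = j.+3.
    have := mxrank_sum_cap A0 (val z); rewrite -XE rank_pt rA0.
    suff -> : \rank (A0 :&: val z) = 0%N by rewrite addn0 addn1.
    apply/eqP; rewrite -leqn0 capmxC rank_cap_ltn ?rank_pt //.
    by rewrite -mem_pts.
  have A0X : (A0 <= X)%MS by rewrite XE addsmxSl.
  exists X; split => //.
  pose fam := A0 :: take J.+1 (enum [set A in N | z \in pts A]).
  have famE A : A \in fam -> A = A0 \/ [/\ A \in AA, A != A0, (j < \rank (A :&: A0))%N & z \in pts A].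
    rewrite inE => /predU1P[->|/mem_take]; first by left.
    by rewrite mem_enum !in_set => /andP[/and3P[A1 A2 A3] A4]; right.
  have famT A : A \in fam -> A \in subspaces_in j.+2 T.
    move=> /famE[->//|[/AAS]]; rewrite !inE => /and3P[-> -> AS] _ _ _.
    exact: subset_trans ST.
  have famX A : A \in fam -> (A <= X)%MS.
    move=> Af; case: (famE A Af) => [->//|[AA1 nA rc zA]].
    have [rA _] := subspaces_inP (famT A Af).
    have sA : ((A :&: A0) + val z <= A)%MS by rewrite addsmx_sub capmxSl -mem_pts zA.
    have rs : (\rank A <= \rank ((A :&: A0) + val z)%MS)%N.
      have := mxrank_sum_cap (A :&: A0)%MS (val z); rewrite rank_pt rA.
      have -> : \rank ((A :&: A0) :&: val z)%MS = 0%N.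
        apply/eqP; rewrite -leqn0 capmxC rank_cap_ltn ?rank_pt //.
        by apply: contra zA0 => zc; rewrite mem_pts (submx_trans zc) // capmxSr.
      by rewrite addn0 addn1 => ->; rewrite ltnS.
    have [_] := mxrank_leqif_sup sA; rewrite eqn_leq rs mxrankS // => /esym h.
    by apply: submx_trans h _; rewrite XE addsmxS // capmxSr.
  have ufam : uniq fam.
    rewrite /= take_uniq ?enum_uniq // andbT; apply/negP => /mem_take.
    by rewrite mem_enum !inE eqxx andbF.
  have sfam : size fam = J.+2 by rewrite /= size_takel // -cardE.
  have bon : (J.+2 * gnum q j.+2 <= #|pts X :&: T| + 'C(J.+2, 2) * gnum q j.+1)%N.
    rewrite -sfam; apply: (bonferroni (Y := fun A : 'M[F]_n.+1 => pts A)) ufam _ _ _.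
    - by move=> A /famT/subspaces_inP[rA _]; rewrite card_pts rA.
    - move=> A B Af Bf AB; apply: card_ptsI_leq; first by have [] := subspaces_inP (famT A Af).
      by apply: contra AB => /(subspaces_in_inj (famT A Af) (famT B Bf)) ->.
    - move=> A Af; rewrite subsetI pts_sub famX //.
      by have [_ ->] := subspaces_inP (famT A Af).
  apply: (subspace_gap hT ltT); first by rewrite rX.
  rewrite -(ltn_add2r ('C(J.+2, 2) * gnum q j.+1)); apply: leq_trans big _.
  by rewrite addnAC leq_add2r.
right; have q_gt0 : (0 < q ^ j.+1)%N by rewrite expn_gt0 q0.
rewrite -(leq_pmul2r q_gt0) -mulnA -sum_nat_const.
apply: (@leq_trans (\sum_(A in N) #|pts A :\: pts A0|)).
  apply: leq_sum => A; rewrite inE => /and3P[AA1 AneA0 _].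
  have [rA AS] := subspaces_inP (AAS _ AA1).
  have nA : ~~ (A <= A0)%MS by apply: contra AneA0 => /(subspaces_in_inj (AAS _ AA1) A0T) ->.
  rewrite -(leq_add2l #|pts A :&: pts A0|) cardsID card_pts rA gnumSr addnC [X in (_ <= X)%N]addnC.
  by rewrite leq_add2l card_ptsI_leq.
have -> : (\sum_(A in N) #|pts A :\: pts A0| =
    \sum_(z in S :\: pts A0) #|[set A in N | z \in pts A]|)%N.
  rewrite (sum_card_incidence N (fun A z => z \in pts A)); apply: eq_bigr => A.
  rewrite inE => /and3P[AA1 _ _]; have [_ /subsetP AS] := subspaces_inP (AAS _ AA1).
  apply: eq_card => x; rewrite [RHS]inE !in_setD.
  by case: (boolP (x \in pts A)) => [/AS ->|]; rewrite ?andbT ?andbF.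
apply: (@leq_trans (\sum_(z in S :\: pts A0) J)).
  by apply: leq_sum => z zS; have := few z; rewrite zS /= -leqNgt.
rewrite sum_nat_const mulnC leq_mul2l; apply/orP; right; apply: leq_trans leS.
exact: subset_leq_card (subsetDl _ _).
Qed.

End SubspaceFamilies.

Lemma leq_incidences_trans (M x g a w d e : nat) : (0 < M)%N -> (x * g <= a * M)%N ->
  (M * (w * d) <= g * d + M * e)%N -> (x * (w * d) <= a * d + x * e)%N.
Proof.
move=> M0 inc H; rewrite -(leq_pmul2r M0).
have {}inc : (x * g * d <= a * M * d)%N by rewrite leq_mul2r inc orbT.
have {}H : (x * (M * (w * d)) <= x * (g * d + M * e))%N by rewrite leq_mul2l H orbT.
by move: inc H; clear; lia.
Qed.

Section Step.
Variables (F : finFieldType) (n : nat).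
Local Notation q := #|F|.
Local Notation pt := (pg_point F n).
Implicit Types (x y z : pt) (S T : {set pt}) (A B K U W X : 'M[F]_n.+1).
Hypothesis n_gt0 : (0 < n)%N.
Hypothesis q2 : (2 < q)%N.

Let q1 : (1 < q)%N := finNzRing_gt1 F.
Let q0 : (0 < q)%N := ltnW q1.

Lemma card_exceptional_leq j r c T0 A0 B0 (KK : {set 'M[F]_n.+1}) :
  A0 \in subspaces_in j.+2 T0 -> B0 \in subspaces_in j.+2 T0 -> [disjoint pts A0 & pts B0] ->
  (#|T0| <= 2 * gnum q j.+2 + c)%N -> KK \subset subspaces_in j.+1 T0 ->
  (forall K, K \in KK -> ~~ (K <= A0)%MS && ~~ (K <= B0)%MS) ->
  (c + 'C(r.+1, 2) * gnum q j < r.+1 * (gnum q j.+1 - 2 * gnum q j))%N -> (#|KK| <= r)%N.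
Proof.
move=> /subspaces_inP[rA AT] /subspaces_inP[rB BT] dis leT /subsetP KT KKn; apply: contraTT; rewrite -!ltnNge => ltr.
rewrite ltnS; set AB := pts A0 :|: pts B0.
have cE : (#|T0 :\: AB| <= c)%N.
  rewrite -(leq_add2l #|AB|) -[X in (X + _ <= _)%N](_ : #|T0 :&: AB| = _); last first.
    by congr #|pred_of_set _|; apply/setIidPr; rewrite subUset AT.
  rewrite cardsID; apply: leq_trans leT _; rewrite leq_add2r mul2n -addnn.
  by have := cardsUI (pts A0) (pts B0); rewrite (disjoint_setI0 dis) cards0 addn0 !card_pts rA rB => ->.
pose s := take r.+1 (enum KK).
have sK K : K \in s -> K \in KK by move=> /mem_take; rewrite mem_enum.
have ss : size s = r.+1 by rewrite size_takel // -cardE.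
apply: leq_trans (_ : #|T0 :\: AB| + 'C(r.+1, 2) * gnum q j <= _)%N; last by rewrite leq_add2r.
rewrite -ss; apply: (bonferroni (Y := fun K : 'M[F]_n.+1 => pts K :\: AB)).
- exact: take_uniq (enum_uniq _).
- move=> K Ks; have [rK _] := subspaces_inP (KT _ (sK K Ks)); have /andP[KA KB] := KKn _ (sK K Ks).
  rewrite leq_subLR -rK -card_pts -(cardsID AB (pts K)) leq_add2r setIUr.
  apply: leq_trans (leq_card_setU _ _) _; rewrite mul2n -addnn.
  by rewrite leq_add // card_ptsI_leq.
- move=> K L Ks Ls KL; have [rK _] := subspaces_inP (KT _ (sK K Ks)).
  apply: leq_trans (_ : #|pts K :&: pts L| <= _)%N; last first.
    apply: card_ptsI_leq => //; apply: contra KL => /(subspaces_in_inj (KT _ (sK K Ks)) (KT _ (sK L Ls))) ->.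
    by rewrite eqxx.
  by apply: subset_leq_card; apply: setISS; apply: subsetDl.
- by move=> K Ks; apply: setSD; have [_] := subspaces_inP (KT _ (sK K Ks)).
Qed.

Lemma card_family_leq j r s c N S T (mu : 'cV[F]_n.+1) (AA : {set 'M[F]_n.+1}) A0 B0 :
  AA \subset subspaces_in j.+2 S -> S \subset T -> (#|S| <= s * q ^ j.+1)%N ->
  A0 \in subspaces_in j.+2 (kerpts T mu) -> B0 \in subspaces_in j.+2 (kerpts T mu) ->
  [disjoint pts A0 & pts B0] -> (#|kerpts T mu| <= 2 * gnum q j.+2 + c)%N ->
  (c + 'C(r.+1, 2) * gnum q j < r.+1 * (gnum q j.+1 - 2 * gnum q j))%N ->
  (forall C, C \in [set A0; B0] -> (#|[set A in AA | (A != C) && (j < \rank (A :&: C))]| <= N)%N) ->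
  (#|AA| <= 2 + 2 * N + r * s)%N.
Proof.
move=> AAS ST leS A0T B0T dis leT num nb.
pose KK := [set K in subspaces_in j.+1 (kerpts T mu) | ~~ (K <= A0)%MS && ~~ (K <= B0)%MS].
have cKK : (#|KK| <= r)%N.
  apply: (card_exceptional_leq A0T B0T dis leT _ _ num).
    by apply/subsetP => K; rewrite inE => /andP[].
  by move=> K; rewrite inE => /andP[].
pose nbs (D : 'M[F]_n.+1) := [set A in AA | (A != D) && (j < \rank (A :&: D))%N].
have cover : AA \subset [set A0; B0] :|: (nbs A0 :|: nbs B0) :|: \bigcup_(K in KK) [set A in AA | (K <= A)%MS].
  apply/subsetP => A AA1; have [rA AS] := subspaces_inP (subsetP AAS _ AA1).
  have [K0 rK K0A] := exists_subspace_of_rank (rank_cap_ker1 mu rA).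
  rewrite sub_capmx in K0A; have /andP[K0A' K0mu] := K0A.
  have [K KE] : {K | K = <<K0>>%MS} by exists <<K0>>%MS.
  have EK : (K :=: K0)%MS by rewrite KE; apply: genmxE.
  have KT : K \in subspaces_in j.+1 (kerpts T mu).
    rewrite KE genmx_subspaces_in //.
    apply: subset_trans (pts_capker mu (subset_trans AS ST)).
    by rewrite pts_sub sub_capmx.
  have near (D : 'M[F]_n.+1) : (K <= D)%MS -> A != D -> A \in nbs D.
    move=> KD AD; rewrite inE AA1 AD; apply: leq_trans (_ : \rank K <= _)%N; first by rewrite EK rK.
    by rewrite mxrankS // sub_capmx KD EK K0A'.
  rewrite !in_setU !in_set1; have [//|nA0] := eqVneq A A0; have [//|nB0] := eqVneq A B0.
  have [KA|KA] := boolP (K <= A0)%MS; first by rewrite near.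
  have [KB|KB] := boolP (K <= B0)%MS; first by rewrite (near B0) ?orbT.
  apply/orP; right; apply/bigcupP; exists K; first by rewrite inE KT KA KB.
  by rewrite inE AA1 EK.
apply: leq_trans (subset_leq_card cover) _; apply: leq_trans (leq_card_setU _ _) (leq_add _ _).
  apply: leq_trans (leq_card_setU _ _) (leq_add _ _); first by rewrite cards2; case: (_ != _).
  rewrite mul2n -addnn; apply: leq_trans (leq_card_setU _ _) (leq_add _ _); apply: nb; rewrite !inE eqxx ?orbT //.
apply: leq_trans (card_bigcup_le _ _) _; apply: (@leq_trans (\sum_(K in KK) s)); last first.
  by rewrite sum_nat_const leq_mul2r cKK orbT.
apply: leq_sum => K; rewrite inE => /andP[/subspaces_inP[rK _] _].
exact: card_through_leq AAS rK leS.
Qed.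

Lemma double_gnum_leq r : (2 * gnum q r <= q ^ r)%N.
Proof.
rewrite -(gnum_geom r q0) (leq_trans _ (leq_addr _ _)) // leq_mul2r; apply/orP; right.
by rewrite -ltnS prednK.
Qed.

Lemma good_hyperplanes k c c' T : hits 2 k.+2 T -> (#|T| <= 2 * gnum q k.+3 + c')%N ->
  (q * q ^ n.-1 * (q * c.+1) <=
   #|[set mu : 'cV[F]_n.+1 | #|kerpts T mu| <= 2 * gnum q k.+2 + c]| * c.+1 + q * q ^ n.-1 * (c' + 2))%N.
Proof.
move=> hT leT; set G := [set mu | _].
have lb (mu : 'cV[F]_n.+1) : (2 * gnum q k.+2 <= #|kerpts T mu|)%N.
  have [lt|ge] := ltnP #|kerpts T mu| (q ^ k.+2); first exact: leq_card_hits (hits_hyperplane mu hT) lt.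
  exact: leq_trans (double_gnum_leq _) ge.
have : (\sum_(mu : 'cV[F]_n.+1) (2 * gnum q k.+2 + c.+1) <=
    \sum_(mu : 'cV[F]_n.+1) (#|kerpts T mu| + (mu \in G) * c.+1))%N.
  apply: leq_sum => mu _; rewrite inE; case: (leqP #|kerpts T mu| (2 * gnum q k.+2 + c)) => h.
    by rewrite mul1n leq_add2r.
  by rewrite mul0n addn0 addnS.
have cst d : (\sum_(mu : 'cV[F]_n.+1) d = q * (q * q ^ n.-1) * d)%N.
  by rewrite sum_nat_const -[X in (_ = X * _)%N](card_functionals F n_gt0).
rewrite cst big_split -big_distrl first_moment //=.
have -> : (\sum_(mu : 'cV[F]_n.+1) (mu \in G) = #|G|)%N.
  by rewrite -sum1_card [RHS]big_mkcond /=; apply: eq_bigr => mu _; case: (_ \in _).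
move: leT; rewrite [gnum q k.+3]gnumS; move: (q ^ n.-1)%N #|G| #|T| (gnum q k.+2) => M g t a; clear.
move: #|F| => w; move: c.+1 => d; clear => leT H.
have h : (t * (w * M) <= (2 * (w * a + 1) + c') * (w * M))%N by rewrite leq_mul2r leT orbT.
rewrite -(leq_add2l (w * (w * M) * (2 * a))).
have -> : (w * (w * M) * (2 * a) + w * M * (w * d) = w * (w * M) * (2 * a + d))%N by ring.
apply: leq_trans H _.
have -> : (w * (w * M) * (2 * a) + (g * d + w * M * (c' + 2)) = (2 * (w * a + 1) + c') * (w * M) + g * d)%N by ring.
by rewrite leq_add2r.
Qed.

(* The first subspace is found among the spans of A0 or B0 with a point, where A0
   and B0 are the two subspaces in a good section; the second one in the same
   way from the subspaces disjoint from the first.  J bounds the members of the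
   family meeting A0 in codimension 1 through a given point outside A0, and r
   the traces on the section contained in neither A0 nor B0. *)
Theorem double_blocking_step j c c' J r s s2 T :
  hits 2 j.+2 T -> (#|T| <= 2 * gnum q j.+3 + c')%N ->
  (forall T' : {set pt}, hits 2 j.+1 T' -> (#|T'| <= 2 * gnum q j.+2 + c)%N ->
    exists X1 X2 : 'M[F]_n.+1, [/\ \rank X1 = j.+2, \rank X2 = j.+2, [disjoint pts X1 & pts X2],
      pts X1 \subset T' & pts X2 \subset T']) ->
  (2 * gnum q j.+3 + c' + c'.+1 * q < q ^ j.+3)%N ->
  (2 * gnum q j.+3 + c' + 'C(J.+2, 2) * gnum q j.+1 < J.+2 * gnum q j.+2 + 2 * q ^ j.+2)%N ->
  (c + 'C(r.+1, 2) * gnum q j < r.+1 * (gnum q j.+1 - 2 * gnum q j))%N ->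
  (2 * gnum q j.+3 + c' <= s * q ^ j.+1)%N ->
  (gnum q j.+3 + c' <= s2 * q ^ j.+1)%N ->
  ((2 + 2 * (J * s) + r * s) * c.+1 + 2 * q ^ j.+1 * (c' + 2) < 2 * q ^ j.+1 * (q * c.+1))%N ->
  ((3 + 2 * (J * s2) + r * s2) * c.+1 + q ^ j.+1 * (c' + 2) < q ^ j.+1 * (q * c.+1))%N ->
  (c + 2 * gnum q j.+1 < gnum q j.+2)%N ->
  exists X1 X2 : 'M[F]_n.+1, [/\ \rank X1 = j.+3, \rank X2 = j.+3, [disjoint pts X1 & pts X2],
    pts X1 \subset T & pts X2 \subset T].
Proof.
move=> hT leT IH N1 N2 N3 N4 N5 N6 N7 N8.
have ltT : (#|T| < q ^ j.+3)%N.
  by apply: leq_ltn_trans leT (leq_ltn_trans _ N1); apply: leq_addr.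
have N2T : (#|T| + 'C(J.+2, 2) * gnum q j.+1 < J.+2 * gnum q j.+2 + 2 * q ^ j.+2)%N.
  by apply: leq_ltn_trans N2; rewrite leq_add2r.
have leTs := leq_trans leT N4.
pose good := [set mu : 'cV[F]_n.+1 | (#|kerpts T mu| <= 2 * gnum q j.+2 + c)%N].
have cgood := good_hyperplanes c hT leT; rewrite -/good in cgood.
have M0 : (0 < q ^ n.-1)%N by rewrite expn_gt0 q0.
have qM0 : (0 < q * q ^ n.-1)%N by rewrite muln_gt0 q0.
have Q0 : (0 < q ^ j.+1)%N by rewrite expn_gt0 q0.
pose AA := subspaces_in j.+2 T.
have pairs (mu : 'cV[F]_n.+1) : mu \in good -> exists A B, [/\ A \in subspaces_in j.+2 (kerpts T mu),
    B \in subspaces_in j.+2 (kerpts T mu) & [disjoint pts A & pts B]].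
  rewrite inE => mug; have [A [B [rA rB dis AT BT]]] := IH _ (hits_hyperplane mu hT) mug.
  exists <<A>>%MS, <<B>>%MS; split; [exact: genmx_subspaces_in | exact: genmx_subspaces_in |].
  move: dis; rewrite !disjoint_pts => /eqP h; rewrite -leqn0 -h mxrankS // capmxS ?genmxE //.
have lift (mu : 'cV[F]_n.+1) A : A \in subspaces_in j.+2 (kerpts T mu) -> A \in AA /\ A *m mu = 0.
  move=> AT; split; last by have [_] := subspaces_inP AT; apply: kerpts_mul0.
  move: AT; rewrite !inE => /and3P[-> -> AT] /=; apply: subset_trans AT (kerpts_sub _ _).
have neq_disj A B (T' : {set pt}) : A \in subspaces_in j.+2 T' -> [disjoint pts A & pts B] -> A != B.
  move=> /subspaces_inP[rA _] dis; apply: contraTneq dis => <-.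
  by rewrite -setI_eq0 setIid -cards_eq0 card_pts rA gnumS addn1.
have [mu0 mu0g] : exists mu0, mu0 \in good.
  apply/set0Pn; apply: contraTneq N6 => good0; rewrite -leqNgt.
  move: cgood; rewrite good0 cards0 mul0n add0n leq_pmul2l // => h.
  by apply: leq_trans (leq_addl _ _); rewrite leq_pmul2l // muln_gt0.
have jn : (j.+2 <= n.+1)%N.
  have [A [B [/subspaces_inP[rA _] _ _]]] := pairs _ mu0g.
  by rewrite -rA rank_leq_row.
have qM : (q ^ (n.+1 - j.+2) * q ^ j.+1 = q * q ^ n.-1)%N.
  by rewrite -expnD -expnS prednK //; congr (_ ^ _)%N; move: jn; clear; lia.
have inc1 : (2 * #|good| * q ^ j.+1 <= #|AA| * (q * q ^ n.-1))%N.
  rewrite -qM mulnA leq_mul2r; apply/orP; right.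
  apply: leq_card_incidences => [A /subspaces_inP[] //|mu mug].
  have [A [B [AT BT dis]]] := pairs mu mug.
  have [AA1 Amu] := lift mu A AT; have [BA1 Bmu] := lift mu B BT.
  have AB := neq_disj _ _ _ AT dis.
  have <- : #|[set A; B]| = 2%N by rewrite cards2 AB.
  by apply: subset_leq_card; apply/subsetP => D /set2P[] ->; rewrite inE ?AA1 ?BA1 ?Amu ?Bmu eqxx.
have big1 : (2 + 2 * (J * s) + r * s < #|AA|)%N.
  rewrite ltnNge; apply: contraTN N6 => leAA; rewrite -leqNgt.
  have {}leAA : (#|AA| * c.+1 <= (2 + 2 * (J * s) + r * s) * c.+1)%N by rewrite leq_mul2r leAA orbT.
  rewrite (leq_trans _ (leq_add leAA (leqnn _))) //; apply: leq_incidences_trans qM0 _ cgood.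
  by rewrite mulnAC.
have [X1 rX1 X1T] : exists2 X1 : 'M[F]_n.+1, \rank X1 = j.+3 & pts X1 \subset T.
  have [A0 [B0 [A0T B0T dis]]] := pairs _ mu0g.
  have [[X [rX _ XT]]|nA] := neighbours_leq hT ltT (subxx T) leTs N2T (subxx AA) (proj1 (lift _ _ A0T)).
    by exists X.
  have [[X [rX _ XT]]|nB] := neighbours_leq hT ltT (subxx T) leTs N2T (subxx AA) (proj1 (lift _ _ B0T)).
    by exists X.
  have := card_family_leq (subxx AA) (subxx T) leTs A0T B0T dis _ N3 (N := J * s).
  rewrite inE in mu0g; move=> /(_ mu0g) h; exfalso; move: big1; rewrite ltnNge => /negP; apply.
  by apply: h => D /set2P[] ->.
have jn3 : (j.+3 <= n.+1)%N by rewrite -rX1 rank_leq_row.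
pose kills := [set mu : 'cV[F]_n.+1 | X1 *m mu == 0].
have ckills : (#|kills| * q ^ j.+1 <= q * q ^ n.-1)%N.
  rewrite card_annihilator rX1 mul1n -expnD (leq_trans _ (leq_pmull _ q0)) //.
  by rewrite leq_pexp2l //; move: jn3; clear; lia.
set good' := good :\: kills.
have cgood' : (#|good| <= #|kills| + #|good'|)%N.
  by rewrite -(cardsID kills good) leq_add2r subset_leq_card // subsetIr.
pose AA' := [set A in AA | [disjoint pts A & pts X1]].
have AA'S : AA' \subset subspaces_in j.+2 (T :\: pts X1).
  apply/subsetP => A; rewrite !inE => /andP[/and3P[-> -> AT] dis] /=.
  by rewrite subsetD AT.
have split_good mu : mu \in good' -> exists A B, [/\ A \in subspaces_in j.+2 (kerpts T mu),
    B \in subspaces_in j.+2 (kerpts T mu), [disjoint pts A & pts B], (A <= X1)%MS & [disjoint pts B & pts X1]].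
  move=> /setDP[mug]; rewrite inE => nX1; have [A [B [AT BT dis]]] := pairs mu mug.
  have [rA sA] := subspaces_inP AT; have [rB sB] := subspaces_inP BT.
  pose Y := <<X1 :&: kermx mu>>%MS.
  have YE : (Y :=: X1 :&: kermx mu)%MS by apply: genmxE.
  have rY : \rank (X1 :&: kermx mu) = j.+2.
    apply/eqP; rewrite eqn_leq rank_cap_ker1 // andbT rank_cap_ltn //.
    by rewrite sub_kermx.
  have YT : Y \in subspaces_in j.+2 (kerpts T mu) by rewrite genmx_subspaces_in // pts_capker.
  have [_ sY] := subspaces_inP YT; have rY' : \rank Y = j.+2 by rewrite YE.
  have YAB : (Y <= A)%MS || (Y <= B)%MS.
    apply: contraTT N8; rewrite negb_or -leqNgt => /andP[YA YB].
    rewrite -[in X in (X <= _)%N]rY' -card_pts -(cardsID (pts A :|: pts B) (pts Y)) addnC leq_add //.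
      have : (#|kerpts T mu :\: (pts A :|: pts B)| <= c)%N.
        move: mug; rewrite inE -(cardsID (pts A :|: pts B)) (setIidPr _) ?subUset ?sA //.
        have := cardsUI (pts A) (pts B); rewrite (disjoint_setI0 dis) cards0 addn0 !card_pts rA rB => ->.
        by rewrite addnn -mul2n leq_add2l.
      by apply: leq_trans; apply: subset_leq_card; apply: setSD.
    rewrite setIUr (leq_trans (leq_card_setU _ _)) // mul2n -addnn leq_add // card_ptsI_leq //.
  have Ysub : (Y <= X1)%MS by rewrite YE capmxSl.
  have main A' B' : A' \in subspaces_in j.+2 (kerpts T mu) -> B' \in subspaces_in j.+2 (kerpts T mu) ->
      [disjoint pts A' & pts B'] -> (Y <= A')%MS -> (A' <= X1)%MS /\ [disjoint pts B' & pts X1].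
    move=> A'T B'T dis' YA'; have E := subspaces_in_inj YT A'T YA'; split; first by rewrite -E.
    rewrite -setI_eq0; apply/eqP/setP => x; rewrite in_setI in_set0; apply/negP => /andP[xB xX].
    have [_ /subsetP/(_ x xB)] := subspaces_inP B'T; rewrite inE => /andP[_ xmu].
    have : x \in pts A' :&: pts B'.
      by rewrite in_setI xB andbT -E !pts_vec YE sub_capmx -pts_vec xX sub_kermx.
    by rewrite (disjoint_setI0 dis') in_set0.
  case/orP: YAB => h; first by have [h1 h2] := main A B AT BT dis h; exists A, B.
  rewrite disjoint_sym in dis; have [h1 h2] := main B A BT AT dis h; by exists B, A.
have inc2 : (#|good'| * q ^ j.+1 <= #|AA'| * (q * q ^ n.-1))%N.
  rewrite -qM mulnA leq_mul2r; apply/orP; right; rewrite -[#|good'|]mul1n.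
  apply: leq_card_incidences => [A|mu mug].
    by move=> /(subsetP AA'S)/subspaces_inP[].
  have [A [B [_ BT _ _ dis]]] := split_good mu mug; have [BA1 Bmu] := lift mu B BT.
  by apply/card_gt0P; exists B; rewrite in_set [B \in AA']in_set BA1 dis Bmu eqxx.
have big2 : (2 + 2 * (J * s2) + r * s2 < #|AA'|)%N.
  rewrite ltnNge; apply: contraTN N7 => leAA; rewrite -leqNgt.
  have {}leAA : (#|AA'|.+1 * c.+1 <= (3 + 2 * (J * s2) + r * s2) * c.+1)%N by rewrite leq_mul2r ltnS leAA orbT.
  rewrite (leq_trans _ (leq_add leAA (leqnn _))) //; apply: leq_incidences_trans qM0 _ cgood.
  rewrite mulnC; apply: (@leq_trans ((#|kills| + #|good'|) * q ^ j.+1)); first by rewrite leq_mul2r cgood' orbT.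
  by rewrite mulnDl mulSn leq_add.
have [mu1 mu1g] : exists mu1, mu1 \in good'.
  apply/set0Pn; apply: contraTneq N7 => g0; rewrite g0 cards0 addn0 in cgood'; rewrite -leqNgt.
  have inc : (#|good| * q ^ j.+1 <= q * q ^ n.-1)%N by rewrite (leq_trans _ ckills) // leq_mul2r cgood' orbT.
  apply: (@leq_trans (1 * c.+1 + q ^ j.+1 * (c' + 2))); last by rewrite leq_add2r leq_mul2r.
  by apply: leq_incidences_trans qM0 _ cgood; rewrite mulnC mul1n.
have [A0 [B0 [A0T B0T dis A0X1 B0X1]]] := split_good mu1 mu1g.
have leTs2 : (#|T :\: pts X1| <= s2 * q ^ j.+1)%N.
  apply: leq_trans N5; rewrite -(leq_add2l #|pts X1|) -[X in (X + #|_ :\: _| <= _)%N](_ : #|T :&: pts X1| = _).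
    rewrite cardsID (leq_trans leT) // card_pts rX1 mul2n -addnn addnA leqnn //.
  by congr #|pred_of_set _|; apply/setIidPr.
have [[X [rX2 B0X X2T]]|nB] :=
    neighbours_leq hT ltT (subsetDl T _) leTs2 N2T AA'S (proj1 (lift _ _ B0T)); last first.
  exfalso; have h := card_family_leq AA'S (subsetDl T _) leTs2 A0T B0T dis _ N3 (N := J * s2).
  move: big2; rewrite ltnNge => /negP; apply; apply: h.
    by move: mu1g; rewrite !inE => /andP[].
  move=> D /set2P[] -> //; rewrite (_ : [set _ in _ | _] = set0) ?cards0 //.
  apply/setP => A; rewrite in_set0 !inE; apply/negP => /and3P[/andP[_]].
  rewrite disjoint_pts => /eqP r0 _; rewrite ltnNge => /negP; apply.
  by rewrite (leq_trans (mxrankS (capmxS (submx_refl A) A0X1))) // r0.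
exists X1, X; split => //.
apply: (full_subspaces_disjoint hT X1T X2T); apply: leq_ltn_trans N1.
have [rB0 _] := subspaces_inP B0T.
have cap : (\rank (X1 :&: X) <= 1)%N.
  have s1 : ((X1 :&: X) + B0 <= X)%MS by rewrite addsmx_sub capmxSr.
  have := mxrankS s1; rewrite rX2; have := mxrank_sum_cap (X1 :&: X)%MS B0; rewrite rB0.
  have -> : \rank ((X1 :&: X) :&: B0)%MS = 0%N.
    apply/eqP; move: B0X1; rewrite disjoint_pts => /eqP h; rewrite -leqn0 -h mxrankS //.
    by rewrite sub_capmx capmxSr (submx_trans (capmxSl _ _)) // capmxSl.
  by move: (\rank _) (\rank _) => u v; clear; lia.
apply: leq_add => //; rewrite leq_mul2r; apply/orP; right.
have cc : (#|pts X1 :&: pts X| <= 1)%N by rewrite -ptsI card_pts (leq_trans (leq_gnum q cap)) // gnumS gnum0 muln0.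
have := cardsUI (pts X1) (pts X); have := cardsID (pts X1 :|: pts X) T.
have -> : #|T :&: (pts X1 :|: pts X)| = #|pts X1 :|: pts X|.
  by congr #|pred_of_set _|; apply/setIidPr; rewrite subUset X1T.
rewrite (card_pts X1) (card_pts X) rX1 rX2.
by move: leT cc; move: #|T| (#|_ :&: _|) (#|_ :|: _|) (#|_ :\: _|) (gnum _ _); clear; lia.
Qed.

End Step.

Section StepNumerics.
Local Open Scope nat_scope.

Lemma step_numeric_large (w Q g c c' : nat) : 25 <= w -> w * g + 1 = g + Q ->
  (g == 0) && (c == 3) || (0 < g) && (c + g == 2 * Q) -> c' + (g + Q) <= 2 * (w * Q) ->
  [/\ 2 * (g + Q + w * Q + w * (w * Q)) + c' + c'.+1 * w < w * (w * (w * Q)),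
   2 * (g + Q + w * Q + w * (w * Q)) + c' + 10 * (g + Q) <
   5 * (g + Q + w * Q) + 2 * (w * (w * Q)),
   c + 6 * g < 4 * (g + Q - 2 * g),
   2 * (g + Q + w * Q + w * (w * Q)) + c' <= (2 * w + 5) * (w * Q) &
   g + Q + w * Q + w * (w * Q) + c' <= (w + 4) * (w * Q)] /\
  [/\
   (2 + 2 * (3 * (2 * w + 5)) + 3 * (2 * w + 5)) * c.+1 +
    2 * (w * Q) * (c' + 2) < 2 * (w * Q) * (w * c.+1),
   (3 + 2 * (3 * (w + 4)) + 3 * (w + 4)) * c.+1 +
   w * Q * (c' + 2) < w * Q * (w * c.+1) &
   c + 2 * (g + Q) < g + Q + w * Q].
Proof.
move=> w25 gQ cE c'E.
have Q1 : 1 <= Q by nia.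
have wQ : 25 * Q <= w * Q by rewrite leq_mul2r w25 orbT.
have wwQ : 25 * (w * Q) <= w * (w * Q) by rewrite leq_mul2r w25 orbT.
have wwwQ : 25 * (w * (w * Q)) <= w * (w * (w * Q)) by rewrite leq_mul2r w25 orbT.
have g24 : 24 * g < Q by nia.
have ww : w <= w * Q by rewrite leq_pmulr.
have c'w : c' * w + w * g + w * Q <= 2 * (w * (w * Q)) by nia.
have wA : c' + 2 + (w - 1) <= w * c.+1.
  by case/orP: cE => /andP[g0 /eqP E]; nia.
have [A AE] : exists A, w * c.+1 = c' + 2 + A.
  by exists (w * c.+1 - (c' + 2)); lia.
have {}wA : w - 1 <= A by lia.
have A1 : (18 * w + 47) * c.+1 < 2 * (w * Q) * A /\ (9 * w + 39) * c.+1 < w * Q * A.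
  case/orP: cE => /andP[g0 /eqP E].
    have Q1' : Q = 1 by nia.
    subst Q; have A2 : 2 * w - 1 <= A by lia.
    by subst c; split; nia.
  have h : w * Q * (w - 1) <= w * Q * A by rewrite leq_mul2l wA orbT.
  have h2 : 24 * (w * Q) <= w * Q * (w - 1) by rewrite [leqRHS]mulnC leq_mul2r; lia.
  have c2 : c.+1 <= 2 * Q by lia.
  have h3 : (18 * w + 47) * c.+1 <= (18 * w + 47) * (2 * Q) by rewrite leq_mul2l c2 orbT.
  have h4 : (9 * w + 39) * c.+1 <= (9 * w + 39) * (2 * Q) by rewrite leq_mul2l c2 orbT.
  by split; lia.
split; split.
- lia.
- lia.
- case/orP: cE => /andP[g0 /eqP E]; lia.
- lia.
- lia.
- rewrite AE; case: A1; lia.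
- rewrite AE; case: A1; lia.
- case/orP: cE => /andP[g0 /eqP E]; lia.
Qed.

Lemma step_numeric_prime (w Q g c c' : nat) : 11 <= w -> w * g + 1 = g + Q ->
  (g == 0) && (c == 0) || (0 < g) && (w * c == 5 * Q) -> c' <= 5 * Q ->
  [/\ 2 * (g + Q + w * Q + w * (w * Q)) + c' + c'.+1 * w < w * (w * (w * Q)),
   2 * (g + Q + w * Q + w * (w * Q)) + c' + 3 * (g + Q) <
   3 * (g + Q + w * Q) + 2 * (w * (w * Q)),
   c + 0 * g < 1 * (g + Q - 2 * g),
   2 * (g + Q + w * Q + w * (w * Q)) + c' <= (2 * w + 5) * (w * Q) &
   g + Q + w * Q + w * (w * Q) + c' <= (w + 4) * (w * Q)] /\
  [/\
   (2 + 2 * (1 * (2 * w + 5)) + 0 * (2 * w + 5)) * c.+1 +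
    2 * (w * Q) * (c' + 2) < 2 * (w * Q) * (w * c.+1),
   (3 + 2 * (1 * (w + 4)) + 0 * (w + 4)) * c.+1 +
   w * Q * (c' + 2) < w * Q * (w * c.+1) &
   c + 2 * (g + Q) < g + Q + w * Q].
Proof.
move=> w11 gQ cE c'E.
have Q1 : 1 <= Q by nia.
have wQ : 11 * Q <= w * Q by rewrite leq_mul2r w11 orbT.
have wwQ : 11 * (w * Q) <= w * (w * Q) by rewrite leq_mul2r w11 orbT.
have wwwQ : 11 * (w * (w * Q)) <= w * (w * (w * Q)) by rewrite leq_mul2r w11 orbT.
have g10 : 10 * g < Q by nia.
have ww : w <= w * Q by rewrite leq_pmulr.
have c'w : c' * w <= 5 * (w * Q) by nia.
have c11 : 11 * c <= 5 * Q by case/orP: cE => /andP[_ /eqP E]; nia.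
have [A AE] : exists A, w * c.+1 = c' + 2 + A.
  exists (w * c.+1 - (c' + 2)); apply/esym/subnKC; rewrite mulnS.
  case/orP: cE => /andP[g0 /eqP E]; last by lia.
  by move/eqP: g0 gQ => -> ; rewrite muln0 !add0n E => Q1'; rewrite -Q1' in c'E; lia.
have A1 : (4 * w + 12) * c.+1 < 2 * (w * Q) * A /\ (2 * w + 11) * c.+1 < w * Q * A.
  case/orP: cE => /andP[g0 /eqP E].
    have Q1' : Q = 1 by nia.
    subst Q; have A2 : w - 7 <= A by lia.
    by subst c; split; nia.
  have wA : w - 2 <= A by move: AE; rewrite mulnS E; lia.
  have h : w * Q * (w - 2) <= w * Q * A by rewrite leq_mul2l wA orbT.
  have h2 : 9 * (w * Q) <= w * Q * (w - 2) by rewrite [leqRHS]mulnC leq_mul2r; lia.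
  have c2 : c.+1 <= Q by lia.
  have h3 : (4 * w + 12) * c.+1 <= (4 * w + 12) * Q by rewrite leq_mul2l c2 orbT.
  have h4 : (2 * w + 11) * c.+1 <= (2 * w + 11) * Q by rewrite leq_mul2l c2 orbT.
  by split; lia.
split; split.
- lia.
- lia.
- lia.
- lia.
- lia.
- rewrite AE; case: A1; lia.
- rewrite AE; case: A1; lia.
- lia.
Qed.

End StepNumerics.

Section DoubleBlockingSubspaces.
Variables (F : finFieldType) (n : nat).
Local Notation q := #|F|.
Local Notation pt := (pg_point F n).
Hypothesis n_gt0 : (0 < n)%N.

Definition contains_disjoint_subspaces k (T : {set pt}) := exists X1 X2 : 'M[F]_n.+1,
  [/\ \rank X1 = k.+1, \rank X2 = k.+1, [disjoint pts X1 & pts X2],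
      pts X1 \subset T & pts X2 \subset T].

(* The bound 2 q^(k-1) - gnum (k-1) on the excess satisfies c_(k+1) = q c_k - 1,
   which leaves exactly enough good hyperplane sections. *)
Lemma double_blocking_subspaces_large k c T : (25 <= q)%N -> (0 < k)%N ->
  ((k == 1)%N && (c <= 3)%N) || (2 <= k)%N && (c + gnum q k.-1 <= 2 * q ^ k.-1)%N ->
  hits 2 k T -> (#|T| <= 2 * gnum q k.+1 + c)%N -> contains_disjoint_subspaces k T.
Proof.
move=> q25; elim: k c T => // -[_ c T _ /orP[/andP[_ c3]|//] hT leT|j IH c' T _ c'E hT leT].
  have [|||X1 [X2 h]] := @double_blocking_contains_lines _ _ n_gt0 T 5 hT _ _ _.
  - by apply: leq_trans leT _; rewrite !gnumS gnum0 muln0 add0n muln1; move: c3; clear; lia.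
  - exact: q25.
  - exact: leq_trans q25.
  by exists X1, X2.
have q2 : (2 < q)%N := leq_trans (isT : (2 < 25)%N) q25.
have {}c'E : (c' + gnum q j.+1 <= 2 * q ^ j.+1)%N by case/orP: c'E => /andP[].
have [c cE] : exists c, (j == 0)%N && (c == 3)%N || (0 < j)%N && (c + gnum q j == 2 * q ^ j)%N.
  case: (j) => [|i]; first by exists 3%N.
  exists (2 * q ^ i.+1 - gnum q i.+1)%N; rewrite /= subnK // (@leq_trans (2 * gnum q i.+1)) ?leq_pmull //.
  by rewrite (leq_trans (double_gnum_leq q2 _)) // leq_pmull.
have IHc (T' : {set pt}) : hits 2 j.+1 T' -> (#|T'| <= 2 * gnum q j.+2 + c)%N ->
    contains_disjoint_subspaces j.+1 T'.
  apply: IH => //; case/orP: cE => /andP[h1 /eqP h2]; first by rewrite h2 eqSS h1.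
  by apply/orP; right; rewrite ltnS h1 /= h2.
have gq : (q * gnum q j + 1 = gnum q j + q ^ j)%N by rewrite -gnumS gnumSr.
rewrite gnumSr expnS in c'E.
have gcE : ((gnum q j == 0) && (c == 3) || (0 < gnum q j) && (c + gnum q j == 2 * q ^ j))%N.
  by move: cE; case: (j) => [|i]; rewrite ?gnum0 // gnumS addn1.
have [[N1 N2 N3 N4 N5] [N6 N7 N8]] := step_numeric_large q25 gq gcE c'E.
apply: (double_blocking_step n_gt0 q2 (c := c) (c' := c') (J := 3) (r := 3)
  (s := 2 * q + 5) (s2 := q + 4) hT leT IHc); rewrite ?gnumSr ?expnS //.
Qed.

Lemma double_blocking_subspaces_prime k c T : (11 <= q)%N -> (0 < k)%N ->
  ((k == 1)%N && (c == 0)%N) || (2 <= k)%N && (c <= 5 * q ^ k.-2)%N ->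
  hits 2 k T -> (#|T| <= 2 * gnum q k.+1 + c)%N -> contains_disjoint_subspaces k T.
Proof.
move=> q11; elim: k c T => // -[_ c T _ /orP[/andP[_ /eqP ->]|//] hT leT|j IH c' T _ c'E hT leT].
  have [|||X1 [X2 h]] := @double_blocking_contains_lines _ _ n_gt0 T 2 hT _ _ _.
  - by apply: leq_trans leT _; rewrite !gnumS gnum0 muln0 add0n muln1; clear; lia.
  - exact: leq_trans q11.
  - exact: leq_trans q11.
  by exists X1, X2.
have q2 : (2 < q)%N := leq_trans (isT : (2 < 11)%N) q11.
have {}c'E : (c' <= 5 * q ^ j)%N by case/orP: c'E => /andP[].
have [c [cE gcE]] : exists c, [/\ (j == 0)%N && (c == 0)%N || (0 < j)%N && (c <= 5 * q ^ j.-1)%N &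
   ((gnum q j == 0) && (c == 0) || (0 < gnum q j) && (q * c == 5 * q ^ j))%N].
  case: (j) => [|i]; first by exists 0%N; rewrite gnum0.
  by exists (5 * q ^ i)%N; rewrite leqnn gnumS addn1 expnS mulnCA eqxx.
have IHc (T' : {set pt}) : hits 2 j.+1 T' -> (#|T'| <= 2 * gnum q j.+2 + c)%N ->
    contains_disjoint_subspaces j.+1 T' by exact: IH.
have gq : (q * gnum q j + 1 = gnum q j + q ^ j)%N by rewrite -gnumS gnumSr.
have [[N1 N2 N3 N4 N5] [N6 N7 N8]] := step_numeric_prime q11 gq gcE c'E.
apply: (double_blocking_step n_gt0 q2 (c := c) (c' := c') (J := 1) (r := 0)
  (s := 2 * q + 5) (s2 := q + 4) hT leT IHc); rewrite ?gnumSr ?expnS //.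
Qed.

End DoubleBlockingSubspaces.

(* The roots of X^(q^k) - X form a subfield of its splitting field. *)
Lemma exists_field_ext (F : finFieldType) (p h k : nat) : prime p -> (0 < h)%N ->
  #|F| = (p ^ h)%N -> (0 < k)%N -> exists L : splittingFieldType F, \dim {:L} = k.
Proof.
move=> pr_p h_gt0 cF k_gt0; have q1 : (1 < #|F|)%N := finNzRing_gt1 F.
have charF : p \in [pchar F] := card_finPcharP cF pr_p.
pose m := (#|F| ^ k)%N; have m_gt1 : (1 < m)%N by rewrite (ltn_exp2l 0) ?k_gt0.
have m_gt0 := ltnW m_gt1; have m1_gt0 : (0 < m.-1)%N by rewrite -ltnS prednK.
have m0 : (m%:R : F) = 0.
  by apply/eqP; rewrite -(dvdn_pcharf charF) /m cF -expnM dvdn_exp // muln_gt0 h_gt0.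
pose g (R : nzRingType) : {poly R} := 'X^m - 'X.
have Dg (R : comNzRingType) : g R = ('X^(m.-1) - 1) * ('X - 0).
  by rewrite /g subr0 mulrBl mul1r -exprSr prednK.
have /FinSplittingFieldFor[/= L splitLg] : g F != 0.
  by rewrite Dg monic_neq0 ?rpredM ?monicXsubC ?monicXnsubC.
rewrite rmorphB rmorphXn /= map_polyX -/(g L) in splitLg.
exists L; have /finField_galois_generator[/= a _ Da] : (1 <= {:L})%VS by apply: sub1v.
pose E := fixedSpace (a ^+ k)%g; rewrite dimv1 expn1 in Da.
have {splitLg} [zs DgL defL] := splitLg.
have Uzs : uniq zs.
  rewrite -separable_prod_XsubC -(eqp_separable DgL) Dg separable_root andbC.
  rewrite /root !hornerE subr_eq0 eq_sym expr0n gtn_eqF ?oner_eq0 //=.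
  rewrite cyclotomic.separable_Xn_sub_1 // -subn1 natrB // subr_eq0 eq_sym.
  have -> : m%:R = 0 :> L by rewrite -(rmorph_nat (in_alg L) m) m0 rmorph0.
  exact: oner_neq0.
have in_zs : zs =i E.
  move=> z; rewrite -root_prod_XsubC -(eqp_root DgL) (sameP fixedSpaceP eqP).
  rewrite /root !hornerE subr_eq0 /= /m; congr (_ == z).
  elim: (k) => [|i IHi]; first by rewrite gal_id.
  by rewrite expgSr expnSr exprM IHi galM ?Da ?memvf.
have defE : E = {:L}%VS.
  apply/eqP; rewrite eqEsubv subvf -defL -[E]subfield_closed agenvS //.
  by rewrite subv_add sub1v; apply/span_subvP=> z; rewrite in_zs.
have szs : size zs = m.
  apply: succn_inj; rewrite -(size_prod_XsubC _ id).
  by rewrite -(eqp_size DgL) size_polyDl size_polyXn // size_polyN size_polyX.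
apply/eqP; rewrite -(eqn_exp2l _ _ q1) -/m -szs -(size_map VectorInternalTheory.v2r).
have /card_uniqP <- : uniq (map (@VectorInternalTheory.v2r _ L) zs).
  by rewrite map_inj_uniq //; apply: can_inj VectorInternalTheory.v2rK.
rewrite dimvf -[X in (_ ^ X)%N]mul1n -card_mx; apply/eqP/eq_card => v; rewrite [LHS]inE.
by rewrite -(VectorInternalTheory.r2vK v); apply/esym/map_f; rewrite in_zs defE memvf.
Qed.

Lemma exists_coordinates (F : fieldType) (V : vectType F) :
  exists co : V -> 'rV[F]_(\dim {:V}),
    [/\ bijective co, {morph co : x y / x + y} & forall a x, co (a *: x) = a *: co x].
Proof.
exists (fun x => \row_i coord (vbasis {:V}) i x); split.
- exists (fun v : 'rV[F]_(\dim {:V}) => \sum_i v 0 i *: (vbasis {:V})`_i) => x.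
    rewrite [RHS](coord_vbasis (memvf x)).
    by apply: eq_bigr => i _; rewrite mxE.
  by apply/rowP => i; rewrite mxE coord_sum_free // (basis_free (vbasisP _)).
- by move=> x y; apply/rowP => i; rewrite !mxE linearD.
- by move=> a x; apply/rowP => i; rewrite !mxE linearZ.
Qed.

Lemma exists_field_coordinates (F : finFieldType) (p h k : nat) : prime p -> (0 < h)%N ->
  #|F| = (p ^ h)%N -> (0 < k)%N ->
  exists (K : finFieldType) (phi : {rmorphism F -> K}) (co : K -> 'rV[F]_k),
    [/\ #|K| = (#|F| ^ k)%N, p \in [pchar K], bijective co,
        {morph co : x y / x + y} & forall a x, co (phi a * x) = a *: co x].
Proof.
move=> pr_p h_gt0 cF k_gt0; have [L] := exists_field_ext pr_p h_gt0 cF k_gt0.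
move=> dimL; have [co [bij coD coZ]] := exists_coordinates L.
case: k / dimL k_gt0 co bij coD coZ => _ co bij coD coZ.
pose K : finFieldType := finvect_type L.
exists K, (in_alg L), co; split => //.
- by rewrite (bij_eq_card (bij : bijective (co : K -> _))) card_mx mul1n.
- by rewrite (pchar_lalg L) (card_finPcharP cF pr_p).
- by move=> a x; rewrite -coZ; congr co; exact: (mulr_algl a (x : L)).
Qed.

Lemma second_moment_numeric (q k a : nat) : (11 <= q)%N -> (0 < k)%N -> (2 * a + 3 <= q ^ k)%N ->
  ((q + 2) * ((2 * q ^ k + a) * q ^ k) <=
     (2 * q ^ k + a) * (2 * q ^ k + a - 1) + 2 * (q + 1) * (q ^ k * q ^ k))%N ->
  (a <= 2 * gnum q k + (if k == 1%N then 0 else 5 * q ^ k.-2))%N.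
Proof.
move=> q11 k0 aQ H; have q0 : (0 < q)%N by apply: leq_trans q11.
have key : (a * (2 * q) <= 4 * q ^ k + 5 * a)%N.
  move: H aQ (expn_gt0 q k); rewrite q0 /=; move: (q ^ k)%N => Q H aQ Q0.
  have [X XE] : exists X, (2 * Q + a = X + 1)%N by exists (2 * Q + a - 1)%N; move: Q0; clear; lia.
  rewrite XE addnK in H; rewrite -(leq_pmul2r Q0).
  have aa : (2 * (a * a) <= a * Q)%N by rewrite mulnCA leq_mul2l; apply/orP; right; move: aQ; clear; lia.
  have XX : (X * X + 2 * X + 1 = 4 * (Q * Q) + 4 * (Q * a) + a * a)%N.
    by have := congr1 (fun z => z * z)%N XE; clear; lia.
  have XQ : ((q + 2) * ((X + 1) * Q) = 2 * (q * (Q * Q)) + q * (a * Q) + 4 * (Q * Q) + 2 * (a * Q))%N.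
    by rewrite -XE; clear; lia.
  by move: H; rewrite XQ; move: XX aa XE aQ; clear; lia.
have {}key : (a * (2 * q - 5) <= 4 * q ^ k)%N.
  by rewrite mulnBr leq_subLR addnC (mulnC a 5).
rewrite leqNgt; apply/negP => big; move: key; rewrite leqNgt => /negP; apply.
case: k k0 big {H aQ} => [|[|k]] // _.
  rewrite /= expn1 gnumS gnum0 => a3; apply: (@leq_trans (3 * (2 * q - 5))); first by move: q11; clear; lia.
  by rewrite leq_mul2r; apply/orP; right; move: a3; clear; lia.
rewrite /= !expnS gnumSr expnS gnumS; have := expn_gt0 q k; rewrite q0 /= => R0.
have : (q ^ k <= q * gnum q k + 1)%N by rewrite -gnumS gnumSr leq_addl.
move: (q ^ k)%N (q * gnum q k + 1)%N R0 => R g R0 gR big.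
apply: (@leq_trans (((2 * q + 7) * R) * (2 * q - 5))).
  have [b bE] : exists b, (q = b + 11)%N by exists (q - 11)%N; rewrite subnK.
  have -> : (2 * q - 5 = 2 * b + 17)%N by move: bE; clear; lia.
  rewrite bE; move: R0; clear.
  have : (2 * (b + 11) + 7) * R * (2 * b + 17) = 4 * (b * (b * R)) + 92 * (b * R) + 493 * R by ring.
  lia.
by rewrite leq_mul2r; apply/orP; right; move: big gR; clear; lia.
Qed.

Section MinimalSets.
Variables (F : finFieldType) (n : nat).
Local Notation q := #|F|.
Local Notation pt := (pg_point F n).
Implicit Types (x y z : pt) (S T : {set pt}).

Lemma hitsP t k T :
  reflect (hits t k T) [forall G : 'M[F]_(n.+1, k), (t <= #|kerpts T G|)%N].
Proof.
apply: (iffP forallP) => [h m G /same_kernel[G' GE]|h G]; last exact: h (rank_leq_col G).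
apply: leq_trans (h G') _; apply: subset_leq_card; apply/subsetP => x.
by rewrite !inE GE.
Qed.

Lemma exists_minimal_hits t k T : hits t k T -> exists2 T' : {set pt}, T' \subset T /\ hits t k T' &
  forall x, x \in T' -> exists G : 'M[F]_(n.+1, k), (#|kerpts (T' :\ x) G| < t)%N.
Proof.
move/hitsP => hT; have [T' minT T'T] := minset_exists (C := T) (P := fun S : {set pt} =>
  [forall G : 'M[F]_(n.+1, k), (t <= #|kerpts S G|)%N]) hT.
have /minsetP[/hitsP hT' min] := minT; exists T' => // x xT'.
have : ~~ [forall G : 'M[F]_(n.+1, k), (t <= #|kerpts (T' :\ x) G|)%N].
  apply/negP => h; have := min _ h (subsetDl _ _) => E.
  by have := setD11 x T'; rewrite E xT'.
by case/forallPn => G; rewrite -ltnNge => ltG; exists G.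
Qed.

Lemma minimal_double_blocking_card k T : prime q -> (11 <= q)%N -> (0 < k)%N -> hits 2 k T ->
  (2 * #|T| + 3 <= 5 * q ^ k)%N -> exists2 T' : {set pt}, T' \subset T /\ hits 2 k T' &
  (#|T'| <= 2 * gnum q k.+1 + (if k == 1 then 0 else 5 * q ^ k.-2))%N.
Proof.
move=> pr_q q11 k0 hT cT; have [T' [T'T hT'] min] := exists_minimal_hits hT.
exists T' => //; have q0 : (0 < q)%N := prime_gt0 pr_q.
have cT' : (2 * #|T'| + 3 <= 5 * q ^ k)%N.
  by apply: leq_trans cT; rewrite leq_add2r leq_mul2l subset_leq_card.
have ltT' : (#|T'| < q ^ k.+1)%N.
  have : (11 * q ^ k <= q ^ k.+1)%N by rewrite expnS leq_mul2r q11 orbT.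
  have : (0 < q ^ k)%N by rewrite expn_gt0 q0.
  by move: cT'; move: (q ^ k)%N (q ^ k.+1)%N #|T'|; clear; lia.
have lb := leq_card_hits hT' ltT'.
have [a aE] : exists a, #|T'| = (2 * q ^ k + a)%N.
  by exists (#|T'| - 2 * q ^ k)%N; rewrite subnKC // (leq_trans _ lb) // leq_mul2l gnumSr leq_addl.
have a2 : (2 <= a)%N.
  move: lb; rewrite aE gnumSr mulnDr addnC leq_add2l; apply: leq_trans.
  by move: k0; case: (k) => // j _; rewrite gnumS mulnDr leq_addl.
have a3 : (2 * a + 3 <= q ^ k)%N.
  by move: cT'; rewrite aE; move: (q ^ k)%N; clear; lia.
suff H : ((q + 2) * ((2 * q ^ k + a) * q ^ k) <=
    (2 * q ^ k + a) * (2 * q ^ k + a - 1) + 2 * (q + 1) * (q ^ k * q ^ k))%N.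
  rewrite aE gnumSr [(2 * (_ + _))%N]mulnDr addnAC addnC leq_add2r.
  exact: second_moment_numeric.
have [K [phi [co [cK charK [oc coK ocK] coD coZ]]]] :=
  exists_field_coordinates (F := F) (h := 1) (k := k) pr_q isT (erefl _) k0.
pose r x : 'rV[K]_n.+1 := map_mx phi (vec x).
have co0 : co 0 = 0 by rewrite -(mul0r 0) -(rmorph0 phi) coZ scale0r.
have coeq0 w : (co w == 0) = (w == 0).
  by apply/eqP/eqP => [h|->//]; apply: (can_inj coK); rewrite h co0.
pose mx (u : 'cV[K]_n.+1) : 'M[F]_(n.+1, k) := \matrix_(i, j) co (u i 0) 0 j.
have mxE' u x : vec x *m mx u = co (pairing r x u).
  rewrite /pairing mxE (big_morph co coD co0); apply/rowP => j; rewrite mxE summxE.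
  by apply: eq_bigr => i _; rewrite !mxE coZ mxE.
have zerosE u : zeros r T' u = kerpts T' (mx u).
  by apply/setP => x; rewrite !inE mxE' coeq0.
rewrite -aE -cK; apply: (@zeros_second_moment_leq _ _ _ r T' (a - 2) q).
- by move=> u; rewrite zerosE; apply: hT' (rank_leq_col _).
- by rewrite aE cK -addnA subnK // mul2n addnn.
- by rewrite cK; move: a2 a3; move: (q ^ k)%N; clear; lia.
- exact: charK.
- move=> x xT'; have [G ltG] := min x xT'; pose u : 'cV[K]_n.+1 := \col_i oc (row i G).
  have mxu : mx u = G by apply/matrixP => i j; rewrite !mxE ocK mxE.
  have h2 := hT' _ G (rank_leq_col G).
  have kx : kerpts (T' :\ x) G = kerpts T' G :\ x.
    by apply/setP => y; rewrite !inE andbA.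
  rewrite kx in ltG; move: (cardsD1 x (kerpts T' G)) h2 ltG => ->.
  case xG: (x \in _); last by rewrite add0n => h1 h2; have := leq_trans h2 h1; rewrite ltnn.
  rewrite add1n ltnS => h1 h2; exists u; last first.
    rewrite zerosE mxu (cardsD1 x) xG add1n; congr _.+1; apply/eqP.
    by rewrite eqn_leq h1 -ltnS h2.
  apply/eqP; rewrite -coeq0 -mxE' mxu; move: xG; rewrite inE; by case/andP.
- move=> x y xy; have [|mu xmu ymu] := separating_functional (_ : ~~ (vec y <= vec x)%MS).
    by apply: vec_not_sub; rewrite eq_sym.
  exists (map_mx phi mu); rewrite /pairing -map_mxM mxE.
    by rewrite xmu mxE rmorph0.
  rewrite fmorph_eq0; apply: contra ymu => /eqP h; apply/eqP/matrixP => i j.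
  by rewrite !ord1 h mxE.
Qed.

End MinimalSets.

(** * Rainbow-free colorings *)

Section Colorings.
Variables (F : finFieldType) (n k : nat).
Local Notation q := #|F|.
Local Notation pt := (pg_point F n).
Variable P : {set {set pt}}.
Hypothesis partP : partition P [set: pt].
Hypothesis rf : forall m (G : 'M[F]_(n.+1, m)), (\rank G <= k)%N ->
  exists x y, [/\ x != y, vec x *m G = 0, vec y *m G = 0 & pblock P x = pblock P y].
Implicit Types (x y z : pt) (C : {set pt}).

Definition large_classes := [set C in P | (1 < #|C|)%N].
Local Notation CC := large_classes.
Definition large_points := cover CC.
Local Notation T := large_points.

Let trivCC : trivIset CC.
Proof.
have /and3P[_ tP _] := partP; apply: trivIsetS tP.
by apply/subsetP => C; rewrite inE => /andP[].
Qed.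

Lemma pblock_large x y : x != y -> pblock P x = pblock P y ->
  [/\ pblock P x \in CC, x \in pblock P x & y \in pblock P x].
Proof.
have /and3P[/eqP cP tP _] := partP.
move=> xy E; have xC : x \in pblock P x by rewrite mem_pblock cP inE.
have yC : y \in pblock P x by rewrite E mem_pblock cP inE.
split=> //; rewrite inE pblock_mem ?cP ?inE //=.
by apply/card_gt1P; exists x, y.
Qed.

Lemma hits_large_points : hits 2 k T.
Proof.
move=> m G rG; have [x [y [xy xG yG E]]] := rf rG; have [CC1 xC yC] := pblock_large xy E.
apply/card_gt1P; exists x, y; split=> //; rewrite inE ?xG ?yG eqxx andbT;
  by apply/bigcupP; exists (pblock P x).
Qed.

Lemma card_large_points : (#|T| + #|P| = #|{: pt}| + #|CC|)%N.
Proof.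
have /and3P[/eqP cP tP P0] := partP.
have -> : #|T| = (\sum_(C in CC) #|C|)%N by rewrite (eqP trivCC).
have CP : P :&: CC = CC by apply/setIidPr/subsetP => C; rewrite inE => /andP[].
rewrite -cardsT -cP -(eqP tP) [in RHS](big_setID CC) /= CP -addnA; congr (_ + _)%N.
rewrite (eq_bigr (fun=> 1%N)); last first.
  move=> C; rewrite !inE andbC => /andP[CP1]; rewrite CP1 /= -leqNgt => c1.
  apply/eqP; rewrite eqn_leq c1 card_gt0; apply: contraTneq CP1 => ->.
  exact: P0.
by rewrite sum1_card -(cardsID CC P) CP addnC.
Qed.

Lemma double_card_large_classes : (2 * #|CC| <= #|T|)%N.
Proof.
rewrite /large_points -(eqP trivCC) mulnC -sum_nat_const.
by apply: leq_sum => C; rewrite inE => /andP[].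
Qed.

Definition chosen C := [set x in take 2 (enum C)].

Lemma card_chosen C : C \in CC -> #|chosen C| = 2%N.
Proof.
rewrite inE => /andP[_ C2]; rewrite cardsE (card_uniqP _) ?take_uniq ?enum_uniq //.
by rewrite size_takel // -cardE.
Qed.

Lemma chosen_sub C : chosen C \subset C.
Proof. by apply/subsetP => x; rewrite inE => /mem_take; rewrite mem_enum. Qed.

(* The chosen points that g does not separate from the rest of their class. *)
Definition bad (g : 'M[F]_(n.+1, k.+1)) C : {set pt} :=
  [set x in chosen C | [exists y in C :\ x, exists t : F, vec y *m g == t *: (vec x *m g)]].

Lemma double_cover_class (g : 'M[F]_(n.+1, k.+1)) C : C \in CC ->
  (forall x, x \in C -> vec x *m g != 0) ->
  (2 * #|[set u : pg_point F k | 2 <= #|fiber C g u|]%N| + 2 <= #|C| + #|bad g C|)%N.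
Proof.
move=> CC1 Cg; set U := [set u | _]; pose C' := C :\: (chosen C :\: bad g C).
have badsub : bad g C \subset chosen C by apply/subsetP => x; rewrite inE => /andP[].
have cC' : (#|C'| + 2 = #|C| + #|bad g C|)%N.
  rewrite -(card_chosen CC1) -(cardsID (bad g C) (chosen C)) (setIidPr badsub).
  rewrite addnC -addnA addnC; congr (_ + _)%N.
  rewrite -(cardsID (chosen C :\: bad g C) C) (setIidPr _) //.
  exact: subset_trans (subsetDl _ _) (chosen_sub C).
rewrite -cC' leq_add2r.
have C'g x : x \in C' -> vec x *m g != 0 by rewrite inE => /andP[_ /Cg].
rewrite -(sum_fiber C'g) mulnC -sum_nat_const big_mkcond /=; apply: leq_sum => u _.
case: ifP => //; rewrite inE => u2; apply: (leq_trans u2); apply: subset_leq_card.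
apply/subsetP => x xu; have := xu; rewrite !inE => /andP[xC xgu]; rewrite xC xgu !andbT negb_and negbK.
case: (boolP (x \in take 2 (enum C))) => [xch|]; last by rewrite orbT.
rewrite orbF /=; have /card_gt1P[y [z [yu zu yz]]] := u2.
have [y' y'u y'x] : exists2 y', y' \in fiber C g u & y' != x.
  by have [E|yx] := eqVneq y x; [exists z; rewrite // -E eq_sym | exists y].
rewrite inE in y'u; have /andP[y'C y'g] := y'u.
apply/existsP; exists y'; rewrite !inE y'x y'C /=; apply/existsP.
have ux : (val u <= vec x *m g)%MS.
  have [_] := mxrank_leqif_sup xgu; rewrite rank_pt rank_rV (Cg x xC) eqxx => /esym ->.
  by [].
have /sub_rVP[t E] := submx_trans y'g ux; by exists t; rewrite E.
Qed.

Lemma large_classes_leq D : (11 <= q)%N -> (#|P| + D = #|{: pt}|)%N -> (10 * D <= 23 * q ^ k)%N ->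
  (#|T| + 2 * gnum q k.+1 <= 2 * D + 7)%N.
Proof.
move=> q11 cD D23; have q0 : (0 < q)%N by apply: leq_trans q11.
have TD : (#|T| = D + #|CC|)%N.
  by have := card_large_points; rewrite -cD; clear; lia.
have mD : (#|CC| <= D)%N.
  by have := double_card_large_classes; rewrite TD mul2n -addnn leq_add2r.
pose B (g : 'M[F]_(n.+1, k.+1)) := (\sum_(C in CC) \sum_(x in chosen C) \sum_(y in C :\ x)
  \sum_(t : F) ((vec y - t *: vec x) *m g == 0)%R)%N.
pose Z (g : 'M[F]_(n.+1, k.+1)) := (\sum_(x in T) (vec x *m g == 0)%R)%N.
have [w wE] : exists w, w = (q ^ (k.+1 * n))%N by exists (q ^ (k.+1 * n))%N.
have w0 : (0 < w)%N by rewrite wE expn_gt0 q0.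
have cnt (v : 'rV[F]_n.+1) : v != 0 -> (\sum_(g : 'M[F]_(n.+1, k.+1)) (v *m g == 0)%R = w)%N.
  move=> v0; have := @card_annihilator _ 1 n.+1 k.+1 v; rewrite rank_rV v0 subSS subn0 -wE => <-.
  rewrite -sum1_card [RHS]big_mkcond /=; apply: eq_bigr => g _; rewrite inE.
  by case: eqP.
have EZ : (\sum_g Z g = #|T| * w)%N.
  by rewrite /Z exchange_big -sum_nat_const; apply: eq_bigr => x _; apply: cnt; apply: vec_neq0.
have EB : (\sum_g B g = 2 * D * q * w)%N.
  have -> : (2 * D * q * w = \sum_(C in CC) 2 * ((#|C| - 1) * (q * w)))%N.
    rewrite -big_distrr -big_distrl /= -!mulnA; congr (2 * (_ * _))%N.
    rewrite -(addnK #|CC| D) -TD -(eqP trivCC) -sum1_card.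
    by rewrite -sumnB // => C; rewrite inE => /andP[_ /ltnW].
  rewrite /B exchange_big; apply: eq_bigr => C CC1 /=; rewrite exchange_big /=.
  rewrite -(card_chosen CC1) -sum_nat_const; apply: eq_bigr => x xC.
  have {}xC := subsetP (chosen_sub C) x xC.
  have -> : (#|C| - 1 = #|C :\ x|)%N by rewrite (cardsD1 x C) xC addKn.
  rewrite exchange_big -sum_nat_const /=; apply: eq_bigr => y; rewrite !inE => /andP[yx _].
  rewrite exchange_big -sum_nat_const /=; apply: eq_bigr => t _.
  by apply: cnt; apply: vec_comb_neq0.
have [g gB] : exists g, (B g + 8 * Z g < 8)%N.
  apply/existsP; apply: contraT => /existsPn h; have : (\sum_(g : 'M[F]_(n.+1, k.+1)) 8 <= \sum_g (B g + 8 * Z g))%N.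
    by apply: leq_sum => g _; rewrite leqNgt h.
  rewrite big_split -big_distrr /= EB EZ sum_nat_const.
  have -> : #|'M[F]_(n.+1, k.+1)| = (w * (q * q ^ k))%N.
    by rewrite card_mx wE -expnS -expnD; congr (_ ^ _)%N; rewrite -mulnSr mulnC.
  rewrite TD => H; have {H} : (8 * (q * q ^ k) <= 2 * D * q + 8 * (D + #|CC|))%N.
    by rewrite -(leq_pmul2r w0); move: H; clear; lia.
  have Q0 : (0 < q ^ k)%N by rewrite expn_gt0 q0.
  have Dq : (10 * D * q <= 23 * q ^ k * q)%N by rewrite leq_mul2r D23 orbT.
  have qQ : (11 * q ^ k <= q * q ^ k)%N by rewrite leq_mul2r q11 orbT.
  by move: D23 mD Dq qQ Q0; clear; move: (q ^ k)%N #|CC| #|F|; lia.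
have Z0 x : x \in T -> vec x *m g != 0.
  move=> xT; apply/negP => xg; move: gB; rewrite ltnNge => /negP; apply.
  by rewrite /Z (bigD1 x xT) /= xg mulnDr addnCA leq_addr.
have badB : (\sum_(C in CC) #|bad g C| <= B g)%N.
  apply: leq_sum => C _; rewrite -sum1_card big_mkcond [X in (_ <= X)%N]big_mkcond /=.
  apply: leq_sum => x _; rewrite inE; case: (x \in chosen C) => //=.
  case: existsP => // -[y /andP[yC /existsP[t /eqP E]]].
  by rewrite (bigD1 y yC) /= (bigD1 t) //= mulmxBl -scalemxAl E subrr eqxx.
have cov : (gnum q k.+1 <= \sum_(C in CC) #|[set u : pg_point F k | 2 <= #|fiber C g u|]%N|)%N.
  rewrite -(card_pg_point F k) -cardsT; apply: leq_trans (card_bigcup_le _ _).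
  apply: subset_leq_card; apply/subsetP => u _.
  have [|x [y [xy xG yG E]]] := rf (G := g *m cokermx (val u)).
    by apply: leq_trans (mxrankM_maxr _ _) _; rewrite mxrank_coker rank_pt subSS subn0.
  have [CC1 xC yC] := pblock_large xy E; apply/bigcupP; exists (pblock P x) => //.
  rewrite inE; apply/card_gt1P; exists x, y; split => //; rewrite inE ?xC ?yC /= submxE -mulmxA.
    by rewrite xG.
  by rewrite yG.
have : (\sum_(C in CC) (2 * #|[set u : pg_point F k | 2 <= #|fiber C g u|]%N| + 2) <=
    \sum_(C in CC) (#|C| + #|bad g C|))%N.
  apply: leq_sum => C CC1; apply: double_cover_class => // x xC; apply: Z0.
  by apply/bigcupP; exists C.
have B7 : (B g <= 7)%N by exact: (leq_trans (leq_addr (8 * Z g) (B g)) (gB : (B g + 8 * Z g <= 7)%N)).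
rewrite !big_split /= big1_eq addn0 sum_nat_const (eqP trivCC) -/T TD; move: (leq_trans badB B7) cov.
move: (\sum_(C in CC) #|bad g C|)%N (\sum_(C in CC) #|[set u | _]|)%N #|CC| (gnum _ _); clear; lia.
Qed.

End Colorings.

Section Monochromatic.
Variables (F : finFieldType) (n k : nat).
Local Notation q := #|F|.
Local Notation pt := (pg_point F n).
Implicit Types (x y z : pt) (S T C : {set pt}).

Lemma unique_transversal_line m1 m2 (X1 : 'M[F]_(m1, n.+1)) (X2 : 'M[F]_(m2, n.+1)) x x1 x2 y1 y2 :
  [disjoint pts X1 & pts X2] -> x \notin pts X1 -> x1 \in pts X1 -> y1 \in pts X1 ->
  x2 \in pts X2 -> y2 \in pts X2 -> (vec x <= vec x1 + vec x2)%MS -> (vec x <= vec y1 + vec y2)%MS ->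
  x2 = y2.
Proof.
rewrite disjoint_pts mxrank_eq0 !pts_vec => /eqP dis xX1 x1X y1X x2X y2X.
move=> /sub_addsmxP[[u v] /= E] /sub_addsmxP[[u' v'] /= E'].
have /sub_rVP[a aE] := submxMl v (vec x2).
have /sub_rVP[b bE] := submxMl v' (vec y2).
have a0 : a != 0.
  apply: contra xX1 => /eqP a0; rewrite E aE a0 scale0r addr0.
  exact: submx_trans (submxMl _ _) x1X.
have W : (u *m vec x1 - u' *m vec y1 <= X1 :&: X2)%MS.
  rewrite sub_capmx addmx_sub ?eqmx_opp ?(submx_trans (submxMl _ _)) //=.
  have -> : u *m vec x1 - u' *m vec y1 = v' *m vec y2 - v *m vec x2.
    by apply/eqP; rewrite subr_eq addrAC eq_sym subr_eq -E E' addrC.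
  by rewrite addmx_sub ?eqmx_opp ?(submx_trans (submxMl _ _)).
move: W; rewrite dis => /submxP[w]; rewrite mulmx0 => /eqP; rewrite subr_eq0 => /eqP uE.
move: E; rewrite E' uE => /addrI; rewrite aE bE => /(congr1 (fun v => a^-1 *: v)).
rewrite !scalerA mulVf // scale1r => /esym; exact: vec_scale.
Qed.

Lemma line_exchange x x1 x2 : (vec x <= vec x1 + vec x2)%MS -> x != x1 ->
  (vec x2 <= vec x1 + vec x)%MS.
Proof.
move=> /sub_addsmxP[[u v] /= E] xx1; have /sub_rVP[a aE] := submxMl v (vec x2).
have a0 : a != 0.
  apply: contraNneq xx1 => a0; apply/eqP/pt_ext; rewrite -!vecP E aE a0 scale0r addr0.
  exact: submxMl.
have -> : vec x2 = a^-1 *: (vec x - u *m vec x1).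
  by rewrite E addrAC subrr add0r aE scalerA mulVf // scale1r.
rewrite scalemx_sub // addmx_sub ?addsmxSr // eqmx_opp.
exact: submx_trans (submxMl _ _) (addsmxSl _ _).
Qed.

Lemma off_transversal_line m1 m2 (X1 : 'M[F]_(m1, n.+1)) (X2 : 'M[F]_(m2, n.+1)) x x1 x2 :
  [disjoint pts X1 & pts X2] -> x1 \in pts X1 -> x2 \in pts X2 ->
  (vec x <= vec x1 + vec x2)%MS -> x != x1 -> x \notin pts X1.
Proof.
move=> dis x1X x2X xl xx1; apply/negP => xX.
have : x2 \in pts X1 :&: pts X2.
  rewrite in_setI x2X andbT pts_vec (submx_trans (line_exchange xl xx1)) //.
  by rewrite addsmx_sub -!pts_vec x1X.
by rewrite (disjoint_setI0 dis) in_set0.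
Qed.

Lemma card_obstructed_leq T m1 m2 (X1 : 'M[F]_(m1, n.+1)) (X2 : 'M[F]_(m2, n.+1)) S :
  [disjoint pts X1 & pts X2] -> S \subset pts X1 ->
  (#|[set x2 in pts X2 | [exists x1 in S, exists x in T,
      [&& (vec x <= vec x1 + vec x2)%MS, x != x1 & x != x2]]]| <=
   #|T :\: (pts X1 :|: pts X2)|)%N.
Proof.
move=> dis /subsetP SX; set B := [set x2 in _ | _]; set R := T :\: _.
pose Y x := [set x2 in pts X2 | [exists x1 in S, (vec x <= vec x1 + vec x2)%MS]].
have BY : B \subset \bigcup_(x in R) Y x.
  apply/subsetP => x2; rewrite inE => /andP[x2X /existsP[x1 /andP[x1S /existsP[x]]]].
  move=> /and4P[xT xl xx1 xx2]; apply/bigcupP; exists x; last first.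
    by rewrite inE x2X; apply/existsP; exists x1; rewrite x1S.
  have x1X := SX _ x1S; rewrite in_setD xT andbT in_setU negb_or.
  rewrite (off_transversal_line dis x1X x2X xl xx1) /=.
  have dis' : [disjoint pts X2 & pts X1] by rewrite disjoint_sym.
  have xl' : (vec x <= vec x2 + vec x1)%MS by rewrite addsmxC.
  exact: off_transversal_line dis' x2X x1X xl' xx2.
apply: leq_trans (subset_leq_card BY) _; apply: leq_trans (card_bigcup_le _ _) _.
rewrite -sum1_card; apply: leq_sum => x; rewrite in_setD in_setU negb_or => /andP[/andP[xX1 _] _].
rewrite leqNgt; apply/negP => /card_gt1P[x2 [y2 [+ + ne]]].
rewrite /Y !in_set -!(mem_pts X2) => /andP[x2X /existsP[x1 /andP[x1S l1]]] /andP[y2X /existsP[y1 /andP[y1S l2]]].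
move/eqP: ne; apply.
exact: (unique_transversal_line dis xX1 (SX _ x1S) (SX _ y1S) x2X y2X l1 l2).
Qed.

Lemma monochromatic (P : {set {set pt}}) m1 m2 (X1 : 'M[F]_(m1, n.+1)) (X2 : 'M[F]_(m2, n.+1)) :
  partition P [set: pt] ->
  (forall m (G : 'M[F]_(n.+1, m)), (\rank G <= k)%N ->
    exists x y, [/\ x != y, vec x *m G = 0, vec y *m G = 0 & pblock P x = pblock P y]) ->
  let T := large_points P in
  pts X1 \subset T -> pts X2 \subset T -> [disjoint pts X1 & pts X2] ->
  (#|T| + #|T :\: (pts X1 :|: pts X2)| * q < q ^ k.+1)%N ->
  (#|T :\: (pts X1 :|: pts X2)| < #|pts X1|)%N ->
  (#|T :\: (pts X1 :|: pts X2)| < #|pts X2|)%N ->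
  exists2 C, C \in P & pts X1 \subset C /\ pts X2 \subset C.
Proof.
move=> partP rf T X1T X2T dis lt R1 R2.
have /and3P[/eqP cP tP _] := partP.
have same x1 x2 : x1 \in pts X1 -> x2 \in pts X2 ->
    ~~ [exists x in T, [&& (vec x <= vec x1 + vec x2)%MS, x != x1 & x != x2]] ->
    pblock P x1 = pblock P x2.
  move=> x1X x2X /existsPn free.
  have [|G rG kG] := isolate_pair X1T X2T dis lt x1X x2X.
    move=> x xT xl; have := free x; rewrite xT xl /= negb_and !negbK.
    by case/orP => /eqP; [left|right].
  have [x [y [xy xG yG E]]] := rf _ G rG.
  have [CC1 xC yC] := pblock_large partP xy E.
  have xT : x \in T by apply/bigcupP; exists (pblock P x).
  have yT : y \in T by apply/bigcupP; exists (pblock P x).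
  have : x \in kerpts T G by rewrite inE xT xG eqxx.
  have : y \in kerpts T G by rewrite inE yT yG eqxx.
  by rewrite kG => /set2P[] yE /set2P[] xE; move: xy E; rewrite xE yE ?eqxx // => _ ->.
have free2 S : S \subset pts X1 -> exists2 x2, x2 \in pts X2 &
    forall x1, x1 \in S -> pblock P x1 = pblock P x2.
  move=> SX; have := card_obstructed_leq T dis SX; set B := [set x2 in _ | _] => cB.
  have /subsetPn[x2 x2X nB] : ~~ (pts X2 \subset B).
    by apply: contraTN R2 => /subset_leq_card h; rewrite -leqNgt (leq_trans h).
  exists x2 => // x1 x1S; apply: same => //; first exact: (subsetP SX).
  by apply: contra nB => h; rewrite inE x2X; apply/existsP; exists x1; rewrite x1S.
have free1 S : S \subset pts X2 -> exists2 x1, x1 \in pts X1 &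
    forall x2, x2 \in S -> pblock P x2 = pblock P x1.
  rewrite disjoint_sym in dis; move=> SX; have := card_obstructed_leq T dis SX.
  set B := [set x2 in _ | _]; rewrite setUC => cB.
  have /subsetPn[x1 x1X nB] : ~~ (pts X1 \subset B).
    by apply: contraTN R1 => /subset_leq_card h; rewrite -leqNgt (leq_trans h).
  exists x1 => // x2 x2S; apply/esym/same => //; first exact: (subsetP SX).
  apply: contra nB => /existsP[x /andP[xT /and3P[xl xx1 xx2]]]; rewrite inE x1X.
  apply/existsP; exists x2; rewrite x2S; apply/existsP; exists x.
  by rewrite xT addsmxC xl xx1 xx2.
have /card_gt0P[z zX] : (0 < #|pts X1|)%N by apply: leq_trans R1.
exists (pblock P z); first by rewrite pblock_mem ?cP ?inE.
have mono1 x : x \in pts X1 -> pblock P x = pblock P z.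
  move=> xX; have [|y _ h] := free2 [set x; z].
    by apply/subsetP => w /set2P[] ->.
  by rewrite (h x) ?(h z) // !inE eqxx ?orbT.
have mono2 x : x \in pts X2 -> pblock P x = pblock P z.
  move=> xX; have [|y yX h] := free1 [set x]; first by rewrite sub1set.
  by rewrite (h x) ?inE ?eqxx // mono1.
by split; apply/subsetP => x xX; [rewrite -(mono1 x xX)|rewrite -(mono2 x xX)]; rewrite mem_pblock cP inE.
Qed.

End Monochromatic.

Section Core.
Variables (F : finFieldType) (n k : nat).
Local Notation q := #|F|.
Local Notation pt := (pg_point F n).
Hypothesis n_gt0 : (0 < n)%N.

Lemma ten_gnum_leq : (11 <= q)%N -> (10 * gnum q k <= q ^ k)%N.
Proof.
move=> q11; have q0 : (0 < q)%N by apply: leq_trans q11.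
by rewrite -(gnum_geom k q0) (leq_trans _ (leq_addr _ _)) // leq_mul2r -ltnS prednK // q11 orbT.
Qed.

Theorem large_coloring_monochromatic (P : {set {set pt}}) (D : nat) : (0 < k)%N ->
  partition P [set: pt] ->
  (forall m (G : 'M[F]_(n.+1, m)), (\rank G <= k)%N ->
    exists x y, [/\ x != y, vec x *m G = 0, vec y *m G = 0 & pblock P x = pblock P y]) ->
  (#|P| + D = #|{: pt}|)%N ->
  [/\ prime q, (11 <= q)%N & (24 * D + 120 <= 53 * q ^ k + 12 * gnum q k)%N] \/
  [/\ (2 <= k)%N, (25 <= q)%N & (2 * D + 5 + gnum q k.-1 <= 4 * gnum q k.+1 + q ^ k.-1)%N] ->
  exists2 C, C \in P & contains_disjoint_subspaces k C.
Proof.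
move=> k0 partP rf cD cases; set T := large_points P.
have hT : hits 2 k T := hits_large_points partP rf.
have q11 : (11 <= q)%N by case: cases => [[]|[_ q25 _]] //; apply: leq_trans q25.
have g10 := ten_gnum_leq q11; have gS := gnumSr q k.
have Q0 : (0 < q ^ k)%N by rewrite expn_gt0 (leq_trans _ q11).
have qQ : (11 * q ^ k <= q ^ k.+1)%N by rewrite expnS leq_mul2r q11 orbT.
have D23 : (10 * D <= 23 * q ^ k)%N.
  case: cases => [[_ _ h]|[k2 q25 h]].
    by move: h g10; move: (q ^ k)%N (gnum q k); clear; lia.
  have qk : (25 * q ^ k.-1 <= q ^ k)%N by rewrite -[in X in (_ <= X)%N](prednK k0) expnS leq_mul2r q25 orbT.
  by move: h g10 gS qk; move: (q ^ k)%N (q ^ k.-1)%N (gnum q k) (gnum q k.+1) (gnum q k.-1); clear; lia.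
have cT := large_classes_leq partP rf q11 cD D23; rewrite -/T in cT.
have [TX Rq R1] : [/\ contains_disjoint_subspaces k T,
    (#|T| + (#|T| - 2 * gnum q k.+1) * q < q ^ k.+1)%N & (#|T| < 3 * gnum q k.+1)%N].
  case: cases => [[pr_q _ h]|[k2 q25 h]].
    have cT12 : (12 * #|T| + 12 * gnum q k + 36 <= 29 * q ^ k)%N.
      by move: cT h gS; move: #|T| (q ^ k)%N (gnum q k) (gnum q k.+1); clear; lia.
    split.
    - have [|T' [T'T hT'] cT'] := minimal_double_blocking_card pr_q q11 k0 hT.
        by move: cT12; move: #|T| (q ^ k)%N (gnum q k); clear; lia.
      have [|X1 [X2 [r1 r2 dis s1 s2]]] := double_blocking_subspaces_prime n_gt0 q11 k0 _ hT' cT'.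
        by case: (k) k0 => [|[|j]] //= _; rewrite leqnn.
      by exists X1, X2; split=> //; apply: subset_trans T'T.
    - have R : (12 * (#|T| - 2 * gnum q k.+1) <= 5 * q ^ k)%N.
        by move: cT12 gS; move: #|T| (q ^ k)%N (gnum q k) (gnum q k.+1); clear; lia.
      have {}R : (12 * (#|T| - 2 * gnum q k.+1) * q <= 5 * q ^ k * q)%N by rewrite leq_mul2r R orbT.
      move: cT12 R Q0 qQ; rewrite expnSr.
      move: (#|T| - 2 * gnum q k.+1)%N => r; move: #|T| (q ^ k)%N (gnum q k); move: #|F|; clear.
      lia.
    - by move: cT12 gS g10 Q0; move: #|T| (q ^ k)%N (gnum q k) (gnum q k.+1); clear; lia.
  have qk : (25 * q ^ k.-1 <= q ^ k)%N by rewrite -[in X in (_ <= X)%N](prednK k0) expnS leq_mul2r q25 orbT.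
  have qk1 : (2 <= q ^ k.-1)%N.
    case: (k) k2 => [|[|j]] //= _; rewrite expnS (leq_trans _ (leq_pmulr _ _)) ?expn_gt0 ?(leq_trans _ q25) //.
  have gk1 : (gnum q k.-1 <= q ^ k.-1)%N.
    by rewrite (leq_trans _ (double_gnum_leq (leq_trans _ q11) _)) // leq_pmull.
  have cT2 : (#|T| + gnum q k.-1 <= 2 * gnum q k.+1 + q ^ k.-1 + 2)%N.
    by move: cT h; move: #|T| (q ^ k.-1)%N (gnum q k.-1) (gnum q k.+1); clear; lia.
  split.
  - apply: (@double_blocking_subspaces_large _ _ n_gt0 k (#|T| - 2 * gnum q k.+1) T q25 k0 _ hT).
      apply/orP; right; rewrite k2 /=.
      by move: cT2 qk1 gk1; move: #|T| (q ^ k.-1)%N (gnum q k.-1) (gnum q k.+1); clear; lia.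
    by rewrite -leq_subLR.
  - have R : (#|T| - 2 * gnum q k.+1 <= 2 * q ^ k.-1)%N.
      by move: cT2 qk1; move: #|T| (q ^ k.-1)%N (gnum q k.-1) (gnum q k.+1); clear; lia.
    have {}R : ((#|T| - 2 * gnum q k.+1) * q <= 2 * q ^ k)%N.
      by rewrite -[in X in (_ <= X)%N](prednK k0) expnSr mulnA leq_mul2r R orbT.
    move: R cT2 gS g10 Q0 qQ qk qk1; move: ((#|T| - 2 * gnum q k.+1) * q)%N => r; move: #|T| (q ^ k.-1)%N (q ^ k.+1)%N (q ^ k)%N.
    by move: (gnum q k) (gnum q k.+1) (gnum q k.-1); clear; lia.
  - by move: cT2 gS g10 Q0 qk qk1; move: #|T| (q ^ k.-1)%N (gnum q k) (gnum q k.-1) (gnum q k.+1) (q ^ k)%N; clear; lia.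
have [X1 [X2 [r1 r2 dis s1 s2]]] := TX.
have R : #|T :\: (pts X1 :|: pts X2)| = (#|T| - 2 * gnum q k.+1)%N.
  rewrite -(cardsID (pts X1 :|: pts X2) T) (setIidPr _) ?subUset ?s1 //.
  have := cardsUI (pts X1) (pts X2); rewrite (disjoint_setI0 dis) cards0 addn0 !card_pts r1 r2 => ->.
  by rewrite addnn mul2n addKn.
have Rlt : (#|T| - 2 * gnum q k.+1 < gnum q k.+1)%N.
  by move: R1 gS Q0; move: #|T| (gnum q k.+1) (gnum q k); clear; lia.
have [|||C CP [C1 C2]] := monochromatic partP rf s1 s2 dis; rewrite -/T ?R //.
- by rewrite card_pts r1.
- by rewrite card_pts r2.
by exists C => //; exists X1, X2.
Qed.

End Core.

Section Translation.
Variables (F : finFieldType) (n k : nat).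
Local Notation q := #|F|.
Local Notation pt := (pg_point F n).
Hypothesis kn : (k < n)%N.
Local Notation H := (pg_hypergraph F n (n - k)).

Let n_gt0 : (0 < n)%N. Proof. exact: leq_ltn_trans kn. Qed.

Lemma pg_subspace_of_rank d m (U : 'M[F]_(m, n.+1)) : \rank U = d.+1 ->
  exists W : pg_subspace F n d, (val W :=: U)%MS.
Proof.
move=> rU; have h : (<<<<U>>%MS>>%MS == <<U>>%MS) && (\rank <<U>>%MS == d.+1)%N.
  by rewrite genmx_id eqxx mxrank_gen rU eqxx.
by exists (Sub <<U>>%MS h); rewrite SubK; apply: genmxE.
Qed.

Lemma pg_points_pts d (U : pg_subspace F n d) : pg_points U = pts (val U).
Proof. by apply/setP => x; rewrite !inE. Qed.

Lemma rank_pg_subspace d (U : pg_subspace F n d) : \rank (val U) = d.+1.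
Proof. by have /andP[_ /eqP] := valP U. Qed.

Lemma hyperedge_kernel m (G : 'M[F]_(n.+1, m)) : (\rank G <= k)%N ->
  exists2 e, e \in H & forall x, x \in e -> vec x *m G = 0.
Proof.
move=> rG; have [|K rK KG] := @exists_subspace_of_rank F n (n - k).+1 _ (kermx G).
  by rewrite mxrank_ker; move: rG kn; clear; lia.
have [U UE] := pg_subspace_of_rank rK; exists (pg_points U); first exact: imset_f.
move=> x; rewrite pg_points_pts mem_pts UE -vecP => xU.
by apply/eqP; rewrite -sub_kermx (submx_trans xU).
Qed.

Lemma two_transversalP (T : {set pt}) : reflect (hits 2 k T) (two_transversal H T).
Proof.
apply: (iffP forall_inP) => [h m G rG|h e /imsetP[U _ ->]].
  have [e eH eG] := hyperedge_kernel rG; apply: leq_trans (h e eH) _.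
  apply: subset_leq_card; apply/subsetP => x; rewrite !inE => /andP[-> xe] /=.
  by rewrite eG.
have := h _ (cokermx (val U)); rewrite mxrank_coker rank_pg_subspace => /(_ _)/leq_trans -> //.
  by move: kn; clear; lia.
apply: subset_leq_card; apply/subsetP => x; rewrite !inE => /andP[-> /=].
by rewrite -submxE vecP.
Qed.

Lemma rainbow_free_kernel (P : {set {set pt}}) : rainbow_free H P ->
  forall m (G : 'M[F]_(n.+1, m)), (\rank G <= k)%N ->
  exists x y, [/\ x != y, vec x *m G = 0, vec y *m G = 0 & pblock P x = pblock P y].
Proof.
move=> /forall_inP rf m G rG; have [e eH eG] := hyperedge_kernel rG.
have := rf e eH; rewrite negb_forall_in => /existsP[x /andP[xe]].
rewrite negb_forall_in => /existsP[y /andP[ye]]; rewrite negb_imply negbK => /andP[xy /eqP E].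
by exists x, y; split=> //; apply: eG.
Qed.

Lemma hits_disjoint_subspaces (X1 X2 : 'M[F]_n.+1) (T : {set pt}) : \rank X1 = k.+1 -> \rank X2 = k.+1 ->
  [disjoint pts X1 & pts X2] -> pts X1 \subset T -> pts X2 \subset T -> hits 2 k T.
Proof.
move=> r1 r2 dis s1 s2 m G rG.
have meet (X : 'M[F]_n.+1) : \rank X = k.+1 -> exists2 x, x \in pts X & vec x *m G = 0.
  move=> rX; have [|K rK KX] := @exists_subspace_of_rank F n 1 _ (X :&: kermx G)%MS.
    have := mxrank_mul_ker X G; rewrite rX; have := leq_trans (mxrankM_maxr X G) rG.
    by move: (\rank _) (\rank _) => a b; clear; lia.
  have [x xK] := pt_of_rank1 rK; have : (val x <= X :&: kermx G)%MS by rewrite xK.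
  rewrite sub_capmx sub_kermx => /andP[xX xG]; exists x; first by rewrite mem_pts.
  by apply/eqP; rewrite vec_ker xG.
have [x1 x1X x1G] := meet _ r1; have [x2 x2X x2G] := meet _ r2.
apply/card_gt1P; exists x1, x2; split; rewrite ?inE ?x1G ?x2G ?eqxx ?andbT.
- exact: (subsetP s1 _ x1X).
- exact: (subsetP s2 _ x2X).
- by apply: contraTneq dis => E; rewrite -setI_eq0; apply/set0Pn; exists x1; rewrite inE x1X E.
Qed.

Lemma tau2E : (2 < q)%N -> (2 * k < n)%N -> tau2 H = (2 * gnum q k.+1)%N.
Proof.
move=> q2 k2n; rewrite /tau2.
pose X1 : 'M[F]_n.+1 := pid_mx k.+1.
have r1 : \rank X1 = k.+1 by rewrite rank_pid_mx // ltnS ltnW.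
have [|X2 r2 X2c] := @exists_subspace_of_rank F n k.+1 _ X1^C%MS.
  by rewrite mxrank_compl r1; move: k2n; clear; lia.
have dis : [disjoint pts X1 & pts X2].
  rewrite disjoint_pts -leqn0; apply: leq_trans (mxrankS (capmxS (submx_refl X1) X2c)) _.
  by rewrite capmx_compl mxrank0.
have hT := hits_disjoint_subspaces r1 r2 dis (subsetUl (pts X1) (pts X2)) (subsetUr _ _).
case: arg_minnP => [|T tT min].
  apply/two_transversalP => m G rG; apply: leq_trans (hT _ G rG) _.
  by apply: subset_leq_card; apply: kerptsS; apply: subsetT.
apply/eqP; rewrite eqn_leq; apply/andP; split.
  have /min/leq_trans : two_transversal H (pts X1 :|: pts X2) by apply/two_transversalP.
  apply; apply: leq_trans (leq_card_setU _ _) _.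
  by rewrite !card_pts r1 r2 mul2n -addnn.
have {}tT := two_transversalP _ tT.
have [lt|ge] := ltnP #|T| (q ^ k.+1); first exact: leq_card_hits tT lt.
exact: leq_trans (double_gnum_leq q2 _) ge.
Qed.

Lemma trivial_coloring : strict_coloring #|[set [set: pt]]| [set [set: pt]] &&
  rainbow_free H [set [set: pt]].
Proof.
have part : partition [set [set: pt]] [set: pt].
  rewrite /partition cover1 eqxx trivIset1 inE eq_sym /=.
  by rewrite -card_gt0 cardsT card_pg_point gnumS addn1.
rewrite /strict_coloring part eqxx /=; apply/forall_inP => e /imsetP[U _ ->].
rewrite negb_forall_in.
have : (1 < #|pg_points U|)%N.
  rewrite pg_points_pts card_pts rank_pg_subspace gnumS addn1 ltnS.
  move: kn; rewrite -subn_gt0; case: (n - k)%N => // j _.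
  by rewrite muln_gt0 gnumS addn1 (ltnW (finNzRing_gt1 F)).
case/card_gt1P => x [y [xU yU xy]]; apply/existsP; exists x; rewrite xU /=.
rewrite negb_forall_in; apply/existsP; exists y; rewrite yU /= xy /= negbK.
have /and3P[_ tr _] := part; rewrite !(def_pblock tr (B := setT)) ?inE //.
Qed.

End Translation.

Lemma card_partition_leq (V : finType) (P : {set {set V}}) : partition P [set: V] -> (#|P| <= #|V|)%N.
Proof.
case/and3P => /eqP cP tP P0; rewrite -cardsT -cP -(eqP tP) -sum1_card.
by apply: leq_sum => C CP; rewrite card_gt0; apply: contraNneq P0 => <-.
Qed.

Theorem theorem1p7 (R : rcfType) (n p h q k : nat) (F : finFieldType)
    (delta : R) :
  (2 <= n)%N ->
  prime p -> (1 <= h)%N -> q = (p ^ h)%N -> #|F| = q ->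
  (1 <= k <= n - 1)%N ->
  ([/\ h = 1%N, (11 <= q)%N,
       delta = 2^-1 * ((Num.sqrt 2 - 1) * q%:R ^+ k
                       - 3 * (theta q (k - 1))%:R - 8)
     & 0 <= delta]
   \/
   [/\ (2 <= h)%N, (2 <= k)%N, (25 <= q)%N
     & delta = 2^-1 * (q%:R ^+ (k - 1) - (theta q (k - 2))%:R - 3)]) ->
  ((2 * k < n)%N ->
     tau2 (pg_hypergraph F n (n - k)) = (2 * theta q k)%N
     /\
     forall (N : nat) (P : {set {set pg_point F n}}),
       strict_coloring N P ->
       rainbow_free (pg_hypergraph F n (n - k)) P ->
       (theta q n)%:R - (tau2 (pg_hypergraph F n (n - k)))%:R + 1 - delta
         <= N%:R ->
       (exists2 C : {set pg_point F n}, C \in P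
          & exists U W : pg_subspace F n k,
              [/\ [disjoint pg_points U & pg_points W],
                  pg_points U \subset C & pg_points W \subset C])
       /\
       (exists2 C : {set pg_point F n}, C \in P
          & exists2 T : {set pg_point F n}, T \subset C
              & two_transversal (pg_hypergraph F n (n - k)) T))
  /\
  ((n <= 2 * k)%N ->
     (upper_chromatic (pg_hypergraph F n (n - k)))%:R
       < (theta q n)%:R - 2 * (theta q k)%:R + 1 - delta).
Proof.
move=> n2 pr_p h1 qE cF /andP[k1 kn1] cases.
have kn : (k < n)%N by move: kn1 n2; clear; lia.
have n_gt0 : (0 < n)%N := ltnW n2.
have q11 : (11 <= q)%N by case: cases => [[]|[_ _ q25 _]] //; apply: leq_trans q25.
have q1 : (1 < q)%N := leq_trans (isT : (1 < 11)%N) q11.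
have core N (P : {set {set pg_point F n}}) : strict_coloring N P ->
    rainbow_free (pg_hypergraph F n (n - k)) P ->
    (theta q n)%:R - 2 * (theta q k)%:R + 1 - delta <= N%:R ->
    exists2 C, C \in P & contains_disjoint_subspaces k C.
  move=> /andP[partP /eqP cP] rf leN; rewrite !thetaE // in leN.
  have cV : #|{: pg_point F n}| = gnum q n.+1 by rewrite card_pg_point cF.
  have := card_partition_leq partP; rewrite cP cV => NV.
  have [D DE] : {D | (N + D)%N = gnum q n.+1} by exists (gnum q n.+1 - N)%N; rewrite subnKC.
  apply: (large_coloring_monochromatic (D := D) n_gt0 k1 partP (rainbow_free_kernel kn rf)).
    by rewrite cP DE cV.
  have {leN} leD : D%:R <= 2 * (gnum q k)%:R + 2 * q%:R ^+ k - 1 + delta.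
    by move: leN; rewrite -DE gnumSr !natrD natrX; lra.
  rewrite cF; case: cases => [[hE _ dE _]|[_ k2 q25 dE]].
    left; split => //; first by rewrite qE hE expn1.
    rewrite dE thetaE // subn1 prednK // in leD.
    have s2 : Num.sqrt (2 : R) <= 17 / 12.
      rewrite -(ler_pXn2r (_ : (0 < 2)%N)) ?nnegrE ?sqrtr_ge0 ?sqr_sqrtr //; lra.
    have Q0 : 0 <= q%:R ^+ k :> R by rewrite exprn_ge0.
    have sQ : Num.sqrt 2 * q%:R ^+ k <= 17 / 12 * q%:R ^+ k :> R by rewrite ler_wpM2r.
    rewrite -(ler_nat R) [leLHS]natrD [X in X + _ <= _]natrM [leRHS]natrD [X in _ <= X + _]natrM.
    rewrite [X in _ <= _ + X]natrM natrX.
    lra.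
  right; split=> //.
  rewrite dE thetaE // -[(k - 2).+1](_ : k.-1 = _) ?subn1 in leD; last first.
    by move: k2; case: (k) => [|[|j]] //; rewrite !subSS subn0.
  rewrite -(ler_nat R) [leLHS]natrD [X in X + _ <= _]natrD [X in X + _ + _ <= _]natrM.
  rewrite [leRHS]natrD [X in _ <= X + _]natrM gnumSr [X in _ <= _ * X + _]natrD !natrX.
  lra.
split=> [k2n|nk2].
  rewrite tau2E ?cF ?thetaE //; last by apply: leq_trans q11.
  split=> // N P cP rf leN.
  have [|C CP [X1 [X2 [r1 r2 dis s1 s2]]]] := core N P cP rf.
    by move: leN; rewrite natrM !thetaE.
  have [U UE] := pg_subspace_of_rank r1; have [W WE] := pg_subspace_of_rank r2.
  have eU : pg_points U = pts X1 by apply/setP => x; rewrite !inE UE.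
  have eW : pg_points W = pts X2 by apply/setP => x; rewrite !inE WE.
  split; exists C => //; first by exists U, W; rewrite eU eW.
  exists (pts X1 :|: pts X2); first by rewrite subUset s1.
  apply/two_transversalP => //.
  exact: (hits_disjoint_subspaces r1 r2 dis (subsetUl _ _) (subsetUr _ _)).
rewrite ltNge; apply/negP => le_chi.
have [P /andP[cP rf] chiE] : exists2 P : {set {set pg_point F n}}, strict_coloring #|P| P && rainbow_free (pg_hypergraph F n (n - k)) P &
    upper_chromatic (pg_hypergraph F n (n - k)) = #|P|.
  have := @eq_bigmax_cond _ (fun P : {set {set pg_point F n}} => strict_coloring #|P| P && rainbow_free (pg_hypergraph F n (n - k)) P)
    (fun P : {set {set pg_point F n}} => #|P|).
  case=> [|P cP E]; last by exists P.
  by apply/card_gt0P; exists [set setT]; apply: trivial_coloring.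
rewrite chiE in le_chi; have [C _ [X1 [X2 [r1 r2 dis _ _]]]] := core _ _ cP rf le_chi.
move: dis; rewrite disjoint_pts => /eqP r0; have := mxrank_sum_cap X1 X2; rewrite r0 r1 r2 addn0.
by have := rank_leq_row (X1 + X2)%MS; move: nk2; move: (\rank _); clear; lia.
Qed.
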